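(* Let $H$ be a Hilbert space and $T\in B(H)$ a Fredholm operator of index zero, with $n=\dim(\ker(T))=\dim(\operatorname{ran}(T)^\perp)>0$. Let $P=P_{\mathrm{Gr}(0)}$ and $Q=P_{\mathrm{invGr}(T)}$ be the orthogonal projections of $H\times H$ onto the graph of the null operator and onto the inverse graph of $T$, respectively. Then $1$ is a conjugate parameter of $0$ for the geodesic $\gamma_u:[0,1]\to\mathcal{R}$ with $u=1$ connecting $P$ and $Q$, described in the context. Moreover, the index of this conjugate parameter is $n^2$.
   Context: $\mathrm{Gr}(0)=H\times\{0\}$ and $\mathrm{invGr}(T)=\{(Tx,x):x\in H\}$. $\mathcal{R}=\{\tilde uP\tilde u^*:\tilde u\text{ unitary in }B(H\times H)\}$ is the Riemann sphere of $B(H)$; it contains $Q$. Tangent vectors at $\tilde p\in\mathcal{R}$ are $X\in B(H\times H)$ with $X^*=X$, $X\tilde p+\tilde pX=X$; geodesics are $\gamma(t)=e^{t\tilde X}\tilde pe^{-t\tilde X}$ with $\tilde X=X\tilde p-\tilde pX$. Let $\mathcal{H}_{11}=\operatorname{ran}P\cap\operatorname{ran}Q$, $\mathcal{H}_{00}=\ker P\cap\ker Q$, $\mathcal{H}_{10}=\operatorname{ran}P\cap\ker Q=\operatorname{ran}(T)^\perp\oplus\{0\}$, $\mathcal{H}_{01}=\ker P\cap\operatorname{ran}Q=\{0\}\oplus\ker(T)$ (both of dimension $n$), $\mathcal{H}'=\mathcal{H}_{10}\oplus\mathcal{H}_{01}$, and $\mathcal{H}_0$ the orthogonal complement of the sum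 of these. For an isometric isomorphism $u:\mathcal{H}_{01}\to\mathcal{H}_{10}$, $\gamma_u:[0,1]\to\mathcal{R}$ is the geodesic from $P$ to $Q$ which, with respect to $H\times H=\mathcal{H}_{11}\oplus\mathcal{H}_{00}\oplus\mathcal{H}'\oplus\mathcal{H}_0$, is block diagonal with blocks $1$, $0$, $\begin{pmatrix}\cos^2(t\pi/2)&\cos(t\pi/2)\sin(t\pi/2)u\\\sin(t\pi/2)\cos(t\pi/2)u^*&\sin^2(t\pi/2)\end{pmatrix}$, $\delta_0(t)$, where $\delta_0$ is the unique geodesic of length at most $\pi/2$ (length $=\int\|\dot\gamma\|dt$, operator norm) joining the restrictions of $P$ and $Q$ to $\mathcal{H}_0$. ''$u=1$'' means that a fixed isometric isomorphism is used to identify $\mathcal{H}_{01}$ with $\mathcal{H}_{10}$, and $u$ is this identification. A Jacobi field along a geodesic $\gamma$ is a field along $\gamma$ obtained by differentiating, at $s=0$, a smooth family of perturbations $\gamma_s$ of $\gamma=\gamma_0$ by geodesics that start and end at the same points as $\gamma$. For a geodesic $\gamma(t)$, $t\in[0,1]$, a parameter $t_0$ is conjugate of $0$ along $\gamma$ if there is a non-trivial Jacobi field vanishing at $0$ and at $t_0$; the index of $t_0$ is the (real) dimension of the space of Jacobi fields that vanish at $0$ and at $t_0$. *)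

(* Defs.v *)
From HB Require Import structures.
From mathcomp Require Import all_boot all_order all_algebra sesquilinear complex.
From mathcomp Require Import ring lra.
From mathcomp Require Import all_classical all_reals all_analysis.
Set Implicit Arguments.
Unset Strict Implicit.
Unset Printing Implicit Defensive.
Import Order.TTheory GRing.Theory Num.Theory.
Import numFieldNormedType.Exports.
Local Open Scope classical_set_scope.
Local Open Scope complex_scope.
Local Open Scope ring_scope.

(* hdot is linear in its first argument, conjugate-linear in the second. *)
HB.mixin Record NormedModule_isHilbert (R : realType) H
    & CompleteNormedModule R[i] H := {
  hdot : {dot H for Num.conj};
  sqr_normE : forall x : H, `|x| ^+ 2 = hdot x x
}.

#[short(type="hilbertType")]
HB.structure Definition Hilbert (R : realType) :=
  {H of CompleteNormedModule R[i] H & NormedModule_isHilbert R H}.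

(* The library's norm on a product is the max norm, hence an alias carrying
   the Hilbert norm |(x, y)|^2 = |x|^2 + |y|^2. *)
Definition hprod (R : realType) (H1 H2 : hilbertType R) : Type := (H1 * H2)%type.

Section HilbertProduct.
Context {R : realType} {H1 H2 : hilbertType R}.
Local Notation K := (hprod H1 H2).

HB.instance Definition _ := GRing.Lmodule.copy K (H1 * H2)%type.

Definition hprod_dot (x y : K) : R[i] := hdot x.1 y.1 + hdot x.2 y.2.

Fact hprod_dot_bilinear :
  bilinear_for *%R (Num.conj \; *%R) hprod_dot.
Proof.
split=> [y|x] a u v; rewrite /hprod_dot /=.
  by rewrite !linearPl /= mulrDr addrACA.
by rewrite !linearPr /= mulrDr addrACA.
Qed.

HB.instance Definition _ := bilinear_isBilinear.Build R[i] K K R[i]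
  *%R (Num.conj \; *%R) hprod_dot hprod_dot_bilinear.

Fact hprod_dot_herm (x y : K) :
  hprod_dot x y = (-1) ^+ false * Num.conj (hprod_dot y x).
Proof. by rewrite /hprod_dot rmorphD mulrDr -!hermC. Qed.

HB.instance Definition _ := isHermitianSesquilinear.Build R[i] K false Num.conj
  hprod_dot hprod_dot_herm.

Fact hprod_dot_gt0 (x : K) : x != 0 -> 0 < hprod_dot x x.
Proof.
case: x => x y; rewrite /hprod_dot /= -pair_eqE /= negb_and => /orP[h|h].
  by rewrite ltr_wpDr ?dnorm_gt0 ?dnorm_ge0.
by rewrite ltr_wpDl ?dnorm_gt0 ?dnorm_ge0.
Qed.

HB.instance Definition _ := isDotProduct.Build R[i] K hprod_dot hprod_dot_gt0.

Definition hprod_norm (x : K) : R[i] := sqrtC (hprod_dot x x).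

Fact hprod_sqr (x : K) : hprod_dot x x = `|x.1| ^+ 2 + `|x.2| ^+ 2.
Proof. by rewrite /hprod_dot !sqr_normE. Qed.

Fact hprod_normD (x y : K) : hprod_norm (x + y) <= hprod_norm x + hprod_norm y.
Proof.
have nn (z : K) : 0 <= hprod_norm z by rewrite sqrtC_ge0 dnorm_ge0.
rewrite -(@ler_pXn2r _ 2) ?nnegrE ?addr_ge0//.
rewrite sqrrD ![hprod_norm _ ^+ 2]sqrtCK !hprod_sqr /=.
set a := `|x.1|; set b := `|x.2|; set c := `|y.1|; set d := `|y.2|.
have [a0 b0 c0 d0] : [/\ 0 <= a, 0 <= b, 0 <= c & 0 <= d] by split; exact: normr_ge0.
have cs : a * c + b * d <= hprod_norm x * hprod_norm y.
  rewrite -(@ler_pXn2r _ 2) ?nnegrE ?mulr_ge0 ?addr_ge0 ?mulr_ge0//.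
  rewrite exprMn ![hprod_norm _ ^+ 2]sqrtCK !hprod_sqr -/a -/b -/c -/d.
  rewrite -subr_ge0 (_ : _ - _ = (a * d - b * c) ^+ 2); last by ring.
  by rewrite real_exprn_even_ge0 ?rpredB ?rpredM ?ger0_real.
apply: (@le_trans _ _ ((a + c) ^+ 2 + (b + d) ^+ 2)).
  by rewrite lerD// ler_pXn2r ?nnegrE ?addr_ge0 ?ler_normD.
rewrite -subr_ge0 (_ : _ - _ =
  (hprod_norm x * hprod_norm y - (a * c + b * d)) *+ 2); last by ring.
by rewrite mulrn_wge0// subr_ge0.
Qed.

Fact hprod_normZ a (x : K) : hprod_norm (a *: x) = `|a| * hprod_norm x.
Proof.
rewrite /hprod_norm dnormZ rootCMl ?exprn_ge0 ?normr_ge0//.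
by rewrite sqrCK.
Qed.
Fact hprod_norm_eq0 (x : K) : hprod_norm x = 0 -> x = 0.
Proof. by move/eqP; rewrite sqrt_dnorm_eq0 => /eqP. Qed.

HB.instance Definition _ := Lmodule_isNormed.Build R[i] K
  hprod_normD hprod_normZ hprod_norm_eq0.

Fact hprod_normE (x : K) : `|x| = hprod_norm x. Proof. by []. Qed.

Fact hprod_norm_fst (x : K) : `|x.1| <= `|x|.
Proof.
rewrite hprod_normE -(@ler_pXn2r _ 2) ?nnegrE ?sqrtC_ge0 ?dnorm_ge0//.
by rewrite sqrtCK hprod_sqr lerDl exprn_ge0.
Qed.

Fact hprod_norm_snd (x : K) : `|x.2| <= `|x|.
Proof.
rewrite hprod_normE -(@ler_pXn2r _ 2) ?nnegrE ?sqrtC_ge0 ?dnorm_ge0//.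
by rewrite sqrtCK hprod_sqr lerDr exprn_ge0.
Qed.

Fact hprod_norm_le (x : K) : `|x| <= `|x.1| + `|x.2|.
Proof.
rewrite hprod_normE -(@ler_pXn2r _ 2) ?nnegrE ?sqrtC_ge0 ?dnorm_ge0 ?addr_ge0//.
by rewrite sqrtCK hprod_sqr sqrrD addrAC lerDl mulrn_wge0 ?mulr_ge0.
Qed.

Fact hprod_complete (F : set_system K) : ProperFilter F -> cauchy F -> cvg F.
Proof.
move=> FF Fc.
have cst (V : completeNormedModType R[i]) (f : K -> V) :
    (forall x y : K, `|f x - f y| <= `|x - y|) -> cvg (f @ F).
  move=> fle; apply: cauchy_cvg; apply/cauchy_ballP => e e0.
  move/cauchy_ballP: Fc => /(_ e e0) [] [A B] /= [FA FB] AB.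
  exists (f @` A, f @` B) => /=.
    by split; [apply: filterS FA|apply: filterS FB] => x Ax /=; exists x.
  move=> [_ _] /= [[x Ax <-] [y By <-]].
  have := AB (x, y) (conj Ax By); rewrite -!ball_normE /=.
  exact/le_lt_trans/fle.
have /cvg_ex[/= l1 F1] := cst H1 fst (fun x y => hprod_norm_fst (x - y)).
have /cvg_ex[/= l2 F2] := cst H2 snd (fun x y => hprod_norm_snd (x - y)).
apply/cvg_ex; exists ((l1, l2) : K); apply/cvgrPdist_lt => e e0.
have e2 : 0 < e / 2 by rewrite divr_gt0.
move/cvgrPdist_lt: F1 => /(_ _ e2) F1; move/cvgrPdist_lt: F2 => /(_ _ e2) F2.
near=> z; rewrite (le_lt_trans (hprod_norm_le _))// (splitr e) ltrD//=.
  by near: z; exact: F1.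
by near: z; exact: F2.
Unshelve. all: by end_near. Qed.

HB.instance Definition _ := Uniform_isComplete.Build K hprod_complete.

Fact hprod_sqr_normE (x : K) : `|x| ^+ 2 = hprod_dot x x.
Proof. by rewrite hprod_normE sqrtCK. Qed.

HB.instance Definition _ := NormedModule_isHilbert.Build R K hprod_sqr_normE.

End HilbertProduct.

(* B(V) is a real normed space here: curves and Jacobi fields only involve real
   scalars, and dimensions of spaces of Jacobi fields are real dimensions. *)
Section BoundedOperators.
Context {R : realType}.

Section Def.
Variable V : normedModType R[i].

Record bop : Type := Bop {
  bop_fun :> V -> V;
  bop_linear : linear bop_fun;
  bop_bounded : exists M : R, forall x, `|bop_fun x| <= M%:C * `|x|
}.
HB.instance Definition _ := gen_eqMixin bop.
HB.instance Definition _ := gen_choiceMixin bop.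
HB.instance Definition _ (A : bop) :=
  GRing.isLinear.Build R[i] V V *:%R A (bop_linear A).

Lemma bop_ext (A B : bop) : A =1 B -> A = B.
Proof.
case: A B => [f fl fb] [g gl gb] /= /funext fg; rewrite fg in fl fb *.
by congr Bop; exact: Prop_irrelevance.
Qed.

Definition rnorm (x : V) : R := complex.Re `|x|.
Lemma rnormE x : (rnorm x)%:C = `|x|.
Proof. by apply: RRe_real; exact: normr_real. Qed.
Lemma rnorm_ge0 x : 0 <= rnorm x.
Proof. by rewrite -lecR rnormE; exact: normr_ge0. Qed.
Lemma rnormD x y : rnorm (x + y) <= rnorm x + rnorm y.
Proof. by rewrite -lecR rmorphD /= !rnormE ler_normD. Qed.
Lemma rnormZ (a : R) x : rnorm (a%:C *: x) = `|a| * rnorm x.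
Proof.
apply: complexI; rewrite rmorphM /= !rnormE normrZ normc_def /=.
by rewrite expr0n addr0 sqrtr_sqr.
Qed.

Lemma bop_boundedR (A : bop) :
  exists2 M : R, 0 <= M & forall x, rnorm (A x) <= M * rnorm x.
Proof.
have [M h] := bop_bounded A; exists `|M| => // x.
rewrite (@le_trans _ _ (M * rnorm x))//; last first.
  by apply: ler_wpM2r; [exact: rnorm_ge0|exact: ler_norm].
by rewrite -lecR rmorphM /= !rnormE.
Qed.

Lemma bop_bound_of (f : V -> V) (M : R) :
  (forall x, rnorm (f x) <= M * rnorm x) ->
  exists M : R, forall x, `|f x| <= M%:C * `|x|.
Proof.
by move=> h; exists M => x; rewrite -!rnormE -rmorphM lecR.
Qed.

Fact bop_zero_linear : linear (fun _ : V => 0 : V).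
Proof. by move=> a x y; rewrite scaler0 addr0. Qed.
Fact bop_zero_bounded : exists M : R, forall x : V, `|0 : V| <= M%:C * `|x|.
Proof. by exists 0 => x; rewrite normr0 mul0r. Qed.
Definition bop_zero := Bop bop_zero_linear bop_zero_bounded.

Fact bop_one_linear : linear (fun x : V => x).
Proof. by []. Qed.
Fact bop_one_bounded : exists M : R, forall x : V, `|x| <= M%:C * `|x|.
Proof. by exists 1 => x; rewrite mul1r. Qed.
Definition bop_one := Bop bop_one_linear bop_one_bounded.

Fact bop_add_linear (A B : bop) : linear (fun x => A x + B x).
Proof. by move=> a x y; rewrite !linearP scalerDr addrACA. Qed.
Fact bop_add_bounded (A B : bop) :
  exists M : R, forall x, `|A x + B x| <= M%:C * `|x|.
Proof.
have [M M0 hM] := bop_boundedR A; have [N N0 hN] := bop_boundedR B.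
apply: (@bop_bound_of _ (M + N)) => x.
by rewrite (le_trans (rnormD _ _))// mulrDl lerD.
Qed.
Definition bop_add A B := Bop (bop_add_linear A B) (bop_add_bounded A B).

Fact bop_opp_linear (A : bop) : linear (fun x => - A x).
Proof. by move=> a x y; rewrite linearP opprD scalerN. Qed.
Fact bop_opp_bounded (A : bop) :
  exists M : R, forall x, `|- A x| <= M%:C * `|x|.
Proof. by have [M h] := bop_bounded A; exists M => x; rewrite normrN. Qed.
Definition bop_opp A := Bop (bop_opp_linear A) (bop_opp_bounded A).

Fact bop_scale_linear (a : R) (A : bop) : linear (fun x => a%:C *: A x).
Proof. by move=> b x y; rewrite linearP scalerDr !scalerA mulrC. Qed.
Fact bop_scale_bounded (a : R) (A : bop) :
  exists M : R, forall x, `|a%:C *: A x| <= M%:C * `|x|.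
Proof.
have [M M0 hM] := bop_boundedR A; apply: (@bop_bound_of _ (`|a| * M)) => x.
by rewrite rnormZ -mulrA ler_wpM2l.
Qed.
Definition bop_scale a A := Bop (bop_scale_linear a A) (bop_scale_bounded a A).

Fact bop_comp_linear (A B : bop) : linear (fun x => A (B x)).
Proof. by move=> a x y; rewrite !linearP. Qed.
Fact bop_comp_bounded (A B : bop) :
  exists M : R, forall x, `|A (B x)| <= M%:C * `|x|.
Proof.
have [M M0 hM] := bop_boundedR A; have [N N0 hN] := bop_boundedR B.
apply: (@bop_bound_of _ (M * N)) => x.
by rewrite (le_trans (hM _))// -mulrA ler_wpM2l.
Qed.
Definition bop_comp A B := Bop (bop_comp_linear A B) (bop_comp_bounded A B).

Fact bop_addA : associative bop_add.
Proof. by move=> A B D; apply: bop_ext => x /=; rewrite addrA. Qed.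
Fact bop_addC : commutative bop_add.
Proof. by move=> A B; apply: bop_ext => x /=; rewrite addrC. Qed.
Fact bop_add0 : left_id bop_zero bop_add.
Proof. by move=> A; apply: bop_ext => x /=; rewrite add0r. Qed.
Fact bop_addN : left_inverse bop_zero bop_opp bop_add.
Proof. by move=> A; apply: bop_ext => x /=; rewrite addNr. Qed.
HB.instance Definition _ :=
  GRing.isZmodule.Build bop bop_addA bop_addC bop_add0 bop_addN.

Fact bop_compA : associative bop_comp.
Proof. by move=> A B D; apply: bop_ext. Qed.
Fact bop_comp1l : left_id bop_one bop_comp.
Proof. by move=> A; apply: bop_ext. Qed.
Fact bop_comp1r : right_id bop_one bop_comp.
Proof. by move=> A; apply: bop_ext. Qed.
Fact bop_compDl : left_distributive bop_comp bop_add.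
Proof. by move=> A B D; apply: bop_ext. Qed.
Fact bop_compDr : right_distributive bop_comp bop_add.
Proof. by move=> A B D; apply: bop_ext => x /=; rewrite linearD. Qed.
HB.instance Definition _ := GRing.Zmodule_isPzRing.Build bop
  bop_compA bop_comp1l bop_comp1r bop_compDl bop_compDr.

Fact bop_scaleA a b A : bop_scale a (bop_scale b A) = bop_scale (a * b) A.
Proof. by apply: bop_ext => x /=; rewrite scalerA -rmorphM. Qed.
Fact bop_scale1 : left_id 1 bop_scale.
Proof. by move=> A; apply: bop_ext => x /=; rewrite scale1r. Qed.
Fact bop_scaleDr : right_distributive bop_scale +%R.
Proof. by move=> a A B; apply: bop_ext => x /=; rewrite scalerDr. Qed.
Fact bop_scaleDl A : {morph bop_scale^~ A : a b / a + b}.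
Proof. by move=> a b; apply: bop_ext => x /=; rewrite rmorphD scalerDl. Qed.
HB.instance Definition _ := GRing.Zmodule_isLmodule.Build R bop
  bop_scaleA bop_scale1 bop_scaleDr bop_scaleDl.

Definition opnorm (A : bop) : R :=
  sup [set rnorm (A x) | x in [set x : V | `|x| <= 1]].

Lemma opnorm_has_sup (A : bop) :
  has_sup [set rnorm (A x) | x in [set x : V | `|x| <= 1]].
Proof.
split; first by exists (rnorm (A 0)), 0; rewrite //= normr0.
have [M M0 hM] := bop_boundedR A; exists M => _ [x /= x1 <-].
rewrite (le_trans (hM x))// ler_piMr// -lecR rnormE//.
Qed.

Lemma opnorm_ge0 A : 0 <= opnorm A.
Proof.
apply: (le_trans (rnorm_ge0 (A 0))); apply: sup_upper_bound.
  exact: opnorm_has_sup.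
by exists 0; rewrite //= normr0.
Qed.

Lemma opnorm_le (A : bop) (M : R) :
  (forall x, `|x| <= 1 -> rnorm (A x) <= M) -> opnorm A <= M.
Proof.
move=> h; apply: ge_sup; first by have [] := opnorm_has_sup A.
by move=> _ [x /= x1 <-]; exact: h.
Qed.

Lemma opnormP (A : bop) x : rnorm (A x) <= opnorm A * rnorm x.
Proof.
have [->|x0] := eqVneq x 0.
  by rewrite linear0 /rnorm normr0 mulr0.
have rx : 0 < rnorm x by rewrite -ltcR rnormE normr_gt0.
rewrite -ler_pdivrMr// mulrC -[(_)^-1]ger0_norm ?invr_ge0 ?rnorm_ge0//.
rewrite -rnormZ -linearZ; apply: sup_upper_bound; first exact: opnorm_has_sup.
exists ((rnorm x)^-1%:C *: x) => //=.
by rewrite -rnormE rnormZ ger0_norm ?invr_ge0 ?rnorm_ge0// mulVf ?gt_eqF.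
Qed.

Fact opnormD A B : opnorm (A + B) <= opnorm A + opnorm B.
Proof.
apply: opnorm_le => x x1; rewrite (le_trans (rnormD _ _))// lerD//.
  by apply: sup_upper_bound; [exact: opnorm_has_sup|exists x].
by apply: sup_upper_bound; [exact: opnorm_has_sup|exists x].
Qed.

Fact opnormZ_le a A : opnorm (a *: A) <= `|a| * opnorm A.
Proof.
apply: opnorm_le => x x1; rewrite rnormZ ler_wpM2l//.
by apply: sup_upper_bound; [exact: opnorm_has_sup|exists x].
Qed.

Fact opnormZ (a : R) A : opnorm (a *: A) = `|a| * opnorm A.
Proof.
apply/eqP; rewrite eq_le opnormZ_le /=.
have [->|a0] := eqVneq a 0; first by rewrite normr0 mul0r opnorm_ge0.
rewrite -ler_pdivlMl ?normr_gt0// -normfV (le_trans _ (opnormZ_le _ _))//.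
by rewrite scalerA mulVf// scale1r.
Qed.

Fact opnorm_eq0 A : opnorm A = 0 -> A = 0.
Proof.
move=> A0; apply: bop_ext => x /=; apply/eqP; rewrite -normr_eq0 -rnormE.
have := opnormP A x; rewrite A0 mul0r => h.
by rewrite (_ : rnorm _ = 0)//; apply/le_anti; rewrite h rnorm_ge0.
Qed.

HB.instance Definition _ := Lmodule_isNormed.Build R bop
  opnormD opnormZ opnorm_eq0.

End Def.
End BoundedOperators.


Definition has_dim (F : fieldType) (V : lmodType F) (S : set V) (d : nat) :=
  exists e : 'I_d -> V,
    (forall c : 'I_d -> F, \sum_i c i *: e i = 0 -> forall i, c i = 0) /\
    (forall v, S v <-> exists c : 'I_d -> F, v = \sum_i c i *: e i).

Section Operators.
Context {R : realType} {H : hilbertType R}.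

Definition adjoint (A B : bop H) := forall x y, hdot (A x) y = hdot x (B y).
Definition selfadjoint (A : bop H) := adjoint A A.

Definition ran (A : bop H) : set H := range A.
Definition ker (A : bop H) : set H := [set x | A x = 0].
Definition orth (S : set H) : set H :=
  [set x | forall y, S y -> hdot x y = 0].
Definition sumset (S1 S2 : set H) : set H :=
  [set x + y | x in S1 & y in S2].

Definition orthoprojection (S : set H) (A : bop H) :=
  forall x, S (A x) /\ orth S (x - A x).

Definition fredholm (T : bop H) :=
  [/\ exists d, has_dim (ker T) d, closed (ran T)
    & exists d, has_dim (orth (ran T)) d].
Definition fredholm_index (T : bop H) (k : int) :=
  exists d1 d2, [/\ has_dim (ker T) d1, has_dim (orth (ran T)) d2
    & k = d1%:Z - d2%:Z].

Definition opexp (A : bop H) : bop H :=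
  limn (series (fun k => k`!%:R^-1 *: A ^+ k)).

(* V is the adjoint of the unitary U. *)
Definition riemann_sphere (P : bop H) : set (bop H) :=
  [set p | exists U V : bop H,
     [/\ adjoint U V, U * V = 1, V * U = 1 & p = U * P * V]].

Definition tangent (p X : bop H) := selfadjoint X /\ X * p + p * X = X.

Definition geod (p X : bop H) (t : R) : bop H :=
  let Z := X * p - p * X in opexp (t *: Z) * p * opexp (- (t *: Z)).

(* Geodesics are complete: one parametrized by [0, 1] is the restriction of a
   unique one defined on the whole line, and curves are kept as maps on R. *)
Definition geodesic (P : bop H) (g : R -> bop H) :=
  exists p X, [/\ riemann_sphere P p, tangent p X & forall t, g t = geod p X t].

Definition curve_length (g : R -> bop H) : \bar R :=
  (\int[lebesgue_measure]_(t in `[0%R, 1%R]) (`|derive1 g t|)%:E)%E.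

End Operators.

(* Class C^k on an open set D, through iterated directional derivatives. *)
Fixpoint Ck_on (R : realType) (U V : normedModType R) (D : set U) (k : nat)
    (F : U -> V) : Prop :=
  (forall p, D p -> {for p, continuous F}) /\
  if k is k'.+1 then
    forall v, (forall p, D p -> derivable F p v) /\ Ck_on D k' ('D_v F)
  else True.
Definition smooth_on (R : realType) (U V : normedModType R) (D : set U)
  (F : U -> V) := forall k, Ck_on D k F.

Section Jacobi.
Context {R : realType} {H : hilbertType R}.
Variable P : bop H.

Local Notation I01 := (`[0%R, 1%R]%classic : set R).

Definition jacobi_field (g : R -> bop H) (J : I01 -> bop H) :=
  exists (e : R) (G : R -> R -> bop H), 0 < e /\
  [/\ smooth_on [set p : R * R | `|p.1| < e] (fun p => G p.1 p.2),
      forall s, `|s| < e -> [/\ geodesic P (G s), G s 0 = g 0 & G s 1 = g 1],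
      forall t, G 0 t = g t
    & forall t : I01, J t = derive1 (fun s => G s (val t)) 0].

Definition jacobi_vanishing (g : R -> bop H) (t0 : R) : set (I01 -> bop H) :=
  [set J | jacobi_field g J /\
     forall t : I01, val t = 0 \/ val t = t0 -> J t = 0].

Definition conjugate_parameter (g : R -> bop H) (t0 : R) :=
  I01 t0 /\ exists J, jacobi_vanishing g t0 J /\ J <> 0.

Definition conjugate_index (g : R -> bop H) (t0 : R) (d : nat) :=
  has_dim (F := R) (jacobi_vanishing g t0) d.

End Jacobi.

Section Geodesic.
Context {R : realType} {H : hilbertType R}.
Implicit Types P Q : bop H.

Definition isometric_iso (S1 S2 : set H) (u : H -> H) :=
  [/\ forall x, S1 x -> S2 (u x),
      forall (a : R[i]) x y, S1 x -> S1 y -> u (a *: x + y) = a *: u x + u y,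
      forall x, S1 x -> `|u x| = `|x|
    & forall y, S2 y -> exists2 x, S1 x & u x = y].

Definition adjoint_between (S1 S2 : set H) (u v : H -> H) :=
  (forall y, S2 y -> S1 (v y)) /\
  (forall x y, S1 x -> S2 y -> hdot (u x) y = hdot x (v y)).

Definition H11 P Q := ran P `&` ran Q.
Definition H00 P Q := ker P `&` ker Q.
Definition H10 P Q := ran P `&` ker Q.
Definition H01 P Q := ker P `&` ran Q.
Definition Hprime P Q := sumset (H10 P Q) (H01 P Q).
Definition H0 P Q := orth (sumset (sumset (H11 P Q) (H00 P Q)) (Hprime P Q)).

(* With E the projection onto the subspace S, an operator B on S is identified
   with the operator B E on the whole space.  So d is a curve of operators on
   S; it is a geodesic when its velocity X at p is an operator on S too. *)
Definition geodesic_in (E : bop H) (d : R -> bop H) :=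
  exists p X, [/\ E * p * E = p, E * X * E = X,
    selfadjoint p /\ p * p = p, tangent p X & forall t, d t = geod p X t].

Definition is_gamma P Q (u : H -> H) (g : R -> bop H) :=
  [/\ geodesic P g, g 0 = P, g 1 = Q,
    exists2 v, adjoint_between (H01 P Q) (H10 P Q) u v &
      forall t : R, 0 <= t <= 1 ->
      let c := (cos (t * pi / 2))%:C in let s := (sin (t * pi / 2))%:C in
      [/\ forall x, H11 P Q x -> g t x = x,
          forall x, H00 P Q x -> g t x = 0
        & forall x y, H10 P Q x -> H01 P Q y ->
          g t (x + y) = (c ^+ 2 *: x + (c * s) *: u y)
                      + ((s * c) *: v x + s ^+ 2 *: y)]
  & exists E : bop H, let d t := g t * E in
    [/\ orthoprojection (H0 P Q) E, forall t, E * g t = g t * E,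
        geodesic_in E d, d 0 = P * E /\ d 1 = Q * E
      & (curve_length d <= (pi / 2)%:E)%E]].

End Geodesic.

Definition graph (R : realType) (H : hilbertType R) (T : bop H) :
  set (hprod H H) := [set z | exists x, z = (x, T x)].
Definition invgraph (R : realType) (H : hilbertType R) (T : bop H) :
  set (hprod H H) := [set z | exists x, z = (T x, x)].

(* Main.v *)
(** Write eps = 2P - 1, W = (2Q - 1) eps and gamma(t) = e^{tZ} P e^{-tZ} with Z skew-adjoint and
    anticommuting with eps; a geodesic from P with generator Z' ends at Q iff e^{2Z'} = W.  The
    hypotheses on gamma give |Z| <= pi/2, and Z^2 = -(pi/2)^2 on ker(W + 1) = H10 + H01.
    Differentiating e^{2 Z_s} = W along a family of geodesics, the velocity V of Z_s commutes with
    W.  Off ker(W + 1) this forces V to commute with Z, because e^{Z/2^k} is recovered from its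
    square as the root with nonnegative real part (here |Z| <= pi/2 enters), and Z from these
    roots.  On ker(W + 1) the part of V anticommuting with Z is a bracket [B, Z], so it comes from
    the rotation e^{sB} gamma e^{-sB}; what remains commutes with Z, changes e^{2Z} to first
    order, and must vanish.  Hence the Jacobi fields are t |-> [B, gamma(t)] with B skew-adjoint,
    and B can be taken on H01 since (2P - 1)B commutes with gamma.  Such B form a real space of
    dimension n^2, and B is determined by the field since Z is invertible on H10 + H01. *)

From HB Require Import structures.
From Stdlib Require Algebra_syntax Ncring Ncring_tac.
Require Import Defs.
From mathcomp Require Import all_boot all_order all_algebra sesquilinear complex.
From mathcomp Require Import ring lra.
From mathcomp Require Import all_classical all_reals all_analysis.
Set Implicit Arguments.
Unset Strict Implicit.
Unset Printing Implicit Defensive.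
Import Order.TTheory GRing.Theory Num.Theory.
Import numFieldNormedType.Exports.
Local Open Scope classical_set_scope.
Local Open Scope complex_scope.
Local Open Scope ring_scope.

(** The end point condition e^{2Z'} = W holds because eps e^{-tZ} = e^{tZ} eps. The obstacle is that
    the bound pi/2 is attained on ker(W + 1): there exp is not injective near 2Z, so Z_s cannot be
    recovered from W. The spectral theorem is avoided; facts about e^A come from norms and quadratic
    forms. The root argument runs as follows. If e^{2A} commutes with V, then Y = e^A V e^{-A} - V
    satisfies e^A Y = - Y e^A, and Re e^A >= 0 forces (e^A + e^{-A}) Y = 0. For A = Z this puts the
    range of Y inside ker(W + 1); for A = Z/2^k with k >= 1 the norm is at most pi/4 and e^A +
    e^{-A} is injective. Rotating by e^{sB} also avoids differentiating exp in a direction that does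
    not commute with Z: after the rotation the velocity commutes with Z, and the scalar formula for
    the derivative applies. The length hypothesis bounds Z on H0 only; off H0 the bound comes from
    the explicit blocks of gamma. *)

#[local] Instance ncring_ops (A : pzRingType) :
  @Ncring.Ring_ops A 0 1 +%R *%R (fun x y => x - y) -%R (@eq A) := {}.
#[local] Instance ncring (A : pzRingType) : Ncring.Ring (Ro := ncring_ops A).
Proof.
split; first exact: RelationClasses.eq_equivalence.
- by move=> ? ? -> ? ? ->.
- by move=> ? ? -> ? ? ->.
- by move=> ? ? -> ? ? ->.
- by move=> ? ? ->.
- exact: (@add0r A).
- exact: (@addrC A).
- exact: (@addrA A).
- exact: (@mul1r A).
- exact: (@mulr1 A).
- exact: (@mulrA A).
- exact: (@mulrDl A).
- exact: (fun x y z => @mulrDr A z x y).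
- by [].
- exact: (@subrr A).
Qed.
(** Settles identities between operators, respecting the order of the factors. *)
Ltac ncring := Ncring_tac.non_commutative_ring.

(** * The Banach algebra of bounded operators *)

Section BopNorm.
Context {R : realType} {V : normedModType R[i]}.
Implicit Types (A B : bop V) (x : V).

Lemma bop_mulE A B x : (A * B) x = A (B x). Proof. by []. Qed.
Lemma bop_addE A B x : (A + B) x = A x + B x. Proof. by []. Qed.
Lemma bop_oppE A x : (- A) x = - A x. Proof. by []. Qed.
Lemma bop_subE A B x : (A - B) x = A x - B x. Proof. by []. Qed.
Lemma bop_scaleE (a : R) A x : (a *: A) x = a%:C *: A x. Proof. by []. Qed.
Lemma bop_oneE x : (1 : bop V) x = x. Proof. by []. Qed.
Lemma bop_zeroE x : (0 : bop V) x = 0. Proof. by []. Qed.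
Lemma bop_funZ A (c : R[i]) x : A (c *: x) = c *: A x.
Proof. exact: linearZ. Qed.
Lemma bop_sumE (I : Type) (r : seq I) (p : pred I) (F : I -> bop V) x :
  (\sum_(i <- r | p i) F i) x = \sum_(i <- r | p i) F i x.
Proof.
by elim/big_ind2 : _ => // A1 y1 A2 y2 <- <-.
Qed.
Definition bopE :=
  (bop_subE, bop_addE, bop_oppE, bop_scaleE, bop_mulE, bop_oneE, bop_zeroE).

Lemma bop_scaleAl (a : R) A B : a *: (A * B) = (a *: A) * B.
Proof. by apply: bop_ext. Qed.
Lemma bop_scaleAr (a : R) A B : a *: (A * B) = A * (a *: B).
Proof. by apply: bop_ext => x; rewrite !bopE linearZ. Qed.

Lemma rnormN x : rnorm (- x) = rnorm x. Proof. by rewrite /rnorm normrN. Qed.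

Lemma bop_norm_le A (M : R) : 0 <= M ->
  (forall x, rnorm (A x) <= M * rnorm x) -> `|A| <= M.
Proof.
move=> M0 h; apply: opnorm_le => x x1; apply: (le_trans (h x)).
by rewrite ler_piMr// -lecR rnormE.
Qed.

Lemma bop_normP A x : rnorm (A x) <= `|A| * rnorm x.
Proof. exact: opnormP. Qed.

Lemma bop_normM A B : `|A * B| <= `|A| * `|B|.
Proof.
apply: bop_norm_le => [|x]; first exact: mulr_ge0.
rewrite bopE (le_trans (bop_normP _ _))// -mulrA ler_wpM2l//.
exact: bop_normP.
Qed.

Lemma bop_norm1 : `|1 : bop V| <= 1.
Proof. by apply: bop_norm_le => // x; rewrite mul1r. Qed.

Lemma bop_normX A k : `|A ^+ k| <= `|A| ^+ k.
Proof.
elim: k => [|k IH]; first by rewrite !expr0 bop_norm1.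
by rewrite !exprS (le_trans (bop_normM _ _))// ler_wpM2l.
Qed.

Lemma bop_cvgM (T : Type) (F : set_system T) {FF : Filter F}
    (f g : T -> bop V) A B :
  f @ F --> A -> g @ F --> B -> (fun t => f t * g t) @ F --> A * B.
Proof.
move=> fA gB; apply/cvgrPdist_le => e e0.
(* [d <= 1] turns the product of the two errors into a linear term; the other bound makes the total
   at most [e]. *)
pose d := Num.min 1 (e / (1 + `|A| + `|B|)).
have K0 : 0 < 1 + `|A| + `|B| by rewrite -addrA ltr_pwDl// addr_ge0.
have d0 : 0 < d by rewrite lt_min ltr01 divr_gt0.
move/cvgrPdist_le : fA => /(_ _ d0) fA; move/cvgrPdist_le : gB => /(_ _ d0) gB.
near=> t.
have h1 : `|A - f t| <= d by near: t.
have h2 : `|B - g t| <= d by near: t.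
have -> : A * B - f t * g t = (A - f t) * B + A * (B - g t) - (A - f t) * (B - g t).
  by ncring.
rewrite (le_trans (ler_normB _ _))// (le_trans (lerD (ler_normD _ _) (lexx _)))//.
have hd : d * (1 + `|A| + `|B|) <= e.
  by rewrite -ler_pdivlMr// ge_min lexx orbT.
apply: le_trans hd.
have d1 : d <= 1 by rewrite ge_min lexx.
have -> : d * (1 + `|A| + `|B|) = d * `|B| + `|A| * d + d * 1 by ring.
rewrite !lerD// (le_trans (bop_normM _ _))//.
- by rewrite ler_wpM2r.
- by rewrite ler_wpM2l.
- by rewrite ler_pM// (le_trans h2).
Unshelve. all: end_near. Qed.

End BopNorm.

Section BopComplete.
Context {R : realType} {V : completeNormedModType R[i]}.

(** The limit is taken pointwise in [V]. The Cauchy estimate survives uniformly in [x], which gives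
    both boundedness of the limit and convergence in norm. *)
Fact bop_complete (F : set_system (bop V)) : ProperFilter F -> cauchy F -> cvg F.
Proof.
move=> FF /cauchy_ballP Fc.
have Fc' (e : R) : 0 < e -> \forall p \near (F, F), `|p.1 - p.2| <= e.
  move=> e0; have := Fc _ e0; apply: filterS => -[A B] /=.
  by rewrite -ball_normE /= => /ltW.
have cvx x : cvg ((fun A : bop V => A x) @ F).
  apply: cauchy_cvg; apply/cauchy_ballP => e e0.
  (* Radii in [V] lie in [R[i]] and radii in [bop V] in [R], hence the real part of [e] below; the
     [+ 1] covers [x = 0]. *)
  have r0 : 0 < rnorm x + 1 by rewrite ltr_wpDl ?rnorm_ge0.
  have re : 0 < complex.Re e by move: e0; rewrite ltcE => /andP[].
  have d0 : 0 < complex.Re e / (rnorm x + 1) by rewrite divr_gt0.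
  have [[S1 S2] /= [F1 F2] h] := Fc _ d0.
  exists ((fun A : bop V => A x) @` S1, (fun A : bop V => A x) @` S2).
    by split; [apply: filterS F1|apply: filterS F2] => A SA /=; exists A.
  move=> [_ _] [[A SA <-] [B SB <-]] /=.
  have := h (A, B) (conj SA SB); rewrite -!ball_normE /= => hAB.
  rewrite -bop_subE -rnormE -(RRe_real (gtr0_real e0)) ltcR.
  rewrite (le_lt_trans (bop_normP _ _))//.
  move: hAB; rewrite ltr_pdivlMr//; apply: le_lt_trans.
  by rewrite ler_wpM2l// lerDl.
pose f x := lim ((fun A : bop V => A x) @ F).
have fP x : (fun A : bop V => A x) @ F --> f x by exact: cvx.
have fl : linear f.
  move=> a x y; apply: cvg_lim => //.
  under eq_fun do rewrite linearP.
  by apply: cvgD; [exact: (cvgZ (cvg_cst _) (fP x))|exact: fP].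
have fB (e : R) : 0 < e ->
    \forall A \near F, forall x, rnorm ((A : bop V) x - f x) <= e * rnorm x.
  move=> e0; have [[S1 S2] /= [F1 F2] h] := Fc' _ e0.
  near=> A => x.
  have SA : S1 A by near: A.
  apply/ler_addgt0Pr => d d0.
  have dC : 0 < d%:C by rewrite ltcR.
  move/cvgrPdist_le : (fP x) => /(_ _ dC) fxd.
  have [B [SB hB]] := filter_ex (filterI F2 fxd).
  have -> : A x - f x = (A - B) x - (f x - B x) by rewrite bopE opprB addrA subrK.
  rewrite (le_trans (rnormD _ _))// rnormN lerD//; last by rewrite -lecR rnormE.
  rewrite (le_trans (bop_normP _ _))// ler_wpM2r ?rnorm_ge0//.
  exact: (h (A, B)).
have fb : exists M : R, forall x, `|f x| <= M%:C * `|x|.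
  have /filter_ex [A hA] := fB 1 ltr01.
  apply: (@bop_bound_of _ _ _ (`|A| + 1)) => x.
  rewrite -[f x](subKr (A x)) (le_trans (rnormD _ _))// rnormN mulrDl.
  by rewrite lerD ?bop_normP.
apply/cvg_ex; exists (Bop fl fb); apply/cvgrPdist_le => e e0.
have := fB _ e0; apply: filterS => A hA.
by rewrite distrC; apply: bop_norm_le (ltW e0) _.
Unshelve. all: by end_near. Qed.

HB.instance Definition _ := Uniform_isComplete.Build (bop V) bop_complete.

End BopComplete.

(** Meant for the Cauchy product of two exponential series: the triangle, summed by antidiagonals,
    is a partial sum of the product series, and the corner is the error. *)
Lemma big_antidiag (M : zmodType) (F : nat -> nat -> M) (N : nat) :
  \sum_(i < N) \sum_(j < N) F i j =
  \sum_(k < N) \sum_(i < k.+1) F i (k - i)%N +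
  \sum_(i < N) \sum_(j < N | (N <= i + j)%N) F i j.
Proof.
have -> : \sum_(k < N) \sum_(i < k.+1) F i (k - i)%N =
    \sum_(i < N) \sum_(j < N | ~~ (N <= i + j)%N) F i j.
  transitivity (\sum_(k < N) \sum_(i < N | (i <= k)%N) F i (k - i)%N).
    apply: eq_bigr => k _.
    by rewrite (big_ord_narrow_cond (P := xpredT) (F := fun i => F i (k - i)%N) (ltn_ord k))//.
  under eq_bigr do rewrite big_mkcond.
  rewrite exchange_big; apply: eq_bigr => i _ /=.
  rewrite -big_mkcond/=.
  rewrite (eq_bigr (fun k : 'I_N => \sum_(j < N | (j : nat) == (k - i)%N) F i j)); last first.
    move=> k ik; have kN : (k - i < N)%N by rewrite (leq_ltn_trans (leq_subr _ _)).
    by rewrite (big_pred1 (Ordinal kN)).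
  rewrite (exchange_big_dep (fun j : 'I_N => ~~ (N <= i + j)%N))/=; last first.
    by move=> k j ik /eqP ->; rewrite subnKC// -ltnNge.
  apply: eq_bigr => j; rewrite -ltnNge => ij.
  rewrite (big_pred1 (Ordinal ij))// => k /=.
  rewrite -val_eqE /=; apply/andP/eqP => [[ik /eqP ->]|->]; first by rewrite subnKC.
  by rewrite leq_addr addKn.
rewrite -big_split; apply: eq_bigr => i _ /=.
by rewrite (bigID (fun j : 'I_N => (N <= i + j)%N)) /= addrC.
Qed.

(** * Operator exponentials *)

Section Exp.
Context {R : realType} {H : hilbertType R}.
Implicit Types (A B U V : bop H).

Local Notation T A := (fun k => k`!%:R^-1 *: A ^+ k).

Lemma bop_normT A k : `|T A k| <= exp_coeff `|A| k.
Proof.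
rewrite normrZ ger0_norm ?invr_ge0// mulrC /exp_coeff /=.
by rewrite ler_wpM2r ?invr_ge0// bop_normX.
Qed.

Lemma opexp_cvg A : series (T A) @ \oo --> opexp A.
Proof.
apply: normed_cvg; apply: (series_le_cvg _ _ (bop_normT A)) => //.
- by move=> k; exact: exp_coeff_ge0.
- exact: is_cvg_series_exp_coeff.
Qed.

Lemma norm_cvg_le (u : nat -> bop H) (v : nat -> R) A (a : R) :
  u @ \oo --> A -> v @ \oo --> a -> (forall n, `|u n| <= v n) -> `|A| <= a.
Proof.
move=> uA va uv; apply: (ler_cvg_to (cvg_norm uA) va).
by near=> n; exact: uv.
Unshelve. all: by end_near. Qed.

Lemma expR_cvg (a : R) : series (exp_coeff a) @ \oo --> expR a.
Proof. rewrite /expR; exact: is_cvg_series_exp_coeff. Qed.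

Lemma opexp0 : opexp (0 : bop H) = 1.
Proof.
apply: (cvg_lim (@norm_hausdorff _ _)).
rewrite -(cvg_shiftS _) /=; apply: cvg_near_cst; near=> n.
rewrite /series /= big_nat_recl//= fact0 invr1 scale1r expr0 big1 ?addr0// => i _.
by rewrite expr0n /= scaler0.
Unshelve. all: by end_near. Qed.

Lemma binom_coeff n i : (i <= n)%N ->
  (n`!%:R : R)^-1 * 'C(n, i)%:R = (n - i)`!%:R^-1 * i`!%:R^-1.
Proof.
move=> ni; apply: (@mulfI _ (n`!%:R)); first by rewrite pnatr_eq0 -lt0n fact_gt0.
rewrite mulrA mulfV ?mul1r ?pnatr_eq0 -?lt0n ?fact_gt0//.
rewrite -(bin_fact ni) !natrM mulrACA -!mulrA.
rewrite [X in _ = _ * X](_ : _ = 1) ?mulr1//.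
by field; rewrite !pnatr_eq0 -!lt0n !fact_gt0.
Qed.

Lemma opexp_termD A B k : A * B = B * A ->
  T (A + B) k = \sum_(i < k.+1) T A (k - i)%N * T B i.
Proof.
move=> AB /=; rewrite exprDn_comm// scaler_sumr; apply: eq_bigr => i _.
have ik : (i <= k)%N by rewrite -ltnS.
rewrite (_ : _ *+ 'C(k, i) = ('C(k, i)%:R : R) *: (A ^+ (k - i) * B ^+ i)); last by rewrite scaler_nat.
rewrite scalerA (binom_coeff ik).
by rewrite -bop_scaleAl -bop_scaleAr scalerA.
Qed.

Lemma exp_coeffD (a b : R) k :
  exp_coeff (a + b) k = \sum_(i < k.+1) exp_coeff a (k - i)%N * exp_coeff b i.
Proof.
rewrite /exp_coeff /= exprDn mulr_suml; apply: eq_bigr => i _.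
have := @binom_coeff k i; rewrite -ltnS ltn_ord => /(_ isT) h.
transitivity (a ^+ (k - i) * b ^+ i * (k`!%:R^-1 * 'C(k, i)%:R)); last by rewrite h; ring.
by rewrite -mulr_natr; ring.
Qed.

(** The corner left over by the Cauchy product is dominated termwise by the same corner for the
    scalars |A| and |B|, which tends to 0 by [expRD]. *)
Lemma opexpD A B : A * B = B * A -> opexp (A + B) = opexp A * opexp B.
Proof.
move=> AB; apply/eqP; rewrite eq_sym -subr_eq0 -normr_le0.
pose a := `|A|; pose b := `|B|.
have := @norm_cvg_le (fun n => series (T A) n * series (T B) n - series (T (A + B)) n)
  (fun n => series (exp_coeff a) n * series (exp_coeff b) n - series (exp_coeff (a + b)) n)
  (opexp A * opexp B - opexp (A + B)) 0; apply.
- by apply: cvgB; [apply: bop_cvgM|]; exact: opexp_cvg.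
- by rewrite -(subrr (expR (a + b))) {1}expRD; apply: cvgB; [apply: cvgM|]; exact: expR_cvg.
move=> n; rewrite /series /= !big_mkord.
have -> : (\sum_(k < n) T A k) * (\sum_(k < n) T B k) =
    \sum_(i < n) \sum_(j < n) T A j * T B i.
  by rewrite mulr_suml exchange_big; apply: eq_bigr => i _; rewrite mulr_sumr.
have -> : (\sum_(k < n) exp_coeff a k) * (\sum_(k < n) exp_coeff b k) =
    \sum_(i < n) \sum_(j < n) exp_coeff a j * exp_coeff b i.
  by rewrite mulr_suml exchange_big; apply: eq_bigr => i _; rewrite mulr_sumr.
rewrite (big_antidiag (fun i j => T A j * T B i)).
rewrite (big_antidiag (fun i j => exp_coeff a j * exp_coeff b i)).
have <- : \sum_(k < n) T (A + B) k = \sum_(k < n) \sum_(i < k.+1) T A (k - i)%N * T B i.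
  by apply: eq_bigr => k _; rewrite -opexp_termD.
have <- : \sum_(k < n) exp_coeff (a + b) k =
    \sum_(k < n) \sum_(i < k.+1) exp_coeff a (k - i)%N * exp_coeff b i.
  by apply: eq_bigr => k _; rewrite -exp_coeffD.
rewrite ![_ + _ - _]addrAC !subrr !add0r.
apply: (le_trans (ler_norm_sum _ _ _)); apply: ler_sum => i _.
apply: (le_trans (ler_norm_sum _ _ _)); apply: ler_sum => j _.
by rewrite (le_trans (bop_normM _ _))// ler_pM ?bop_normT.
Qed.

End Exp.

(** * The real inner product and adjoints *)

Section Rdot.
Context {R : realType} {H : hilbertType R}.
Implicit Types (A B : bop H) (x y z : H).

Definition rdot x y : R := complex.Re (hdot x y).

Lemma rdotC x y : rdot x y = rdot y x.
Proof.
by rewrite /rdot hermC /= expr0 mul1r; case: (hdot y x).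
Qed.
Lemma rdotDl x y z : rdot (x + y) z = rdot x z + rdot y z.
Proof. by rewrite /rdot linearDl raddfD. Qed.
Lemma rdotDr x y z : rdot z (x + y) = rdot z x + rdot z y.
Proof. by rewrite !(rdotC z) rdotDl. Qed.
Lemma rdotZl (a : R) x y : rdot (a%:C *: x) y = a * rdot x y.
Proof. by rewrite /rdot linearZl /=; case: (hdot x y) => u v /=; rewrite mul0r subr0. Qed.
Lemma rdotZr (a : R) x y : rdot x (a%:C *: y) = a * rdot x y.
Proof. by rewrite rdotC rdotZl rdotC. Qed.
Lemma rdotNl x y : rdot (- x) y = - rdot x y.
Proof. by rewrite -[- x]scaleN1r -(rmorphN1 (real_complex R)) rdotZl mulN1r. Qed.
Lemma rdotNr x y : rdot x (- y) = - rdot x y.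
Proof. by rewrite rdotC rdotNl rdotC. Qed.
Lemma rdotBl x y z : rdot (x - y) z = rdot x z - rdot y z.
Proof. by rewrite rdotDl rdotNl. Qed.
Lemma rdotBr x y z : rdot z (x - y) = rdot z x - rdot z y.
Proof. by rewrite rdotDr rdotNr. Qed.
Lemma rdot0l x : rdot 0 x = 0.
Proof. by rewrite -(subrr x) rdotBl subrr. Qed.
Lemma rdot0r x : rdot x 0 = 0.
Proof. by rewrite rdotC rdot0l. Qed.
Lemma rdotxx x : rdot x x = rnorm x ^+ 2.
Proof.
by apply: complexI; rewrite rmorphXn /= rnormE sqr_normE RRe_real// ger0_real// dnorm_ge0.
Qed.
Lemma rdotxx_ge0 x : 0 <= rdot x x.
Proof. by rewrite rdotxx sqr_ge0. Qed.
Lemma rdotxx_eq0 x : rdot x x = 0 -> x = 0.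
Proof.
rewrite rdotxx => /eqP; rewrite sqrf_eq0 => /eqP h; apply/eqP.
by rewrite -normr_eq0 -rnormE h.
Qed.
Lemma rdot_eq0 x : (forall y, rdot x y = 0) -> x = 0.
Proof. by move=> h; exact: rdotxx_eq0. Qed.
Lemma rdot_inj x y : (forall z, rdot x z = rdot y z) -> x = y.
Proof.
by move=> h; apply/eqP; rewrite -subr_eq0; apply/eqP/rdot_eq0 => z; rewrite rdotBl h subrr.
Qed.
Definition rdotE := (rdotDl, rdotDr, rdotNl, rdotNr, rdotZl, rdotZr, rdot0l, rdot0r).

Lemma rnorm_sqrD x y : rnorm (x + y) ^+ 2 = rnorm x ^+ 2 + 2 * rdot x y + rnorm y ^+ 2.
Proof. rewrite -!rdotxx !rdotE (rdotC y x); ring. Qed.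
Lemma rnorm_sqrB x y : rnorm (x - y) ^+ 2 = rnorm x ^+ 2 - 2 * rdot x y + rnorm y ^+ 2.
Proof. rewrite -!rdotxx !rdotE (rdotC y x); ring. Qed.

Lemma rdot_le x y : rdot x y <= rnorm x * rnorm y.
Proof.
have := rnormD x y; have := rnorm_ge0 (x + y); have := rnorm_sqrD x y.
move: (rnorm (x + y)) (rnorm_ge0 x) (rnorm_ge0 y) => n; nra.
Qed.
Lemma rdot_abs x y : `|rdot x y| <= rnorm x * rnorm y.
Proof.
by rewrite ler_norml rdot_le andbT lerNl -rdotNl (le_trans (rdot_le _ _))// rnormN.
Qed.

Lemma Re_mulNi (z : R[i]) : complex.Re (- 'i * z) = complex.Im z.
Proof. by case: z => a b /=; rewrite oppr0 mul0r sub0r mulN1r opprK. Qed.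

Lemma hdot_rdot x y : hdot x y = rdot x y +i* rdot (- 'i *: x) y.
Proof.
by rewrite /rdot linearZl /= Re_mulNi; case: (hdot x y).
Qed.

(** Real parts suffice because the imaginary part of [hdot x y] is [rdot (- 'i *: x) y] and
    operators are complex linear. *)
Lemma adjointP A B : adjoint A B <-> forall x y, rdot (A x) y = rdot x (B y).
Proof.
split=> [h x y|h x y]; first by rewrite /rdot h.
by rewrite !hdot_rdot -linearZ !h.
Qed.

Lemma adjointC A B : adjoint A B -> adjoint B A.
Proof.
by move=> /adjointP h; apply/adjointP => x y; rewrite rdotC -h rdotC.
Qed.
Lemma adjointM A B A' B' : adjoint A A' -> adjoint B B' -> adjoint (A * B) (B' * A').
Proof. by move=> h k x y; rewrite !bopE h k. Qed.
Lemma adjointD A B A' B' : adjoint A A' -> adjoint B B' -> adjoint (A + B) (A' + B').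
Proof.
move=> /adjointP h /adjointP k; apply/adjointP => x y.
by rewrite !bopE rdotDl rdotDr h k.
Qed.
Lemma adjointN A A' : adjoint A A' -> adjoint (- A) (- A').
Proof. by move=> /adjointP h; apply/adjointP => x y; rewrite !bopE !rdotE h. Qed.
Lemma adjointB A B A' B' : adjoint A A' -> adjoint B B' -> adjoint (A - B) (A' - B').
Proof. by move=> h k; apply: adjointD => //; exact: adjointN. Qed.
Lemma adjointZ (a : R) A A' : adjoint A A' -> adjoint (a *: A) (a *: A').
Proof. by move=> /adjointP h; apply/adjointP => x y; rewrite !bopE !rdotE h. Qed.
Lemma adjoint0 : adjoint (0 : bop H) 0.
Proof. by apply/adjointP => x y; rewrite !bopE !rdotE. Qed.

Lemma bop_eq_rdot A B : (forall x y, rdot (A x) y = rdot (B x) y) -> A = B.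
Proof. by move=> h; apply: bop_ext => x; apply: rdot_inj. Qed.

Lemma adjoint_uniq A B B' : adjoint A B -> adjoint A B' -> B = B'.
Proof.
move=> /adjointP h /adjointP k; apply: bop_eq_rdot => x y.
by rewrite rdotC -h k rdotC.
Qed.

Lemma rdot_bop_le A x y : `|rdot (A x) y| <= `|A| * rnorm x * rnorm y.
Proof.
by rewrite (le_trans (rdot_abs _ _))// ler_wpM2r ?rnorm_ge0// bop_normP.
Qed.

Lemma rdot_cvg (T : Type) (F : set_system T) {FF : Filter F}
    (f : T -> bop H) A x y :
  f @ F --> A -> (fun t => rdot (f t x) y) @ F --> rdot (A x) y.
Proof.
move=> fA; apply/cvgrPdist_le => e e0.
have r0 : 0 < rnorm x * rnorm y + 1 by rewrite ltr_wpDl ?mulr_ge0 ?rnorm_ge0.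
move/cvgrPdist_le : fA => /(_ _ (divr_gt0 e0 r0)); apply: filterS => t h.
rewrite -rdotBl -bop_subE (le_trans (rdot_bop_le _ _ _))//.
move: h; rewrite ler_pdivlMr// -mulrA; apply: le_trans.
by rewrite ler_wpM2l// lerDl.
Qed.
End Rdot.

Section Exp2.
Context {R : realType} {H : hilbertType R}.
Implicit Types (A B U V Y : bop H).
Local Notation T A := (fun k => k`!%:R^-1 *: A ^+ k).

Lemma seriesE (u : nat -> bop H) n : series u n = \sum_(k < n) u k.
Proof. by rewrite /series /= big_mkord. Qed.

(** Covers three uses at once: commutation ([A = B]), conjugation by an invertible [Y], and a
    reflection [Y] that turns e^A into e^{-A} ([B = - A]). *)
Lemma opexp_intertwine A B Y : A * Y = Y * B -> opexp A * Y = Y * opexp B.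
Proof.
move=> AY; have AYk k : A ^+ k * Y = Y * B ^+ k.
  elim: k => [|k IH]; first by rewrite !expr0 mul1r mulr1.
  by rewrite exprS -mulrA IH mulrA AY -mulrA -exprS.
have h1 : (fun n => series (T A) n * Y) @ \oo --> opexp A * Y.
  by apply: bop_cvgM; [exact: opexp_cvg|exact: cvg_cst].
have h2 : (fun n => Y * series (T B) n) @ \oo --> Y * opexp B.
  by apply: bop_cvgM; [exact: cvg_cst|exact: opexp_cvg].
apply: (cvg_unique (@norm_hausdorff _ _) h1).
rewrite (_ : (fun n => _) = (fun n => Y * series (T B) n))//.
apply/funext => n; rewrite !seriesE mulr_suml mulr_sumr.
by apply: eq_bigr => k _; rewrite -bop_scaleAl -bop_scaleAr AYk.
Qed.

Lemma opexpNr A : opexp A * opexp (- A) = 1.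
Proof. by rewrite -opexpD ?mulrN ?mulNr// subrr opexp0. Qed.
Lemma opexpNl A : opexp (- A) * opexp A = 1.
Proof. by rewrite -opexpD ?mulrN ?mulNr// addNr opexp0. Qed.

Lemma opexp_conj U V A : U * V = 1 -> V * U = 1 ->
  opexp (U * A * V) = U * opexp A * V.
Proof.
move=> UV VU; have := @opexp_intertwine (U * A * V) A U.
rewrite -mulrA VU mulr1 => /(_ erefl) <-.
by rewrite -[RHS]mulrA UV mulr1.
Qed.

Lemma adjoint_opexp A B : adjoint A B -> adjoint (opexp A) (opexp B).
Proof.
move=> AB; apply/adjointP => x y.
have h1 : (fun n => rdot (series (T A) n x) y) @ \oo --> rdot (opexp A x) y.
  by apply: rdot_cvg; exact: opexp_cvg.
have h2 : (fun n => rdot (series (T B) n y) x) @ \oo --> rdot (opexp B y) x.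
  by apply: rdot_cvg; exact: opexp_cvg.
rewrite (rdotC x); apply: (cvg_unique (@norm_hausdorff _ _) h1).
rewrite (_ : (fun t => _) = (fun t => rdot (series (T B) t y) x))//.
apply/funext => n.
have : adjoint (series (T A) n) (series (T B) n).
  rewrite !seriesE; elim/big_ind2 : _ => //; first exact: adjoint0.
    by move=> ? ? ? ?; exact: adjointD.
  move=> k _; apply: adjointZ; elim: (k : nat) => [|j IH].
    by rewrite !expr0.
  by rewrite exprS exprSr; exact: adjointM.
by move/adjointP => ->; rewrite rdotC.
Qed.

Lemma opexp_taylor A : `|opexp A - 1 - A| <= `|A| ^+ 2 * expR `|A|.
Proof.
(* Shifting the index by 2 drops the terms 1 and A; the others are compared with |A|^2 times the
   exponential series through 1/(k+2)! <= 1/k!. *)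
have h1 : (fun n => series (T A) n.+2 - 1 - A) @ \oo --> opexp A - 1 - A.
  apply: cvgB; last exact: cvg_cst.
  apply: cvgB; last exact: cvg_cst.
  by do 2 rewrite (cvg_shiftS (fun n => _)); exact: opexp_cvg.
have h2 : (fun n => `|A| ^+ 2 * series (exp_coeff `|A|) n) @ \oo --> `|A| ^+ 2 * expR `|A|.
  by apply: cvgM; [exact: cvg_cst|exact: expR_cvg].
apply: (norm_cvg_le h1 h2) => n.
rewrite seriesE /series /= big_mkord !big_ord_recl /= !expr0 !fact0 invr1 !scale1r.
rewrite expr1; set S := \sum_(i < n) _.
have -> : 1 + (A + S) - 1 - A = S by ncring.
rewrite /S mulr_sumr (le_trans (ler_norm_sum _ _ _))//.
apply: ler_sum => i _ /=; rewrite normrZ ger0_norm ?invr_ge0//.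
rewrite /exp_coeff /= mulrA -exprD mulrC ler_pM//.
- exact: bop_normX.
- by rewrite lef_pV2 ?posrE ?ltr0n ?fact_gt0// ler_nat; apply: leq_fact; exact: (leq_addl 2 i).
Qed.

Lemma bop_subX A B (m : R) k : `|A| <= m -> `|B| <= m ->
  `|A ^+ k.+1 - B ^+ k.+1| <= k.+1%:R * (m ^+ k * `|A - B|).
Proof.
move=> Am Bm; have m0 : 0 <= m by exact: le_trans Am.
elim: k => [|k IH]; first by rewrite !expr1 expr0 !mul1r.
have -> : A ^+ k.+2 - B ^+ k.+2 = A * (A ^+ k.+1 - B ^+ k.+1) + (A - B) * B ^+ k.+1.
  by rewrite !(exprS _ k.+1); ncring.
rewrite (le_trans (ler_normD _ _))// [X in _ <= X * _]mulrSr [X in _ <= X]mulrDl mul1r lerD//; last first.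
  rewrite (le_trans (bop_normM _ _))// mulrC ler_pM//.
  by rewrite (le_trans (bop_normX _ _))// lerXn2r ?nnegrE.
rewrite (le_trans (bop_normM _ _))// (le_trans (ler_pM _ _ Am IH))//.
by rewrite mulrCA exprS -!mulrA.
Qed.

Lemma opexp_lip A B (m : R) : `|A| <= m -> `|B| <= m ->
  `|opexp A - opexp B| <= `|A - B| * expR m.
Proof.
move=> Am Bm; have m0 : 0 <= m by exact: le_trans Am.
have h1 : (fun n => series (T A) n.+1 - series (T B) n.+1) @ \oo --> opexp A - opexp B.
  apply: cvgB.
    by rewrite (cvg_shiftS (fun n => _)); exact: opexp_cvg.
  by rewrite (cvg_shiftS (fun n => _)); exact: opexp_cvg.
have h2 : (fun n => `|A - B| * series (exp_coeff m) n) @ \oo --> `|A - B| * expR m.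
  by apply: cvgM; [exact: cvg_cst|exact: expR_cvg].
apply: (norm_cvg_le h1 h2) => n.
rewrite !seriesE /series /= big_mkord -sumrB big_ord_recl /= !expr0 subrr add0r.
rewrite mulr_sumr (le_trans (ler_norm_sum _ _ _))//.
apply: ler_sum => i _ /=; rewrite -[bump 0 i]/(i.+1) -scalerBr normrZ ger0_norm ?invr_ge0//.
rewrite (le_trans (ler_wpM2l _ (bop_subX i Am Bm))) ?invr_ge0//.
rewrite factS natrM invfM /exp_coeff /= le_eqVlt; apply/orP; left; apply/eqP.
by field; rewrite nat1r !pnatr_eq0 -lt0n fact_gt0.
Qed.

End Exp2.

(** * Derivatives of operator-valued curves *)

Section Deriv.
Context {R : realType}.

Lemma is_deriveP (V W : normedModType R) (f : V -> W) x v L :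
  is_derive x v f L <->
  (fun h : R => h^-1 *: (f (h *: v + x) - f x)) @ 0^' --> L.
Proof.
split=> [[df <-]|h]; first exact: df.
by split; [apply/cvg_ex; exists L|apply: cvg_lim].
Qed.

Lemma is_derive1P (W : normedModType R) (f : R -> W) (x : R) L :
  is_derive x 1 f L <->
  (fun h : R => h^-1 *: (f (h + x) - f x)) @ 0^' --> L.
Proof.
by rewrite is_deriveP; under eq_fun do rewrite [_ *: 1]mulr1.
Qed.

Lemma is_derive_line (V W : normedModType R) (f : V -> W) x v L :
  is_derive x v f L <-> is_derive (0 : R) 1 (fun h => f (h *: v + x)) L.
Proof.
rewrite is_deriveP is_derive1P.
by under [in X in _ <-> X]eq_fun do rewrite addr0 scale0r add0r.
Qed.

Lemma is_derive1_cvg (W : normedModType R) (f : R -> W) (x : R) L :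
  is_derive x 1 f L -> (fun h => f (h + x)) @ 0^' --> f x.
Proof.
move=> /is_derive1P h.
have id0 : (fun h : R => h) @ 0^' --> (0 : R) by move=> S; exact: nbhs_dnbhs.
have : (fun k => k *: (k^-1 *: (f (k + x) - f x)) + f x) @ 0^' --> 0 *: L + f x.
  by apply: cvgD; [exact: (cvgZ id0 h)|exact: cvg_cst].
rewrite scale0r add0r; apply: cvg_trans; apply: near_eq_cvg.
near=> k; rewrite /= scalerA mulfV ?scale1r ?subrK//.
by near: k; exact: nbhs_dnbhs_neq.
Unshelve. all: by end_near. Qed.

Lemma is_derive1_continuous (W : normedModType R) (f : R -> W) (x : R) L :
  is_derive x 1 f L -> {for x, continuous f}.
Proof.
by move=> [df _]; apply/differentiable_continuous/derivable1_diffP.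
Qed.

Lemma is_derive_uniq (V W : normedModType R) (f : V -> W) x v L L' :
  is_derive x v f L -> is_derive x v f L' -> L = L'.
Proof. by move=> [_ <-] [_ <-]. Qed.

End Deriv.

Section BopDeriv.
Context {R : realType} {H : hilbertType R}.
Implicit Types (A B : bop H) (f g : R -> bop H) (x : R).

Lemma bop_is_deriveM f g x A B :
  is_derive x 1 f A -> is_derive x 1 g B ->
  is_derive x 1 (fun t => f t * g t) (A * g x + f x * B).
Proof.
move=> fA gB; have gx := is_derive1_cvg gB.
move: fA gB; rewrite !is_derive1P => fA gB.
have : (fun h => h^-1 *: (f (h + x) - f x) * g (h + x) +
    f x * (h^-1 *: (g (h + x) - g x))) @ 0^' --> A * g x + f x * B.
  by apply: cvgD; apply: bop_cvgM => //; exact: cvg_cst.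
rewrite (_ : (fun h => _) = fun h => h^-1 *: (f (h + x) * g (h + x) - f x * g x))//.
apply/funext => h /=; rewrite -bop_scaleAl -bop_scaleAr -scalerDr.
by congr (_ *: _); ncring.
Qed.

Lemma bop_is_deriveMl f x A B :
  is_derive x 1 f A -> is_derive x 1 (fun t => B * f t) (B * A).
Proof.
move=> fA; have := bop_is_deriveM (is_derive_cst B x 1) fA.
by rewrite mul0r add0r.
Qed.

Lemma bop_is_deriveMr f x A B :
  is_derive x 1 f A -> is_derive x 1 (fun t => f t * B) (A * B).
Proof.
move=> fA; have := bop_is_deriveM fA (is_derive_cst B x 1).
by rewrite mulr0 addr0.
Qed.

Lemma is_derive_rdot f x A (y z : H) :
  is_derive x 1 f A -> is_derive x 1 (fun t => rdot (f t y) z) (rdot (A y) z).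
Proof.
rewrite !is_derive1P => fA.
have : (fun h => rdot ((h^-1 *: (f (h + x) - f x)) y) z) @ 0^' --> rdot (A y) z.
  exact: rdot_cvg.
rewrite (_ : (fun h => _) = fun h => h^-1 *: (rdot (f (h + x) y) z - rdot (f x y) z))//.
by apply/funext => h; rewrite !bopE rdotZl rdotBl.
Qed.

Lemma cvg0_le (T : Type) (F : set_system T) {FF : Filter F} (W : normedModType R)
    (u : T -> W) (v : T -> R) :
  (\forall t \near F, `|u t| <= v t) -> v @ F --> 0 -> u @ F --> 0.
Proof.
move=> uv v0; apply/cvgrPdist_le => e e0.
move/cvgrPdist_le : v0 => /(_ _ e0) v0.
near=> t; rewrite sub0r normrN (@le_trans _ _ (v t))//; first by near: t.
rewrite (le_trans (ler_norm _))// -normrN -sub0r.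
by near: t.
Unshelve. all: by end_near. Qed.

Lemma cvg_id0 : (fun h : R => h) @ 0^' --> (0 : R).
Proof. by move=> S; exact: nbhs_dnbhs. Qed.

Lemma is_derive_opexp0 A : is_derive (0 : R) 1 (fun t => opexp (t *: A)) A.
Proof.
rewrite is_derive1P; under eq_fun do rewrite addr0 scale0r opexp0.
apply/subr_cvg0; apply: (@cvg0_le _ _ _ _ _ (fun h => `|h| * (`|A| ^+ 2 * expR `|A|))).
  near=> h; have h0 : h != 0 by near: h; exact: nbhs_dnbhs_neq.
  have h1 : `|h| <= 1 by near: h; exact: dnbhs0_le.
  have -> : h^-1 *: (opexp (h *: A) - 1) - A = h^-1 *: (opexp (h *: A) - 1 - h *: A).
    by rewrite [in RHS]scalerBr scalerA mulVf// scale1r.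
  rewrite normrZ normfV ler_pdivrMl ?normr_gt0//.
  rewrite (le_trans (opexp_taylor _))// normrZ exprMn expr2 -!mulrA.
  by do 4 (rewrite ler_wpM2l//); rewrite ler_expR ler_piMl.
rewrite -[X in _ --> X](mul0r (`|A| ^+ 2 * expR `|A|)).
apply: cvgM; last exact: cvg_cst.
by rewrite -[X in _ --> X](@normr0 _ R); apply: cvg_norm; exact: cvg_id0.
Unshelve. all: by end_near. Qed.

(** Since [f 0] commutes with [A], exp(f 0 + h A) factors as exp(f 0) exp(h A), and [opexp_lip]
    bounds its distance to exp(f h) by o(h). *)
Lemma is_derive_opexp_comp f A :
  is_derive (0 : R) 1 f A -> f 0 * A = A * f 0 ->
  is_derive (0 : R) 1 (fun t => opexp (f t)) (opexp (f 0) * A).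
Proof.
move=> fA fA0; have fx : (fun h => f h) @ 0^' --> f 0.
  by have := is_derive1_cvg fA; under eq_fun do rewrite addr0.
have eA := is_derive_opexp0 A.
move: fA eA; rewrite !is_derive1P.
under eq_fun do rewrite addr0; under [in X in _ -> X -> _]eq_fun do rewrite addr0 scale0r opexp0.
under [in X in _ -> _ -> X]eq_fun do rewrite addr0.
move=> fA eA.
pose u h := h^-1 *: (opexp (f h) - opexp (f 0 + h *: A)).
pose v h := opexp (f 0) * (h^-1 *: (opexp (h *: A) - 1)).
rewrite (_ : (fun h => _) = (fun h => u h + v h)); last first.
  apply/funext => h; rewrite /u /v -bop_scaleAr -scalerDr mulrBr mulr1.
  rewrite -opexpD; last by rewrite -bop_scaleAr -bop_scaleAl fA0.
  by congr (_ *: _); ncring.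
suff : (fun h => u h + v h) @ 0^' --> 0 + opexp (f 0) * A by rewrite add0r.
apply: cvgD; last first.
  by apply: bop_cvgM => //; exact: cvg_cst.
(* Bounds both [f h] and [f 0 + h *: A] once |h| <= 1 and |f 0 - f h| <= 1, as [opexp_lip]
   requires. *)
pose m := `|f 0| + `|A| + 1.
apply: (@cvg0_le _ _ _ _ _ (fun h => `|h^-1 *: (f h - f 0) - A| * expR m)); last first.
  suff : (fun h => `|h^-1 *: (f h - f 0) - A| * expR m) @ 0^' --> 0 * expR m.
    by rewrite mul0r.
  apply: cvgM; last exact: cvg_cst.
  by apply/norm_cvg0P/subr_cvg0.
move/cvgrPdist_le : (fx) => /(_ _ ltr01) fx1.
near=> h; have h0 : h != 0 by near: h; exact: nbhs_dnbhs_neq.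
have h1 : `|h| <= 1 by near: h; exact: dnbhs0_le.
have fh : `|f h| <= m.
  have : `|f 0 - f h| <= 1 by near: h; exact: fx1.
  rewrite -[in `|f h|](subKr (f 0) (f h)) => fh.
  rewrite (le_trans (ler_normB _ _))// /m -addrA lerD// (le_trans fh)//.
  by rewrite lerDr.
have fA' : `|f 0 + h *: A| <= m.
  rewrite (le_trans (ler_normD _ _))// /m -addrA lerD// normrZ.
  by rewrite (le_trans (ler_piMl _ h1))// lerDl.
rewrite /u normrZ (le_trans (ler_wpM2l _ (opexp_lip fh fA')))// mulrA.
rewrite ler_wpM2r ?expR_ge0// -normrZ opprD addrA scalerBr scalerA mulVf//.
by rewrite scale1r.
Unshelve. all: by end_near. Qed.

Lemma is_derive_opexp A x :
  is_derive x 1 (fun t => opexp (t *: A)) (A * opexp (x *: A)).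
Proof.
have := bop_is_deriveMr (opexp (x *: A)) (is_derive_opexp0 A).
rewrite !is_derive1P; under eq_fun do rewrite addr0 scale0r opexp0 mul1r.
rewrite (_ : (fun h => _) = (fun h => h^-1 *: (opexp ((h + x) *: A) - opexp (x *: A))))//.
apply/funext => h; rewrite scalerDl opexpD//.
by rewrite -!bop_scaleAl -!bop_scaleAr !scalerA mulrC.
Qed.

Lemma is_derive_opexpN A x :
  is_derive x 1 (fun t => opexp (- (t *: A))) (- A * opexp (- (x *: A))).
Proof. by under eq_fun do rewrite -scalerN; rewrite -scalerN; exact: is_derive_opexp. Qed.

End BopDeriv.

(** * Skew-adjoint operators of norm at most pi/2 *)

Section Skew.
Context {R : realType} {H : hilbertType R}.
Implicit Types (A B U V Y Z : bop H) (x y : H) (mu : R).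

Definition skewadj A := adjoint A (- A).

Lemma skewadjZ (a : R) A : skewadj A -> skewadj (a *: A).
Proof. by move=> sA; rewrite /skewadj -scalerN; exact: adjointZ. Qed.

Lemma skewadjN A : skewadj A -> skewadj (- A).
Proof. by rewrite -scaleN1r; exact: skewadjZ. Qed.

Lemma skewadj_rdot A x y : skewadj A -> rdot (A x) y = - rdot x (A y).
Proof. by move/adjointP => ->; rewrite bopE rdotE. Qed.

Lemma adjoint_opexp_skewadj A : skewadj A -> adjoint (opexp A) (opexp (- A)).
Proof. exact: adjoint_opexp. Qed.

Lemma rnorm_isometry U V x : adjoint U V -> V * U = 1 -> rnorm (U x) = rnorm x.
Proof.
move=> /adjointP UV VU; apply/eqP; rewrite -(@eqrXn2 _ 2) ?rnorm_ge0//.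
by rewrite -!rdotxx UV -bop_mulE VU.
Qed.

Lemma bop_norm_isometryl U V A : adjoint U V -> V * U = 1 -> `|U * A| = `|A|.
Proof.
move=> UV VU; apply/eqP; rewrite eq_le; apply/andP; split; apply: bop_norm_le => // x.
  by rewrite bop_mulE (rnorm_isometry _ UV VU) bop_normP.
by rewrite -(rnorm_isometry _ UV VU) -bop_mulE bop_normP.
Qed.

Lemma bop_norm_isometryr U V A : adjoint U V -> V * U = 1 -> U * V = 1 ->
  `|A * U| = `|A|.
Proof.
move=> UV VU UV1; apply/eqP; rewrite eq_le; apply/andP; split; apply: bop_norm_le => // x.
  by rewrite bop_mulE -(rnorm_isometry x UV VU) bop_normP.
rewrite -[in A x](mulr1 A) -UV1 mulrA bop_mulE -(rnorm_isometry x (adjointC UV) UV1).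
by rewrite bop_normP.
Qed.

Lemma rnorm_opexp A x : skewadj A -> rnorm (opexp A x) = rnorm x.
Proof.
by move=> /adjoint_opexp_skewadj h; apply: (rnorm_isometry _ h); exact: opexpNl.
Qed.

Lemma le0_natmul_bounded (c K : R) : (forall m : nat, m%:R * c <= K) -> c <= 0.
Proof.
move=> h; rewrite leNgt; apply/negP => c0.
have K0 : 0 <= K by have := h 0%N; rewrite mul0r.
have [m] : exists m : nat, K / c < m%:R.
  by exists (Num.truncn (K / c)).+1; rewrite truncnS_gt.
by rewrite ltr_pdivrMr// ltNge h.
Qed.

(* Iterating (1 + U) Y = Y (1 - U): for v in the range of Y the vectors
   2^(-m/2) (1 + U)^m v stay bounded, whereas their squared norms grow
   at least linearly in m, with rate proportional to |(U + U^-1) v|^2. *)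
Lemma anticommute_unitary U V Y : adjoint U V -> U * V = 1 -> V * U = 1 ->
  (forall x, 0 <= rdot (U x) x) -> U * Y = - (Y * U) -> (U + V) * Y = 0.
Proof.
move=> UVadj UV VU q0 UY; apply: bop_ext => x; apply: rdotxx_eq0.
have /adjointP Ua := UVadj; have /adjointP Va := adjointC UVadj.
have isoU z w : rdot (U z) (U w) = rdot z w by rewrite Ua -bop_mulE VU.
have isoV z w : rdot (V z) (V w) = rdot z w by rewrite Va -bop_mulE UV.
have UVz z : U (V z) = z by rewrite -bop_mulE UV.
have VUz z : V (U z) = z by rewrite -bop_mulE VU.
pose q z := rdot (U z) z.
pose w m := ((1 + U) ^+ m * Y) x.
have wS m : w m.+1 = w m + U (w m).
  by rewrite /w exprS -mulrA bop_mulE bop_addE.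
pose C z := U z + V z.
have CS m : C (w m.+1) = C (w m) + U (C (w m)).
  by rewrite wS /C !raddfD /= VUz UVz addrACA.
have nS z : rdot (z + U z) (z + U z) = 2 * rdot z z + 2 * q z.
  by rewrite !rdotE isoU /q (rdotC z); ring.
have qS z : 2 * q (z + U z) = 4 * q z + rdot (C z) (C z).
  rewrite /q /C raddfD /= !rdotE !isoU !isoV.
  have -> : rdot (U (U z)) z = rdot (U z) (V z) by rewrite Ua.
  by rewrite (rdotC (V z)); ring.
pose c := rdot (C (w 0)) (C (w 0)).
have c0 : 0 <= c by exact: rdotxx_ge0.
(* [C (w m)] obeys the same recursion as [w m], so by [nS] and [q0] its squared norm at least
   doubles at each step. *)
have hC m : 2 ^+ m * c <= rdot (C (w m)) (C (w m)).
  elim: m => [|m IH]; first by rewrite expr0 mul1r.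
  by rewrite CS nS exprS; have := q0 (C (w m)); rewrite -/(q _); lra.
have hq m : 2 ^+ m * c <= 2 * q (w m.+1).
  by rewrite wS qS; have := hC m; have := q0 (w m); rewrite -/(q _); lra.
have hn m : 2 ^+ m * (m%:R * c) <= 2 * rdot (w m.+1) (w m.+1).
  elim: m => [|m IH]; first by rewrite mul0r mulr0 mulr_ge0// rdotxx_ge0.
  rewrite wS nS exprS -natr1; have := hq m.
  by move: IH; set a := 2 ^+ m; lra.
have hY m : (1 + U) ^+ m * Y = Y * (1 - U) ^+ m.
  elim: m => [|m IH]; first by rewrite !expr0 mul1r mulr1.
  rewrite exprS -mulrA IH mulrA mulrDl mul1r UY [in RHS]exprS mulrA; congr (_ * _).
  by ncring.
(* The competing upper bound: |(1 - U) t|^2 = 2 |t|^2 - 2 q(t) with q(t) >= 0. *)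
have hU m z : rdot (((1 - U) ^+ m) z) (((1 - U) ^+ m) z) <= 2 ^+ m * rdot z z.
  elim: m => [|m IH]; first by rewrite !expr0 mul1r.
  rewrite exprS bop_mulE; set t := _ z in IH *.
  rewrite bop_subE bop_oneE !rdotE isoU (rdotC t) exprS.
  have := q0 t; lra.
apply/eqP; rewrite eq_le rdotxx_ge0 andbT.
have -> : ((U + V) * Y) x = C (w 0) by rewrite /w expr0 mul1r.
apply: (@le0_natmul_bounded _ (4 * (`|Y| ^+ 2 * rdot x x))) => m.
rewrite -(@ler_pM2l _ (2 ^+ m)) ?exprn_gt0//.
apply: (le_trans (hn m)); rewrite /w hY bop_mulE.
set t := _ x; have -> : rdot (Y t) (Y t) = rnorm (Y t) ^+ 2 by rewrite rdotxx.
have h1 : rnorm (Y t) ^+ 2 <= `|Y| ^+ 2 * rdot t t.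
  by rewrite rdotxx -exprMn lerXn2r ?nnegrE ?mulr_ge0 ?rnorm_ge0// bop_normP.
have h2 := hU m.+1 x; rewrite -/t exprS in h2.
have h3 := ler_wpM2l (sqr_ge0 `|Y|) h2.
by move: h1 h3; set a := 2 ^+ m; set b := `|Y| ^+ 2; nra.
Qed.

(* cos 2x = 2 cos^2 x - 1 for the real part of e^A. *)
Lemma rdot_opexp_half A (c : R) : skewadj A -> 0 <= c ->
  (forall x, c * rdot x x <= rdot (opexp (2^-1 *: A) x) x) ->
  forall x, (2 * c ^+ 2 - 1) * rdot x x <= rdot (opexp A x) x.
Proof.
move=> sA c0 h x; set B := 2^-1 *: A; have sB : skewadj B by exact: skewadjZ.
have AB : A = B + B.
  rewrite /B -scalerDl; have -> : 2^-1 + 2^-1 = 1 :> R by lra.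
  by rewrite scale1r.
have /adjointP adjB := adjoint_opexp_skewadj sB.
have isoB z w : rdot (opexp B z) (opexp B w) = rdot z w.
  by rewrite adjB -bop_mulE opexpNl.
have e1 : rdot (opexp A x) x = rdot (opexp B x) (opexp (- B) x).
  by rewrite AB opexpD// bop_mulE adjB.
have h1 := h x; have [->|x0] := eqVneq x 0; first by rewrite !rdot0r mulr0.
have xx : 0 < rdot x x.
  rewrite lt_neqAle rdotxx_ge0 andbT eq_sym; apply: contra x0 => /eqP/rdotxx_eq0 ->.
  by rewrite eqxx.
pose z := opexp B x + opexp (- B) x.
have zz : rdot z z = 2 * rdot x x + 2 * rdot (opexp A x) x.
  rewrite /z !rdotE isoB e1 (rdotC (opexp (- B) x)).
  have -> : rdot (opexp (- B) x) (opexp (- B) x) = rdot x x.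
    by have /adjointP -> := adjoint_opexp_skewadj (skewadjN sB); rewrite opprK -bop_mulE opexpNr.
  by ring.
have zx : 2 * c * rdot x x <= rdot z x.
  rewrite /z rdotDl; have -> : rdot (opexp (- B) x) x = rdot (opexp B x) x.
    by rewrite adjB rdotC.
  by lra.
have cs : rdot z x ^+ 2 <= rdot z z * rdot x x.
  rewrite !rdotxx -exprMn -[X in X <= _]real_normK ?num_real//.
  by rewrite lerXn2r ?nnegrE ?mulr_ge0 ?rnorm_ge0// rdot_abs.
have : (2 * c * rdot x x) ^+ 2 <= rdot z z * rdot x x.
  apply: le_trans cs; rewrite lerXn2r ?nnegrE ?mulr_ge0 ?rdotxx_ge0//.
  by apply: le_trans zx; rewrite !mulr_ge0 ?rdotxx_ge0.
rewrite exprMn [rdot x x ^+ 2]expr2 mulrA ler_pM2r// zz; nra.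
Qed.

(** The left side bounds |e^{hA} - 1| when |A| = a, and the right side is the chord of the unit
    circle at angle h mu. To first order they are h a and h mu, so a < mu leaves room for the error
    terms. *)
Lemma chord_lt_sin (a mu : R) : 0 <= a -> a < mu ->
  exists2 d : R, 0 < d & forall h, 0 < h -> h <= d ->
    h * a + (h * a) ^+ 2 * expR (h * a) <= 2 * sin (h * (mu / 2)).
Proof.
move=> a0 amu.
pose m := mu / 2.
have hs : is_derive (0 : R) 1 (fun h => sin (h * m)) m.
  have hm : is_derive (0 : R) 1 (fun h => h * m) m.
    by apply: is_derive_eq; rewrite scaler0 add0r /GRing.scale /= mulr1.
  have hh := @is_derive1_comp _ sin (fun h => h * m) 0 _ _ (is_derive_sin (0 * m)) hm.
  by apply: (is_derive_eq hh); rewrite mul0r cos0 mul1r.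
(* With this margin the sine costs h (mu - a)/4 and the quadratic term h (mu - a)/8, together less
   than the gap h (mu - a). *)
have md : 0 < (mu - a) / 8 by lra.
move/is_derive1P : hs => /cvgrPdist_le/(_ _ md)/nbhs_ballP[e /= e0 he].
pose K := a ^+ 2 * expR a.
have K0 : 0 <= K by rewrite mulr_ge0 ?exprn_ge0 ?expR_ge0.
pose d := Num.min (e / 2) (Num.min 1 ((mu - a) / 8 / (K + 1))).
exists d.
  by rewrite !lt_min ltr01 /=; apply/andP; split; [exact: divr_gt0|apply: divr_gt0 => //; exact: ltr_wpDl].
move=> h h0; rewrite !le_min => /and3P[h1 h2 h3].
have := he h; rewrite -ball_normE /= sub0r normrN gtr0_norm//.
have he2 : h < e by lra.
move=> /(_ he2 (lt0r_neq0 h0)); rewrite addr0 mul0r sin0 subr0 /GRing.scale /= -/m.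
rewrite ler_distl => /andP[_]; rewrite mulrC -lerBlDr ler_pdivlMr// => hsin.
have hK : (h * a) ^+ 2 * expR (h * a) <= h * ((mu - a) / 8).
  have e1 : expR (h * a) <= expR a by rewrite ler_expR ler_piMl.
  have : (h * a) ^+ 2 * expR (h * a) <= h * (h * K).
    rewrite exprMn expr2 -!mulrA /K expr2 -!mulrA.
    by do 2 (rewrite ler_wpM2l ?(ltW h0)//); do 2 (rewrite ler_wpM2l//).
  move/le_trans; apply; rewrite ler_wpM2l ?(ltW h0)//.
  move: h3; rewrite ler_pdivlMr ?ltr_wpDl// => h3; apply: le_trans h3.
  by rewrite ler_wpM2l ?(ltW h0)// lerDl.
move: hsin hK; rewrite /m; set u := _ ^+ 2 * _; set w := sin _; nra.
Qed.

(** For B = A/2^k with k large, Re <e^B x, x> = |x|^2 - |e^B x - x|^2 / 2 and the chord estimate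
    give the bound. Doubling the angle k times reaches A; [mu <= pi] keeps the cosine of each half
    angle nonnegative, as [rdot_opexp_half] requires. *)
Lemma rdot_opexp_cos A mu : skewadj A -> `|A| < mu -> mu <= pi ->
  forall x, cos mu * rdot x x <= rdot (opexp A x) x.
Proof.
move=> sA Amu mupi.
have [d d0 hd] := chord_lt_sin (normr_ge0 A) Amu.
have [k kd] : exists k, (2 ^- k : R) <= d.
  pose N := (Num.truncn d^-1).+1; exists N.
  rewrite -[leRHS]invrK lef_pV2 ?posrE ?invr_gt0 ?exprn_gt0//.
  apply: (@le_trans _ _ N%:R); first exact/ltW/truncnS_gt.
  by rewrite -natrX ler_nat; exact/ltnW/ltn_expl.
have mu0 : 0 < mu by apply: le_lt_trans Amu.
have base x : cos (2 ^- k * mu) * rdot x x <= rdot (opexp (2 ^- k *: A) x) x.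
  set B := 2 ^- k *: A; have sB : skewadj B by exact: skewadjZ.
  have h0 : 0 < 2 ^- k :> R by rewrite invr_gt0 exprn_gt0.
  have nB : `|B| = 2 ^- k * `|A| by rewrite normrZ gtr0_norm.
  have := hd _ h0 kd; rewrite -nB; set e := `|B| + _; set s := sin _ => es.
  have e0 : 0 <= e by rewrite addr_ge0// mulr_ge0 ?exprn_ge0 ?expR_ge0.
  have -> : cos (2 ^- k * mu) = 1 - 2 * s ^+ 2.
    rewrite /s; set t := 2 ^- k * (mu / 2); have -> : 2 ^- k * mu = t + t by rewrite /t; field.
    by rewrite cosD; have := cos2Dsin2 t; rewrite -!expr2; lra.
  have hB : rnorm (opexp B x - x) <= e * rnorm x.
    have -> : opexp B x - x = (opexp B - 1 - B + B) x by rewrite subrK.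
    rewrite (le_trans (bop_normP _ _))// ler_wpM2r ?rnorm_ge0//.
    by rewrite (le_trans (ler_normD _ _))// addrC lerD2l opexp_taylor.
  have hB2 : rnorm (opexp B x - x) ^+ 2 <= e ^+ 2 * rnorm x ^+ 2.
    by rewrite -exprMn lerXn2r ?nnegrE ?mulr_ge0 ?rnorm_ge0.
  rewrite rnorm_sqrB rnorm_opexp// in hB2.
  have es2 : e ^+ 2 <= (2 * s) ^+ 2 by rewrite lerXn2r ?nnegrE// (le_trans e0).
  have := ler_wpM2r (sqr_ge0 (rnorm x)) es2; rewrite rdotxx exprMn; lra.
have step j : (j <= k)%N -> forall x,
    cos (2 ^- (k - j) * mu) * rdot x x <= rdot (opexp (2 ^- (k - j) *: A) x) x.
  elim: j => [_|j IH jk]; first by rewrite subn0.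
  have := IH (ltnW jk); rewrite -subnSK//; set i := (k - j.+1)%N => hi.
  have E : 2^-1 * (2 ^- i * mu) = 2 ^- i.+1 * mu by rewrite exprS invfM mulrA.
  have -> : cos (2 ^- i * mu) = 2 * cos (2 ^- i.+1 * mu) ^+ 2 - 1.
    rewrite -E; set t := 2^-1 * _; have -> : 2 ^- i * mu = t + t by rewrite /t; field.
    by rewrite cosD; have := cos2Dsin2 t; rewrite -!expr2; lra.
  apply: rdot_opexp_half; first exact: skewadjZ.
    apply: cos_ge0_pihalf; apply/andP; split.
      rewrite (@le_trans _ _ 0)// ?oppr_le0 ?divr_ge0 ?pi_ge0// mulr_ge0 ?(ltW mu0)//.
    rewrite -E mulrC ler_pM2r// (le_trans _ mupi)// ler_piMl ?(ltW mu0)//.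
    by rewrite invf_le1 ?exprn_gt0// exprn_ege1// ler1n.
  by rewrite scalerA -invfM -exprS.
by have := step k (leqnn k); rewrite subnn expr0 invr1 mul1r scale1r.
Qed.

(** The case of equality |A| = pi/2 escapes the strict bound of [rdot_opexp_cos], so it is applied
    with mu slightly above pi/2 and continuity of the cosine gives the limit. *)
Lemma rdot_opexp_ge0 A : skewadj A -> `|A| <= pi / 2 ->
  forall x, 0 <= rdot (opexp A x) x.
Proof.
move=> sA Api x.
have [->|x0] := eqVneq x 0; first by rewrite rdot0r.
have xx : 0 < rdot x x.
  rewrite lt_neqAle rdotxx_ge0 andbT eq_sym; apply: contra x0 => /eqP/rdotxx_eq0 ->.
  by rewrite eqxx.
rewrite -[X in _ <= X](@mulfVK _ (rdot x x)) ?gt_eqF// mulr_ge0 ?rdotxx_ge0//.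
apply/ler_addgt0Pr => e e0.
have cc : {for (pi / 2 : R), continuous cos} by exact: continuous_cos.
move/cvgrPdist_lt : cc => /(_ _ e0)/nbhs_ballP[d /= d0 hd].
have pi0 := pi_gt0 R.
pose mu := pi / 2 + Num.min (d / 2) (pi / 2) :> R.
have m0 : 0 < Num.min (d / 2) (pi / 2 : R) by rewrite lt_min !divr_gt0.
have mu1 : mu <= pi.
  by rewrite /mu [leRHS]splitr lerD2l ge_min lexx orbT.
have mud : ball (pi / 2 : R) d mu.
  rewrite -ball_normE /= /mu opprD addrA subrr sub0r normrN gtr0_norm//.
  by rewrite gt_min ltr_pdivrMr// ltr_pMr// ltr1n.
have := hd _ mud; rewrite cos_pihalf sub0r normrN ltr_norml => /andP[h1 _].
have : cos mu * rdot x x <= rdot (opexp A x) x.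
  by apply: rdot_opexp_cos => //; apply: (le_lt_trans Api); rewrite /mu ltrDl.
rewrite -ler_pdivlMr// => h2; rewrite -lerBlDr sub0r; apply: le_trans h2; exact: ltW.
Qed.

(** The angle pi/3 lies strictly between pi/4 and pi/2, so Re e^A is bounded below by the positive
    number cos(pi/3). *)
Lemma opexp_add_inj A : skewadj A -> `|A| <= pi / 4 ->
  forall x, opexp A x + opexp (- A) x = 0 -> x = 0.
Proof.
move=> sA Api x hx.
have pi0 := pi_gt0 R.
have h : cos (pi / 3) * rdot x x <= rdot (opexp A x) x.
  by apply: rdot_opexp_cos => //; lra.
have c0 : 0 < cos (pi / 3 : R) by apply: cos_gt0_pihalf; lra.
have e1 : rdot (opexp (- A) x) x = rdot (opexp A x) x.
  by have /adjointP -> := adjoint_opexp_skewadj (skewadjN sA); rewrite opprK rdotC.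
have e2 : rdot (opexp A x + opexp (- A) x) x = 0 by rewrite hx rdot0l.
rewrite rdotDl e1 in e2.
have {}e2 : rdot (opexp A x) x = 0 by lra.
apply: rdotxx_eq0; have := rdotxx_ge0 x; rewrite e2 in h; nra.
Qed.

End Skew.

(** * From commuting with e^{2A} to commuting with A *)

Section Commute.
Context {R : realType} {H : hilbertType R}.
Implicit Types (A B U V Y Z E : bop H) (x y : H).

Lemma comm_opexp A B : A * B = B * A -> opexp A * B = B * opexp A.
Proof. exact: opexp_intertwine. Qed.

(** Conjugating Y = e^A V e^{-A} - V by e^A gives V - e^A V e^{-A} = - Y, so [anticommute_unitary]
    applies. *)
Lemma opexp_half_commute A V : skewadj A -> `|A| <= pi / 2 ->
  opexp A * opexp A * V = V * (opexp A * opexp A) ->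
  (opexp A + opexp (- A)) * (opexp A * V * opexp (- A) - V) = 0.
Proof.
move=> sA Api h.
apply: anticommute_unitary.
- exact: adjoint_opexp_skewadj.
- exact: opexpNr.
- exact: opexpNl.
- exact: rdot_opexp_ge0.
move: h (opexpNr A) (opexpNl A).
move: (opexp A) (opexp (- A)) => e f h ef fe.
have -> : e * (e * V * f - V) = e * e * V * f - e * V by ncring.
rewrite h; have -> : V * (e * e) * f = V * e * (e * f) by ncring.
have -> : (e * V * f - V) * e = e * V * (f * e) - V * e by ncring.
by rewrite ef fe; ncring.
Qed.

Lemma conj_sub_eq0 A V : opexp A * V * opexp (- A) - V = 0 -> opexp A * V = V * opexp A.
Proof.
move=> /eqP; rewrite subr_eq0 => /eqP h.
by rewrite -[in RHS]h -mulrA opexpNl mulr1.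
Qed.

Lemma opexp_double A : opexp A * opexp A = opexp (2 *: A).
Proof. by rewrite -opexpD// scaler_nat mulr2n. Qed.

(** With t = 2^{-k}, e^{tZ} - 1 - tZ has norm O(t^2), so the commutator of Z and V is O(2^{-k}) for
    every k. *)
Lemma commute_of_opexp Z V : (forall k, opexp (2 ^- k *: Z) * V = V * opexp (2 ^- k *: Z)) ->
  Z * V = V * Z.
Proof.
move=> h; apply/eqP; rewrite -subr_eq0 -normr_le0.
pose K := `|Z| ^+ 2 * expR `|Z| * (2 * `|V|).
apply: (@le0_natmul_bounded _ _ K) => m.
apply: (@le_trans _ _ (2 ^+ m * `|Z * V - V * Z|)).
  by rewrite ler_wpM2r// -natrX ler_nat ltnW// ltn_expl.
have h0 : 0 < 2 ^- m :> R by rewrite invr_gt0 exprn_gt0.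
have h1 : 2 ^- m <= 1 :> R by rewrite invf_le1 ?exprn_gt0// exprn_ege1// ler1n.
rewrite -ler_pdivlMl ?exprn_gt0//; move: (h m); set t := 2 ^- m in h0 h1 *.
move=> ht; rewrite -(@ler_pM2l _ t)//.
set D := opexp (t *: Z) - 1 - t *: Z.
have -> : t * `|Z * V - V * Z| = `|V * D - D * V|.
  rewrite -{1}(gtr0_norm h0) -normrZ scalerBr bop_scaleAl bop_scaleAr.
  by congr `|_|; rewrite /D !mulrBr !mulrBl ht; ncring.
have hD : `|D| <= t * (t * (`|Z| ^+ 2 * expR `|Z|)).
  rewrite (le_trans (opexp_taylor _))// normrZ gtr0_norm// exprMn expr2 -!mulrA.
  do 2 (rewrite ler_wpM2l ?(ltW h0)//).
  by do 2 (rewrite ler_wpM2l//); rewrite ler_expR ler_piMl.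
rewrite (le_trans (ler_normB _ _))//.
apply: (@le_trans _ _ (`|D| * (2 * `|V|))).
  have := bop_normM V D; have := bop_normM D V; lra.
rewrite /K; have := normr_ge0 V; set w := `|Z| ^+ 2 * _ in hD *; nra.
Qed.

(** * Operators commuting with W, on and off the eigenspace of -1 *)

Section HalfTurn.
Variables (kappa : R) (Z W E V : bop H).
Hypotheses (kappa0 : 0 < kappa) (sZ : skewadj Z) (Zpi : `|Z| <= pi / 2).
Hypotheses (EE : E * E = E) (sE : adjoint E E) (EZ : E * Z = Z * E).
Hypothesis (ZZE : Z * Z * E = - (kappa ^+ 2 *: E)).
Hypotheses (WE : W * E = - E) (Efix : forall x, W x = - x -> E x = x).
Hypotheses (WZ : W = opexp (2 *: Z)) (sV : skewadj V) (VW : V * W = W * V).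

(** [V] preserves the eigenspace ker(W + 1), the range of [E]; being skew-adjoint it preserves the
    orthogonal complement too. *)
Lemma halfturn_commE : V * E = E * V.
Proof.
have h : E * (V * E) = V * E.
  apply: bop_ext => x; rewrite bop_mulE; apply: Efix.
  by rewrite -bop_mulE mulrA -VW -mulrA WE mulrN.
have a1 : adjoint (V * E) (- (E * V)) by rewrite -mulrN; exact: adjointM.
have a2 : adjoint (V * E) (- (E * V) * E) by rewrite -h; apply: adjointM => //.
have := adjoint_uniq a1 a2; rewrite mulNr -mulrA h => /eqP; rewrite eqr_opp => /eqP.
by move=> ->.
Qed.

(** Commutation descends from W to e^Z, then to e^{Z/2}, e^{Z/4} and so on. Only the first root
    meets the critical norm pi/2, and there the factor 1 - E is essential. *)
Lemma halfturn_comm : Z * (V * (1 - E)) = V * (1 - E) * Z.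
Proof.
have VE := halfturn_commE; set V' := V * (1 - E).
have EV' : E * V' = 0 by rewrite /V' mulrBr mulr1 mulrBr -VE mulrA -VE -mulrA EE subrr.
have EcomZ (t : R) : E * opexp (t *: Z) = opexp (t *: Z) * E.
  by rewrite comm_opexp// -bop_scaleAl -bop_scaleAr EZ.
have WV' : W * V' = V' * W.
  have EW : E * W = W * E by rewrite WZ EcomZ.
  by rewrite /V' mulrA -VW -!mulrA; congr (_ * _); rewrite mulrBr mulrBl EW mulr1 mul1r.
clearbody V'.
have pi0 := pi_gt0 R.
have half (t : R) : 0 <= t -> t <= 1 -> opexp (t *: Z) * opexp (t *: Z) * V' =
    V' * (opexp (t *: Z) * opexp (t *: Z)) ->
    (opexp (t *: Z) + opexp (- (t *: Z))) *
      (opexp (t *: Z) * V' * opexp (- (t *: Z)) - V') = 0.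
  move=> t0 t1; apply: opexp_half_commute; first exact: skewadjZ.
  by rewrite normrZ ger0_norm// (le_trans _ Zpi)// ler_piMl.
apply: commute_of_opexp; elim=> [|k IH].
  rewrite expr0 invr1; apply: conj_sub_eq0.
  have h1 : opexp (1 *: Z) * opexp (1 *: Z) = W by rewrite opexp_double !scalerA mulr1 WZ.
  have := half 1 ler01 (lexx 1); rewrite h1 => /(_ WV').
  set e := opexp (1 *: Z) in h1 *; set f := opexp (- (1 *: Z)); set Y := _ - V' => hY.
  have EY : E * Y = 0.
    have Ee : E * e = e * E by exact: EcomZ.
    by rewrite /Y mulrBr EV' subr0 !mulrA Ee -(mulrA _ E) EV' mulr0 mul0r.
  (* Multiplying (e^Z + e^{-Z}) Y = 0 by e^Z gives (W + 1) Y = 0, so [E] fixes the range of [Y]; but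
     E Y = 0. *)
  clearbody Y; apply: bop_ext => x.
  rewrite -[Y x]Efix; first by rewrite -bop_mulE EY.
  have : (W + 1) * Y = 0.
    have <- : e * ((e + f) * Y) = (W + 1) * Y.
      by rewrite mulrA mulrDr h1 opexpNr.
    by rewrite hY mulr0.
  move/(congr1 (fun A : bop H => A x)); rewrite mulrDl mul1r => /eqP.
  by rewrite bop_addE addr_eq0 => /eqP.
(* From here |tZ| <= pi/4, and [opexp_add_inj] replaces the argument with [E]. *)
set t := 2 ^- k.+1; have t0 : 0 < t :> R by rewrite invr_gt0 exprn_gt0.
have tt : 2 * t = 2 ^- k :> R by rewrite /t exprS invfM mulrA mulfV ?mul1r.
have t1 : t <= 2^-1 by rewrite /t lef_pV2 ?posrE ?exprn_gt0// exprS ler_peMr// exprn_ege1// ler1n.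
have h1 : opexp (t *: Z) * opexp (t *: Z) = opexp (2 ^- k *: Z).
  by rewrite opexp_double scalerA tt.
apply: conj_sub_eq0; have := half t (ltW t0); rewrite h1 => /(_ _ IH) hY.
have {}hY := hY (le_trans t1 (ltW (_ : 2^-1 < 1))).
apply: bop_ext => x; apply: (@opexp_add_inj _ _ (t *: Z)); first exact: skewadjZ.
  rewrite normrZ gtr0_norm//; have : t * `|Z| <= 2^-1 * (pi / 2) by rewrite ler_pM// ltW.
  by lra.
have := congr1 (fun A : bop H => A x) (hY _); rewrite bop_mulE; apply.
by rewrite invf_lt1// ltr1n.
Qed.

(* Solves [B, Z] = the part of V E anticommuting with Z, using Z^2 = - kappa^2 on E. *)
Definition halfturn_gen := (4 * kappa ^+ 2)^-1 *: (Z * (V * E) - V * E * Z).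

Local Notation B := halfturn_gen.
Local Notation V1 := (V * E).

Let ZZV1 : Z * Z * V1 = - (kappa ^+ 2 *: V1).
Proof. by rewrite halfturn_commE mulrA ZZE mulNr -bop_scaleAl. Qed.

Let V1ZZ : V1 * Z * Z = - (kappa ^+ 2 *: V1).
Proof.
have EZZ : E * Z * Z = Z * Z * E by rewrite EZ -mulrA EZ mulrA.
by rewrite -!mulrA (mulrA E) EZZ ZZE mulrN -bop_scaleAr.
Qed.

Let V1E : V1 * E = V1. Proof. by rewrite -mulrA EE. Qed.
Let EV1 : E * V1 = V1. Proof. by rewrite mulrA -halfturn_commE -mulrA EE. Qed.

Lemma halfturn_gen_suppr : B * E = B.
Proof.
have h1 : Z * V1 * E = Z * V1 by rewrite -mulrA V1E.
have h2 : V1 * Z * E = V1 * Z by rewrite -mulrA -EZ mulrA V1E.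
by rewrite /B -bop_scaleAl mulrBl h1 h2.
Qed.

Lemma halfturn_gen_suppl : E * B = B.
Proof.
have h1 : E * (Z * V1) = Z * V1 by rewrite mulrA EZ -mulrA EV1.
have h2 : E * (V1 * Z) = V1 * Z by rewrite mulrA EV1.
by rewrite /B -bop_scaleAr mulrBr h1 h2.
Qed.

Lemma halfturn_gen_skewadj : skewadj B.
Proof.
have s1 : adjoint V1 (- V1).
  have := adjointM sV sE; rewrite mulrN => h.
  by rewrite [X in - X]halfturn_commE.
rewrite /skewadj /B -scalerN; apply: adjointZ; rewrite opprB.
have := adjointB (adjointM sZ s1) (adjointM s1 sZ).
by rewrite !mulrNN.
Qed.

(** J = Z/kappa satisfies J^2 = -1 on the range of [E], and the right side is (V1 + J V1 J)/2, the
    part of V1 anticommuting with J. This is the origin of the factor 4 kappa^2. *)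
Let gen_comm : B * Z - Z * B =
  (4 * kappa ^+ 2)^-1 *: (2 *: (Z * V1 * Z + kappa ^+ 2 *: V1)).
Proof.
rewrite /B -bop_scaleAl -bop_scaleAr -scalerBr; congr (_ *: _).
have h1 : (Z * V1 - V1 * Z) * Z = Z * V1 * Z + kappa ^+ 2 *: V1.
  by rewrite mulrBl V1ZZ opprK.
have h2 : Z * (Z * V1 - V1 * Z) = - (Z * V1 * Z + kappa ^+ 2 *: V1).
  by rewrite mulrBr (mulrA Z Z) ZZV1; ncring.
by rewrite h1 h2 opprK scaler_nat mulr2n.
Qed.

Lemma halfturn_gen_anti : Z * B = - (B * Z).
Proof.
rewrite /B -bop_scaleAl -bop_scaleAr -scalerN; congr (_ *: _).
by rewrite mulrBl mulrBr V1ZZ (mulrA Z Z) ZZV1; ncring.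
Qed.

(** Off [E] this is [halfturn_comm]; on [E] what remains is (V1 - J V1 J)/2 with J = Z/kappa, which
    commutes with J. *)
Lemma halfturn_residue_comm :
  (V - (B * Z - Z * B)) * Z = Z * (V - (B * Z - Z * B)).
Proof.
have -> : V - (B * Z - Z * B) = V * (1 - E) + (V1 - (B * Z - Z * B)).
  by ncring.
rewrite mulrDl [in RHS]mulrDr halfturn_comm; congr (_ + _).
rewrite gen_comm mulrBl mulrBr; set r := Z * V1 * Z.
have rZ : r * Z = - (kappa ^+ 2 *: (Z * V1)).
  have -> : r * Z = Z * (V1 * Z * Z) by rewrite /r; ncring.
  by rewrite V1ZZ mulrN -bop_scaleAr.
have Zr : Z * r = - (kappa ^+ 2 *: (V1 * Z)).
  have -> : Z * r = Z * Z * V1 * Z by rewrite /r; ncring.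
  by rewrite ZZV1 mulNr -bop_scaleAl.
rewrite -!bop_scaleAl -!bop_scaleAr; set p := V1 * Z; set q := Z * V1.
have -> : (r + kappa ^+ 2 *: V1) * Z = kappa ^+ 2 *: (p - q).
  by rewrite mulrDl rZ -bop_scaleAl scalerBr addrC.
have -> : Z * (r + kappa ^+ 2 *: V1) = kappa ^+ 2 *: (q - p).
  by rewrite mulrDr Zr -bop_scaleAr scalerBr addrC.
have k0 : kappa ^+ 2 != 0 by rewrite expf_neq0 ?gt_eqF.
rewrite !scalerA (_ : (4 * kappa ^+ 2)^-1 * 2 * kappa ^+ 2 = 2^-1); last by field; rewrite gt_eqF.
rewrite -(opprB p q) scalerN opprK; apply/eqP.
rewrite subr_eq -addrA -scalerDl (_ : 2^-1 + 2^-1 = 1) ?scale1r; last by lra.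
by rewrite addrC subrK.
Qed.

Lemma halfturn_gen_commW : B * W = W * B.
Proof.
have EW : E * W = W * E.
  by rewrite WZ comm_opexp// -bop_scaleAl -bop_scaleAr EZ.
have -> : W * B = - B by rewrite -halfturn_gen_suppl mulrA WE mulNr.
by rewrite -{1}halfturn_gen_suppr -mulrA EW WE mulrN halfturn_gen_suppr.
Qed.

(** Applied to U = 2P - 1, which changes the sign of both Z and V and hence fixes their products. It
    makes the rotations e^{sB} fix P. *)
Lemma halfturn_gen_comm U : U * Z = - (Z * U) -> U * V = - (V * U) ->
  U * E = E * U -> U * B = B * U.
Proof.
move=> UZ UV UE; rewrite /B -bop_scaleAl -bop_scaleAr; congr (_ *: _).
have UV1 : U * V1 = - (V1 * U) by rewrite mulrA UV mulNr -!mulrA UE.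
have h1 : U * (Z * V1) = Z * V1 * U.
  by rewrite mulrA UZ mulNr -(mulrA Z U) UV1; ncring.
have h2 : U * (V1 * Z) = V1 * Z * U.
  by rewrite mulrA UV1 mulNr -(mulrA V1 U) UZ; ncring.
by rewrite mulrBl mulrBr h1 h2.
Qed.

End HalfTurn.
End Commute.

(** * Variations of geodesics *)

Section Variation.
Context {R : realType} {H : hilbertType R}.
Implicit Types (A B U V Y Z E W P : bop H) (x y : H).

Lemma is_derive_skewadj (Zs : R -> bop H) V : is_derive (0 : R) 1 Zs V ->
  (\forall s \near (0 : R), skewadj (Zs s)) -> skewadj V.
Proof.
move=> dZ sZ; apply/adjointP => x y.
have d1 := is_derive_rdot x y dZ.
have d2 : is_derive (0 : R) 1 (fun s => - rdot (Zs s y) x) (- rdot (V y) x).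
  exact: is_deriveN (is_derive_rdot y x dZ).
have d3 : is_derive (0 : R) 1 (fun s => rdot (Zs s x) y) (- rdot (V y) x).
  apply: near_eq_is_derive _ d2; apply: filterS sZ => s sZs.
  by rewrite [RHS](skewadj_rdot _ _ sZs) (rdotC x).
by rewrite (is_derive_uniq d1 d3) bopE rdotNr (rdotC x).
Qed.

Lemma is_derive_commute (Zs : R -> bop H) V W : is_derive (0 : R) 1 Zs V ->
  (\forall s \near (0 : R), Zs s * W = W * Zs s) -> V * W = W * V.
Proof.
move=> dZ cZ; have d1 := bop_is_deriveMr W dZ.
have d2 : is_derive (0 : R) 1 (fun s => Zs s * W) (W * V).
  apply: near_eq_is_derive _ (bop_is_deriveMl W dZ).
  by apply: filterS cZ => s ->.
exact: is_derive_uniq d1 d2.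
Qed.

Lemma bop_is_deriveZ (a : R) (f : R -> bop H) A (x : R) :
  is_derive (x : R) 1 f A -> is_derive (x : R) 1 (fun s => a *: f s) (a *: A).
Proof. by move=> h; exact: is_deriveZ. Qed.

Variables (kappa : R) (Z W E V P : bop H) (Zs : R -> bop H).
Hypotheses (kappa0 : 0 < kappa) (sZ : skewadj Z) (Zpi : `|Z| <= pi / 2).
Hypotheses (EE : E * E = E) (sE : adjoint E E) (EZ : E * Z = Z * E).
Hypothesis (ZZE : Z * Z * E = - (kappa ^+ 2 *: E)).
Hypotheses (WE : W * E = - E) (Efix : forall x, W x = - x -> E x = x).
Hypotheses (WZ : W = opexp (2 *: Z)).
Hypotheses (dZ : is_derive (0 : R) 1 Zs V) (Zs0 : Zs 0 = Z).
Hypothesis (sZs : \forall s \near (0 : R), skewadj (Zs s)).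
Hypothesis (WZs : \forall s \near (0 : R), opexp (2 *: Zs s) = W).
Local Notation B := (halfturn_gen kappa Z E V).
Hypothesis (PB : P * B = B * P).

(* Conjugating by exp(sB) removes from V = Zs'(0) its part anticommuting with
   Z; the rest commutes with Z, hence is killed by exp(2 Zs(s)) = W. *)
Lemma is_derive_geodesic_variation t :
  let g := opexp (t *: Z) * P * opexp (- (t *: Z)) in
  is_derive (0 : R) 1 (fun s => opexp (t *: Zs s) * P * opexp (- (t *: Zs s)))
    (B * g - g * B).
Proof.
have sV : skewadj V by exact: is_derive_skewadj dZ sZs.
have VW : V * W = W * V.
  apply: is_derive_commute dZ _; apply: filterS WZs => s <-.
  by rewrite comm_opexp// -bop_scaleAl -bop_scaleAr.
have BW : B * W = W * B.
  exact: (halfturn_gen_commW _ EE sE EZ WE Efix WZ sV VW).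
pose a := V - (B * Z - Z * B).
have aZ : a * Z = Z * a.
  exact: (halfturn_residue_comm kappa0 sZ Zpi EE sE EZ ZZE WE Efix WZ sV VW).
pose e s := opexp (s *: B); pose f s := opexp (- (s *: B)).
have ef s : e s * f s = 1 by exact: opexpNr.
have fe s : f s * e s = 1 by exact: opexpNl.
have e0 : e 0 = 1 by rewrite /e scale0r opexp0.
have f0 : f 0 = 1 by rewrite /f scale0r oppr0 opexp0.
have de : is_derive (0 : R) 1 e B by exact: is_derive_opexp0.
have df : is_derive (0 : R) 1 f (- B).
  have := is_derive_opexpN B 0; rewrite scale0r oppr0 opexp0 mulr1.
  exact.
pose Rs s := f s * Zs s * e s.
have Rs0 : Rs 0 = Z by rewrite /Rs e0 f0 mulr1 mul1r Zs0.
have dR : is_derive (0 : R) 1 Rs a.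
  apply: is_derive_eq (bop_is_deriveM (bop_is_deriveM df dZ) de) _.
  by rewrite e0 f0 Zs0 /a; ncring.
have ZsR s : Zs s = e s * Rs s * f s.
  by rewrite /Rs -!mulrA ef mulr1 mulrA ef mul1r.
have expZs c s : opexp (c *: Zs s) = e s * opexp (c *: Rs s) * f s.
  by rewrite ZsR -opexp_conj// -bop_scaleAr -bop_scaleAl.
have dexpR c : is_derive (0 : R) 1 (fun s => opexp (c *: Rs s)) (opexp (c *: Z) * (c *: a)).
  rewrite -[in opexp _]Rs0; apply: (is_derive_opexp_comp (bop_is_deriveZ c dR)).
  by rewrite Rs0 -!bop_scaleAl -!bop_scaleAr aZ.
have fW s : f s * W = W * f s.
  by apply: comm_opexp; rewrite mulNr mulrN -bop_scaleAl -bop_scaleAr BW.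
(* e^{sB} commutes with W, so e^{2 Rs} is also constantly W; its derivative e^{2Z} 2a therefore
   vanishes. *)
have a0 : a = 0.
  have d1 : is_derive (0 : R) 1 (fun s => opexp (2 *: Rs s)) 0.
    apply: near_eq_is_derive _ (is_derive_cst W (0 : R) 1); apply: filterS WZs => s h.
    have : f s * W * e s = W by rewrite fW -mulrA fe mulr1.
    by rewrite -{1}h expZs !mulrA fe mul1r -mulrA fe mulr1.
  have := is_derive_uniq (dexpR 2) d1.
  move/(congr1 (fun X => 2^-1 *: (opexp (- (2 *: Z)) * X))).
  by rewrite mulrA opexpNl mul1r mulr0 scaler0 scalerA mulVf ?scale1r// pnatr_eq0.
have dR0 c : is_derive (0 : R) 1 (fun s => opexp (c *: Rs s)) 0.
  by apply: is_derive_eq (dexpR c) _; rewrite a0 scaler0 mulr0.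
move=> g.
have fP s : f s * P = P * f s.
  by apply: comm_opexp; rewrite mulNr mulrN -bop_scaleAl -bop_scaleAr PB.
(* P passes through the rotation, and the middle factor is stationary at 0 because a = 0, so only
   the bracket with B survives. *)
rewrite (_ : (fun s => _) = (fun s => e s * (opexp (t *: Rs s) * P *
    opexp ((- t) *: Rs s)) * f s)); last first.
  apply/funext => s; rewrite -(scaleNr t) !expZs.
  have -> : e s * opexp (t *: Rs s) * f s * P * (e s * opexp (- t *: Rs s) * f s) =
    e s * opexp (t *: Rs s) * (f s * P) * (e s * opexp (- t *: Rs s) * f s) by ncring.
  rewrite fP.
  have -> : e s * opexp (t *: Rs s) * (P * f s) * (e s * opexp (- t *: Rs s) * f s) =
    e s * opexp (t *: Rs s) * P * (f s * e s) * opexp (- t *: Rs s) * f s by ncring.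
  by rewrite fe mulr1 !mulrA.
apply: is_derive_eq (bop_is_deriveM (bop_is_deriveM de
  (bop_is_deriveM (bop_is_deriveMr P (dR0 t)) (dR0 (- t)))) df) _.
rewrite e0 f0 Rs0 mul0r mul0r mulr0 addr0 mulr0 addr0 mulr1 mul1r.
by rewrite /g -(scaleNr t) mulrN.
Qed.

End Variation.

(** * Geodesics from P, the symmetry 2P - 1, and orthogonal projections *)

Section Geod.
Context {R : realType} {H : hilbertType R}.
Implicit Types (A B U V X Y Z E W P Q : bop H) (x y : H).

(** Written without scalars so that [ncring] can expand it. *)
Definition refl P : bop H := P + P - 1.

Lemma refl_adj P : adjoint P P -> adjoint (refl P) (refl P).
Proof. by move=> sP; apply: adjointB => //; exact: adjointD. Qed.

Lemma refl_sqr P : P * P = P -> refl P * refl P = 1.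
Proof.
move=> PP; have -> : refl P * refl P = (P * P + P * P + P * P + P * P) - (P + P + P + P) + 1.
  by rewrite /refl; ncring.
by rewrite PP subrr add0r.
Qed.

Lemma bop_double_inj A B : A + A = B + B -> A = B.
Proof.
move=> h; have : 2^-1 *: (A + A) = 2^-1 *: (B + B) by rewrite h.
rewrite !scalerDr -!scalerDl (_ : 2^-1 + 2^-1 = 1 :> R) ?scale1r//.
by lra.
Qed.

Lemma refl_comm P A : refl P * A = A * refl P -> P * A = A * P.
Proof.
move=> h; apply: bop_double_inj; have : refl P * A + A = A * refl P + A by rewrite h.
by rewrite /refl mulrBl mulrBr mul1r mulr1 !subrK mulrDl mulrDr.
Qed.

Section Tangent.
Variables (P X : bop H).
Hypotheses (PP : P * P = P) (sP : adjoint P P) (tX : tangent P X).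
Local Notation Z := (X * P - P * X).
Local Notation eps := (refl P).

Lemma tangent_genE : Z = X * eps.
Proof.
case: tX => _ h; have -> : P * X = X - X * P by rewrite -{2}h addrC addKr.
by rewrite /refl; ncring.
Qed.

Lemma tangent_refl : eps * X = - (X * eps).
Proof.
case: tX => _ h; apply/eqP; rewrite -addr_eq0.
have -> : eps * X + X * eps = (X * P + P * X) + (X * P + P * X) - X - X.
  by rewrite /refl; ncring.
by rewrite h addrK subrr.
Qed.

Lemma tangent_gen_refl : eps * Z = - (Z * eps).
Proof. by rewrite tangent_genE mulrA tangent_refl mulNr. Qed.

Lemma tangent_skewadj : skewadj Z.
Proof.
case: tX => sX _; rewrite /skewadj opprB.
by apply: adjointB; exact: adjointM.
Qed.

Lemma tangent_gen_sqr : Z * Z = - (X * X).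
Proof.
by rewrite {2}tangent_genE tangent_genE mulrA -(mulrA X) tangent_refl mulrN mulNr -!mulrA refl_sqr// mulr1.
Qed.

(** A tangent vector is off-diagonal, P X P = 0, and is therefore recovered from its generator: X is
    the initial velocity of its geodesic. *)
Lemma tangent_bracket : Z * P - P * Z = X.
Proof.
case: tX => _ h.
have h1 : P * X * P = 0.
  have -> : P * X * P = P * (X * P + P * X) - P * P * X by ncring.
  by rewrite h PP subrr.
have -> : Z * P - P * Z = X * (P * P) - P * X * P - P * X * P + P * P * X by ncring.
by rewrite PP h1 !subr0 h.
Qed.

Lemma geodE t : geod P X t = opexp (t *: Z) * P * opexp (- (t *: Z)).
Proof. by []. Qed.

Lemma geod0 : geod P X 0 = P.
Proof. by rewrite geodE scale0r oppr0 opexp0 mulr1 mul1r. Qed.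

Lemma is_derive_geod (t : R) :
  is_derive t 1 (geod P X) (opexp (t *: Z) * X * opexp (- (t *: Z))).
Proof.
have h := bop_is_deriveM (bop_is_deriveMr P (is_derive_opexp Z t)) (is_derive_opexpN Z t).
apply: is_derive_eq h _.
transitivity (opexp (t *: Z) * (Z * P - P * Z) * opexp (- (t *: Z))); last first.
  by rewrite tangent_bracket.
have <- : opexp (t *: Z) * Z = Z * opexp (t *: Z).
  by apply: comm_opexp; rewrite -bop_scaleAl -bop_scaleAr.
by ncring.
Qed.

Lemma is_derive_geod0 : is_derive (0 : R) 1 (geod P X) X.
Proof.
by apply: is_derive_eq (is_derive_geod 0) _; rewrite scale0r oppr0 opexp0 mulr1 mul1r.
Qed.

(** 2P - 1 anticommutes with Z and thus turns e^{-tZ} into e^{tZ}. At t = 1 the position of the end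
    point becomes a condition on e^{2Z}. *)
Lemma geod_refl t : refl (geod P X t) * eps = opexp (2 *: (t *: Z)).
Proof.
have h : eps * opexp (- (t *: Z)) = opexp (t *: Z) * eps.
  rewrite (@opexp_intertwine _ _ (t *: Z) (- (t *: Z)))//.
  by rewrite -bop_scaleAl -scalerN -bop_scaleAr mulrN tangent_gen_refl opprK.
have -> : refl (geod P X t) = opexp (t *: Z) * eps * opexp (- (t *: Z)).
  by rewrite geodE /refl mulrBr mulrDr mulr1 mulrBl mulrDl opexpNr.
by rewrite -mulrA -mulrA (mulrA eps) h -!mulrA refl_sqr// mulr1 opexp_double.
Qed.

End Tangent.

Lemma geodesic_tangent P g : g 0 = P -> geodesic P g ->
  exists2 X, tangent P X & forall t, g t = geod P X t.
Proof.
move=> g0 [p [X [_ tX gX]]]; have pP : p = P.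
  by rewrite -g0 gX /geod scale0r oppr0 opexp0 mulr1 mul1r.
by exists X => [|t]; rewrite -pP.
Qed.

Section Orthoprojection.
Variables (S : set H) (A : bop H).
Hypotheses (SB : forall x y, S x -> S y -> S (x - y)) (SA : orthoprojection S A).

Lemma orth_rdot (T : set H) x y : orth T x -> T y -> rdot x y = 0.
Proof. by move=> h Ty; rewrite /rdot (h _ Ty). Qed.

Lemma orthoprojection_adj : adjoint A A.
Proof.
apply/adjointP => x y; have [Sx ox] := SA x; have [Sy oy] := SA y.
rewrite -[X in rdot (A x) X](subrK (A y)) rdotDr (rdotC (A x)) (orth_rdot oy Sx) add0r.
by rewrite -[X in _ = rdot X _](subrK (A x)) rdotDl (orth_rdot ox Sy) add0r.
Qed.

Lemma orthoprojection_id x : S x -> A x = x.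
Proof.
move=> Sx; have [SAx ox] := SA x; apply/eqP; rewrite -subr_eq0 -opprB oppr_eq0.
by apply/eqP/rdotxx_eq0; apply: orth_rdot ox _; exact: SB.
Qed.

Lemma orthoprojection_idem : A * A = A.
Proof. by apply: bop_ext => x; rewrite bop_mulE orthoprojection_id//; have [] := SA x. Qed.

Lemma orthoprojection_orth x : orth S x -> A x = 0.
Proof.
move=> ox; have [SAx _] := SA x; apply: rdotxx_eq0.
have /adjointP -> := orthoprojection_adj.
by rewrite (orthoprojection_id SAx) (orth_rdot ox).
Qed.

End Orthoprojection.

Lemma orthB (S : set H) x y : orth S x -> orth S y -> orth S (x - y).
Proof. by move=> ox oy z Sz; rewrite linearBl /= ox// oy// subr0. Qed.

(** The blocks of gamma are prescribed on [0, 1] only, so derivatives at 0 are compared from the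
    right. *)
Lemma is_derive_right (f h : R -> R) a b :
  is_derive (0 : R) 1 f a -> is_derive (0 : R) 1 h b ->
  (forall t, 0 <= t <= 1 -> f t = h t) -> a = b.
Proof.
move=> fa hb fh; apply/eqP; rewrite -subr_eq0; apply/eqP.
have /is_derive1P/cvg_dnbhs_at_right d1 := is_deriveB fa hb.
apply: (cvg_unique (@norm_hausdorff _ R) d1); apply: cvg_near_cst; near=> t.
have t01 : 0 <= t <= 1 by apply/andP; split; near: t; [exact: nbhs_right_ge|exact: nbhs_right_le].
by rewrite /= addr0 !fctE (fh _ t01) (fh 0) ?lexx ?ler01// !subrr scaler0.
Unshelve. all: by end_near. Qed.

End Geod.

(** * Two projections *)

Section TwoProjections.
Context {R : realType} {H : hilbertType R}.
Implicit Types (x y : H).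
Variables (P Q E : bop H).
Hypotheses (PP : P * P = P) (sP : adjoint P P) (QQ : Q * Q = Q) (sQ : adjoint Q Q).
Hypotheses (projE : orthoprojection (H0 P Q) E) (EP : E * P = P * E) (EQ : E * Q = Q * E).

Lemma ran_id (A : bop H) x : A * A = A -> ran A x -> A x = x.
Proof. by move=> AA [y _ <-]; rewrite -bop_mulE AA. Qed.

Local Notation N := (P - Q).
Local Notation S := (P + Q - 1).

(** N and S act as anticommuting sine and cosine of the angle between P and Q: ker N = H11 + H00 and
    ker S = H10 + H01. *)
Let NN_SS : N * N + S * S = 1.
Proof.
have -> : N * N + S * S = (P * P + P * P - P - P) + (Q * Q + Q * Q - Q - Q) + 1 by ncring.
by rewrite PP QQ !addrK !subrr !add0r.
Qed.

Let NS_SN : N * S = - (S * N).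
Proof.
apply/eqP; rewrite -addr_eq0; apply/eqP.
have -> : N * S + S * N = (P * P + P * P - P - P) - (Q * Q + Q * Q - Q - Q) by ncring.
by rewrite PP QQ !addrK !subrr.
Qed.

Lemma ker_sub_decomp x : P x = Q x -> H11 P Q (P x) /\ H00 P Q (x - P x).
Proof.
move=> h; split; first by split; [exists x|exists x].
split; rewrite /ker /= raddfB /=; first by rewrite -(bop_mulE P) PP subrr.
by rewrite h -(bop_mulE Q) QQ subrr.
Qed.

Lemma ker_add_decomp x : P x + Q x = x -> H10 P Q (P x) /\ H01 P Q (x - P x).
Proof.
move=> h; have hQ : x - P x = Q x by rewrite -{1}h addrC addKr.
split; split.
- by exists x.
- rewrite /ker /=; have : Q (x - P x) = Q x by rewrite hQ -bop_mulE QQ.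
  by rewrite raddfB /= => /eqP; rewrite subr_eq -subr_eq0 opprD addrA subrr sub0r oppr_eq0 => /eqP.
- by rewrite /ker /= raddfB /= -(bop_mulE P) PP subrr.
- by rewrite hQ; exists x.
Qed.

Let N_eq0 x : sumset (H11 P Q) (H00 P Q) x -> N x = 0.
Proof.
move=> [a [aP aQ] [b [bP bQ] <-]]; rewrite bop_subE [P _]raddfD [Q _]raddfD /=.
by rewrite (ran_id PP aP) (ran_id QQ aQ) bP bQ subrr.
Qed.

Let S_eq0 x : Hprime P Q x -> S x = 0.
Proof.
move=> [a [aP aQ] [b [bP bQ] <-]]; rewrite bop_subE bop_addE bop_oneE [P _]raddfD [Q _]raddfD /=.
by rewrite (ran_id PP aP) (ran_id QQ bQ) bP aQ addr0 add0r subrr.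
Qed.

Let sE : adjoint E E.
Proof. exact: orthoprojection_adj projE. Qed.

Let EE : E * E = E.
Proof. by apply: orthoprojection_idem projE => x y; exact: orthB. Qed.

(** N and S are self-adjoint and anticommute, so the range of N S is orthogonal to ker N and ker S.
    It lies in H0, the range of [E]. *)
Let NSE : N * S * (1 - E) = 0.
Proof.
have sN : adjoint N N by exact: adjointB.
have sS : adjoint S S by apply: adjointB => //; exact: adjointD.
have ENS : E * (N * S) = N * S.
  apply: bop_ext => x; rewrite bop_mulE.
  apply: (orthoprojection_id _ projE) => [y z|]; first exact: orthB.
  move=> _ [k1 hk1 [k2 hk2 <-]]; rewrite linearDr /=.
  have -> : hdot ((N * S) x) k1 = 0 by rewrite bop_mulE sN N_eq0// linear0r.
  have -> : hdot ((N * S) x) k2 = 0.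
    by rewrite NS_SN -mulrN bop_mulE sS S_eq0// linear0r.
  by rewrite addr0.
rewrite mulrBr mulr1 -[X in _ - X]mulrA.
have -> : S * E = E * S by rewrite mulrBl mulrBr mulrDl mulrDr EP EQ mulr1 mul1r.
have NE : N * E = E * N by rewrite mulrBl mulrBr EP EQ.
by rewrite mulrA NE -mulrA ENS subrr.
Qed.

Let ecomm (A : bop H) : E * A = A * E -> A * (1 - E) = (1 - E) * A.
Proof. by move=> h; rewrite mulrBl mulrBr h mulr1 mul1r. Qed.

Let NE : N * (1 - E) = (1 - E) * N.
Proof. by apply: ecomm; rewrite mulrBl mulrBr EP EQ. Qed.
Let SE : S * (1 - E) = (1 - E) * S.
Proof. by apply: ecomm; rewrite mulrBl mulrBr mulrDl mulrDr EP EQ mulr1 mul1r. Qed.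

Let FF : (1 - E) * (1 - E) = 1 - E.
Proof. by rewrite mulrBl mul1r mulrBr mulr1 EE subrr subr0. Qed.

(* The projection onto H10 + H01: on the range of 1 - E, where NS = 0 and
   N^2 + S^2 = 1, the operator N^2 is the projection onto ker S. *)
Definition prime_proj := N * N * (1 - E).
Local Notation E' := prime_proj.

Lemma prime_proj_idem : E' * E' = E'.
Proof.
rewrite /prime_proj; move: NE FF NSE NN_SS NS_SN; set F := 1 - E; set n := N; set z := S.
move=> nF FF' nzF nnzz nz.
have -> : n * n * F * (n * n * F) = n * n * (n * n) * F.
  have -> : n * n * F * (n * n * F) = n * n * (F * n) * n * F by ncring.
  rewrite -nF; have -> : n * n * (n * F) * n * F = n * n * n * (F * n) * F by ncring.
  by rewrite -nF -(mulrA _ _ F) -(mulrA n F) FF'; ncring.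
have nn : n * n = 1 - z * z by rewrite -nnzz addrK.
rewrite {1}nn; have -> : (1 - z * z) * (n * n) * F = n * n * F - z * (z * n) * (n * F) by ncring.
have -> : z * n = - (n * z) by rewrite nz opprK.
rewrite nF; have -> : z * - (n * z) * (F * n) = - (z * (n * z * F) * n) by ncring.
by rewrite nzF mulr0 mul0r !oppr0 addr0.
Qed.

Lemma prime_proj_adj : adjoint E' E'.
Proof.
have sN : adjoint N N by exact: adjointB.
have sF : adjoint (1 - E) (1 - E) by exact: adjointB.
have e : (1 - E) * (N * N) = N * N * (1 - E).
  by rewrite -[RHS]mulrA NE [RHS]mulrA NE mulrA.
by have := adjointM (adjointM sN sN) sF; rewrite e.
Qed.

Lemma prime_proj_ker : S * E' = 0.
Proof.
have -> : S * E' = S * N * (N * (1 - E)) by rewrite /prime_proj !mulrA.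
have -> : S * N = - (N * S) by rewrite NS_SN opprK.
by rewrite NE mulNr mulrA NSE mul0r oppr0.
Qed.

Lemma prime_proj_orth : E * E' = 0.
Proof.
rewrite /prime_proj -(mulrA N) NE (mulrA N) NE; have -> : E * ((1 - E) * N * N) = (E - E * E) * N * N by ncring.
by rewrite EE subrr !mul0r.
Qed.

Lemma prime_proj_fix x : P x + Q x = x -> E' x = x.
Proof.
move=> h; have [h1 h2] := ker_add_decomp h.
have Sx : S x = 0 by rewrite bop_subE bop_addE h subrr.
have Hx : Hprime P Q x by exists (P x) => //; exists (x - P x) => //; rewrite addrC subrK.
have Ex : E x = 0.
  have [oE _] := projE x; apply: rdotxx_eq0.
  have /adjointP -> := sE; rewrite -bop_mulE EE rdotC; apply: orth_rdot oE _.
  exists 0; last by exists x; rewrite ?add0r.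
  exists 0; last by exists 0; rewrite ?addr0//; split; rewrite /ker /= raddf0.
  by split; exists 0; rewrite // raddf0.
have F_x : (1 - E) x = x by rewrite bop_subE bop_oneE Ex subr0.
rewrite /prime_proj bop_mulE F_x.
have -> : N * N = 1 - S * S by apply/eqP; rewrite eq_sym subr_eq NN_SS.
by rewrite bop_subE bop_oneE bop_mulE Sx raddf0 subr0.
Qed.

Lemma prime_projE x : P (E' x) + Q (E' x) = E' x.
Proof.
have := congr1 (fun A : bop H => A x) prime_proj_ker.
by rewrite bop_mulE bop_subE bop_addE bop_oneE bop_zeroE => /eqP; rewrite subr_eq0 => /eqP.
Qed.

Lemma prime_proj_commP : P * E' = E' * P.
Proof.
have PN : P * (N * N) = N * N * P.
  have -> : P * (N * N) = P * P * P - P * P * Q - P * Q * P + P * (Q * Q) by ncring.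
  have -> : N * N * P = P * P * P - P * Q * P - Q * (P * P) + (Q * Q) * P by ncring.
  by rewrite !PP QQ; ncring.
by rewrite /prime_proj mulrA PN -!mulrA (ecomm EP).
Qed.

Lemma prime_proj_commZ (Z : bop H) : E * Z = Z * E -> N * N * Z = Z * (N * N) ->
  E' * Z = Z * E'.
Proof. by move=> EZ NZ; rewrite /prime_proj -(mulrA (N * N)) -(ecomm EZ) mulrA NZ -!mulrA. Qed.

(* ker (P - Q) = H11 + H00 is the range of S^2 (1 - E). *)
Lemma prime_proj_full (Z : bop H) : (forall x, P x = Q x -> Z x = 0) ->
  Z * (1 - E) = Z * E'.
Proof.
move=> hZ; have -> : 1 - E = E' + S * S * (1 - E) by rewrite -mulrDl NN_SS mul1r.
rewrite mulrDr -[RHS]addr0; congr (_ + _); apply: bop_ext => x.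
rewrite bop_mulE hZ//; apply/eqP; rewrite -subr_eq0 -bop_subE -bop_mulE.
have -> : N * (S * S * (1 - E)) = N * S * (S * (1 - E)) by ncring.
by rewrite SE (mulrA (N * S)) NSE mul0r bop_zeroE.
Qed.

End TwoProjections.

(** Only the mixed term has a derivative at 0; this is how [u] and [v] are read off as the velocity
    of the block on H10 + H01. *)
Lemma is_derive_trig_quad (R : realType) (a b d : R) :
  is_derive (0 : R) 1 (fun t => a * (cos (t * pi / 2) * cos (t * pi / 2)) +
    b * (cos (t * pi / 2) * sin (t * pi / 2)) +
    d * (sin (t * pi / 2) * sin (t * pi / 2))) (b * (pi / 2)).
Proof.
pose m : R := pi / 2.
have hm : is_derive (0 : R) 1 (fun h => h * m) m.
  by apply: is_derive_eq; rewrite scaler0 add0r /GRing.scale /= mulr1.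
have dc : is_derive (0 : R) 1 (fun t => cos (t * pi / 2)) 0.
  rewrite (_ : (fun t => _) = cos \o (fun h => h * m)); last first.
    by apply/funext => t /=; rewrite /m mulrA.
  have hh := @is_derive1_comp _ cos (fun h => h * m) 0 _ _ (is_derive_cos (0 * m)) hm.
  apply: (is_derive_eq hh).
  by rewrite mul0r sin0 oppr0 mul0r.
have ds : is_derive (0 : R) 1 (fun t => sin (t * pi / 2)) m.
  rewrite (_ : (fun t => _) = sin \o (fun h => h * m)); last first.
    by apply/funext => t /=; rewrite /m mulrA.
  have hh := @is_derive1_comp _ sin (fun h => h * m) 0 _ _ (is_derive_sin (0 * m)) hm.
  apply: (is_derive_eq hh).
  by rewrite mul0r cos0 mul1r.
apply: is_derive_eq (is_deriveD (is_deriveD (is_deriveZ a (is_deriveM dc dc))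
  (is_deriveZ b (is_deriveM dc ds))) (is_deriveZ d (is_deriveM ds ds))) _.
by rewrite !mul0r cos0 sin0 !scaler0 !scale0r !addr0 scaler0 scale1r scaler0 addr0 add0r.
Qed.

(** * The generator of gamma: its blocks and its norm *)

Section Gamma.
Context {R : realType} {H : hilbertType R}.
Implicit Types (x y w : H).
Variables (P Q E X : bop H) (u v : H -> H) (g : R -> bop H).
Local Notation kappa := (pi / 2 : R).
Local Notation Z := (X * P - P * X).
Hypotheses (PP : P * P = P) (sP : adjoint P P) (QQ : Q * Q = Q) (sQ : adjoint Q Q).
Hypotheses (tX : tangent P X) (gX : forall t, g t = geod P X t) (g1 : g 1 = Q).
Hypothesis (uiso : isometric_iso (H01 P Q) (H10 P Q) u).
Hypothesis (uv : adjoint_between (H01 P Q) (H10 P Q) u v).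
Hypothesis (blocks : forall t : R, 0 <= t <= 1 ->
      let c := (cos (t * pi / 2))%:C in let s := (sin (t * pi / 2))%:C in
      [/\ forall x, H11 P Q x -> g t x = x,
          forall x, H00 P Q x -> g t x = 0
        & forall x y, H10 P Q x -> H01 P Q y ->
          g t (x + y) = (c ^+ 2 *: x + (c * s) *: u y)
                      + ((s * c) *: v x + s ^+ 2 *: y)]).
Hypotheses (projE : orthoprojection (H0 P Q) E) (Eg : forall t, E * g t = g t * E).
Hypothesis (len : (curve_length (fun t => (g t * E)%R) <= (pi / 2)%:E)%E).

Let dg : is_derive (0 : R) 1 g X.
Proof. by rewrite (funext gX); exact: is_derive_geod0. Qed.

Let tangent_block x y : (forall t : R, 0 <= t <= 1 -> g t x = y) -> X x = 0.
Proof.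
move=> h; apply: rdot_eq0 => w.
apply: (is_derive_right (is_derive_rdot x w dg) (is_derive_cst (rdot y w) (0 : R) 1)) => t t01.
by rewrite h.
Qed.

Lemma gamma_tangent_ker x : P x = Q x -> X x = 0.
Proof.
move=> /(ker_sub_decomp PP QQ)[h1 h2]; rewrite -[x](subrK (P x)) raddfD /=.
rewrite (@tangent_block (P x) (P x)); last by move=> t /blocks[h _ _]; exact: h.
by rewrite (@tangent_block (x - P x) 0) ?addr0// => t /blocks[_ h _]; exact: h.
Qed.

Lemma gamma_tangent_prime x y : H10 P Q x -> H01 P Q y ->
  X (x + y) = kappa%:C *: (u y + v x).
Proof.
move=> hx hy; apply: rdot_inj => w; rewrite rdotZl.
rewrite mulrC; apply: (is_derive_right (is_derive_rdot (x + y) w dg)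
  (is_derive_trig_quad (rdot x w) (rdot (u y + v x) w) (rdot y w))) => t /blocks[_ _ ->//].
rewrite -!rmorphXn -!rmorphM /= !rdotE; ring.
Qed.

Let u_add x y : H01 P Q x -> H01 P Q y -> u (x + y) = u x + u y.
Proof. by move=> hx hy; have [_ /(_ 1 x y hx hy)] := uiso; rewrite !scale1r. Qed.

Let H01_0 : H01 P Q 0.
Proof. by split; rewrite /ker /ran /= ?raddf0//; exists 0; rewrite // raddf0. Qed.
Let H10_0 : H10 P Q 0.
Proof. by split; rewrite /ker /ran /= ?raddf0//; exists 0; rewrite // raddf0. Qed.
Lemma H01D x y : H01 P Q x -> H01 P Q y -> H01 P Q (x + y).
Proof.
move=> [a b] [c d]; split; first by rewrite /ker /= raddfD /= a c addr0.
by exists (x + y) => //; rewrite raddfD /= (ran_id QQ b) (ran_id QQ d).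
Qed.
Lemma H01N x : H01 P Q x -> H01 P Q (- x).
Proof.
move=> [a b]; split; first by rewrite /ker /= raddfN /= a oppr0.
by exists (- x) => //; rewrite raddfN /= (ran_id QQ b).
Qed.

Let u_rdot x y : H01 P Q x -> H01 P Q y -> rdot (u x) (u y) = rdot x y.
Proof.
move=> hx hy; have [_ _ un _] := uiso.
have n z : H01 P Q z -> rnorm (u z) = rnorm z by move=> hz; rewrite /rnorm un.
have := n _ (H01D hx hy); move/(congr1 (fun a => a ^+ 2)).
by rewrite u_add// !rnorm_sqrD !n//; lra.
Qed.

Let u0 : u 0 = 0.
Proof. by have := u_add H01_0 H01_0; rewrite addr0 -{1}[u 0]addr0 => /addrI. Qed.

Let uv_rdot x y : H01 P Q x -> H10 P Q y -> rdot (u x) y = rdot x (v y).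
Proof. by move=> hx hy; have [_ h] := uv; rewrite /rdot h. Qed.

Let v0 : v 0 = 0.
Proof.
have [hv _] := uv; apply: rdotxx_eq0.
by rewrite -uv_rdot ?rdot0r//; exact: hv.
Qed.

(** By polarization [u] preserves [rdot], so its adjoint [v] inverts it from the left. *)
Let vu y : H01 P Q y -> v (u y) = y.
Proof.
move=> hy; have [hu _ _ _] := uiso; have [hv _] := uv.
apply/eqP; rewrite -subr_eq0; apply/eqP/rdotxx_eq0; set d := v (u y) - y.
have hd : H01 P Q d by apply: H01D; [apply: hv; exact: hu|exact: H01N].
by rewrite {2}/d rdotBr -uv_rdot ?u_rdot ?subrr//; exact: hu.
Qed.

Lemma gamma_tangent_sqr x : P x + Q x = x -> X (X x) = (kappa ^+ 2)%:C *: x.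
Proof.
move=> /(ker_add_decomp PP QQ)[h1 h2]; have [hu _ _ us] := uiso; have [hv _] := uv.
have Xy y : H01 P Q y -> X y = kappa%:C *: u y.
  by move=> hy; have := gamma_tangent_prime H10_0 hy; rewrite add0r v0 addr0.
have Xx y : H10 P Q y -> X y = kappa%:C *: v y.
  by move=> hy; have := gamma_tangent_prime hy H01_0; rewrite addr0 u0 add0r.
have XXy y : H01 P Q y -> X (X y) = (kappa ^+ 2)%:C *: y.
  move=> hy; rewrite (Xy y hy) bop_funZ Xx ?vu//; last exact: hu.
  by rewrite scalerA -rmorphM.
have xd : x = (x - P x) + P x by rewrite subrK.
move: h2 xd; set d := x - P x; clearbody d => h2 ->.
rewrite !raddfD /= XXy//; congr (_ + _).
(* Surjectivity of [u] writes a vector of H10 as u y, where v u = 1 can be used. *)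
have [y hy <-] := us _ h1.
rewrite (Xx (u y)); last exact: hu.
by rewrite vu// bop_funZ Xy// scalerA -rmorphM.
Qed.

Let EP : E * P = P * E.
Proof. by have := Eg 0; rewrite gX geod0. Qed.
Let EQ : E * Q = Q * E.
Proof. by have := Eg 1; rewrite g1. Qed.
Let EX : E * X = X * E.
Proof.
by symmetry; apply: (is_derive_commute dg); apply: filterE => s; rewrite Eg.
Qed.
Let EZ : E * Z = Z * E.
Proof. by rewrite mulrBr mulrBl !mulrA EX EP -!mulrA EP EX. Qed.

Let sE : adjoint E E.
Proof. exact: orthoprojection_adj projE. Qed.
Let EE : E * E = E.
Proof. by apply: orthoprojection_idem projE => x y; exact: orthB. Qed.
Let sZ : skewadj Z.
Proof. exact: tangent_skewadj. Qed.

(** The velocity at time t is X E conjugated by a unitary, so the speed is constant and the length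
    over [0, 1] equals |X E|. *)
Let norm_XE : `|X * E| <= kappa.
Proof.
have dgE t : derive1 (fun t => g t * E) t =
    opexp (t *: Z) * (X * E) * opexp (- (t *: Z)).
  rewrite derive1E; have dt : is_derive t 1 g (opexp (t *: Z) * X * opexp (- (t *: Z))).
    by rewrite (funext gX); exact: is_derive_geod.
  have [_ ->] := bop_is_deriveMr E dt.
  have h : opexp (- (t *: Z)) * E = E * opexp (- (t *: Z)).
    by apply: comm_opexp; rewrite mulNr mulrN -bop_scaleAl -bop_scaleAr EZ.
  by rewrite -mulrA h !mulrA.
have sZt t : skewadj (t *: Z) by exact: skewadjZ.
have nd t : `|derive1 (fun t => g t * E) t| = `|X * E|.
  rewrite dgE.
  rewrite (@bop_norm_isometryr _ _ (opexp (- (t *: Z))) (opexp (t *: Z))); last 3 first.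
  - by apply: adjointC; exact: adjoint_opexp_skewadj.
  - exact: opexpNr.
  - exact: opexpNl.
  rewrite (@bop_norm_isometryl _ _ (opexp (t *: Z)) (opexp (- (t *: Z))))//.
    exact: adjoint_opexp_skewadj.
  exact: opexpNl.
move: len; rewrite /curve_length; under eq_integral do rewrite nd.
rewrite integral_cst//= lebesgue_measure_itv/= lte_fin ltr01 oppr0 adde0 mule1 lee_fin.
exact.
Qed.

Local Notation E' := (prime_proj P Q E).
Local Notation S := (P + Q - 1).

Lemma gamma_gen_full : Z * (1 - E) = Z * E'.
Proof.
apply: (prime_proj_full PP sP QQ sQ projE EP EQ) => x h.
rewrite -(opprK Z) (tangent_genE tX) -(tangent_refl tX) bop_oppE bop_mulE.
by rewrite gamma_tangent_ker// raddf0 oppr0.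
Qed.

Lemma gamma_gen_sqr : Z * Z * E' = - (kappa ^+ 2 *: E').
Proof.
rewrite (tangent_gen_sqr PP tX) mulNr; congr (- _); apply: bop_ext => x.
by rewrite bop_mulE bop_mulE gamma_tangent_sqr// (prime_projE PP sP QQ sQ projE EP EQ).
Qed.

Lemma gamma_rot : refl Q * refl P = opexp (2 *: Z).
Proof. by have := geod_refl PP tX 1; rewrite scale1r -gX g1. Qed.

(** 4 (P - Q)^2 = 2 - W - W^{-1} with W = e^{2Z}, so (P - Q)^2 commutes with Z. *)
Lemma gamma_prime_comm : E' * Z = Z * E'.
Proof.
apply: (prime_proj_commZ EZ).
have rr : refl P * refl Q = opexp (- (2 *: Z)).
  rewrite -[LHS]mulr1 -(opexpNr (2 *: Z)) -gamma_rot mulrA -(mulrA (refl P)).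
  by rewrite (mulrA (refl Q)) (refl_sqr QQ) mul1r (refl_sqr PP) mul1r.
have c1 : refl Q * refl P * Z = Z * (refl Q * refl P).
  by rewrite gamma_rot comm_opexp// -bop_scaleAl -bop_scaleAr.
have c2 : refl P * refl Q * Z = Z * (refl P * refl Q).
  by rewrite rr comm_opexp// mulrN mulNr -bop_scaleAl -bop_scaleAr.
set M := (P - Q) * (P - Q).
have h : M + M + (M + M) = 1 + 1 - refl P * refl Q - refl Q * refl P.
  apply/eqP; rewrite -subr_eq0; apply/eqP.
  pose K := P * P - P + (Q * Q - Q).
  have -> : M + M + (M + M) - (1 + 1 - refl P * refl Q - refl Q * refl P) = K + K + (K + K).
    by rewrite /M /K /refl; ncring.
  by rewrite /K PP QQ !subrr !addr0.
have h2 : (M + M + (M + M)) * Z = Z * (M + M + (M + M)).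
  rewrite h; move: (refl Q * refl P) (refl P * refl Q) c1 c2 => a b c1 c2.
  have -> : (1 + 1 - b - a) * Z = Z + Z - b * Z - a * Z by ncring.
  by rewrite c1 c2; ncring.
apply: bop_double_inj; apply: bop_double_inj.
have -> : M * Z + M * Z + (M * Z + M * Z) = (M + M + (M + M)) * Z by ncring.
by rewrite h2; ncring.
Qed.

(** Z x splits into orthogonal pieces: the length bounds the one from H0, Z multiplies norms by
    exactly kappa on H10 + H01, and Z vanishes on H11 + H00. *)
Lemma gamma_norm : `|Z| <= kappa.
Proof.
have k0 : 0 <= kappa by rewrite divr_ge0 ?pi_ge0.
have sE' : adjoint E' E' by exact: prime_proj_adj.
have EE' : E * E' = 0 by exact: prime_proj_orth.
have E'E' : E' * E' = E' by exact: prime_proj_idem.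
have nZE : `|Z * E| <= kappa.
  rewrite (tangent_genE tX) -mulrA.
  have -> : refl P * E = E * refl P by rewrite mulrBl mulrBr mulrDl mulrDr EP mulr1 mul1r.
  rewrite mulrA (@bop_norm_isometryr _ _ (refl P) (refl P))//; last 2 first.
  - exact: refl_sqr.
  - exact: refl_sqr.
  exact: refl_adj.
apply: bop_norm_le => // x; rewrite -(@ler_pXn2r _ 2) ?nnegrE ?mulr_ge0 ?rnorm_ge0 ?pi_ge0//.
have -> : Z x = (Z * E) (E x) + Z (E' x).
  rewrite -!bop_mulE -bop_addE; congr (bop_fun _ x).
  by rewrite -gamma_gen_full -(mulrA Z) EE; ncring.
have o1 : rdot ((Z * E) (E x)) (Z (E' x)) = 0.
  rewrite -!bop_mulE -mulrA EE -EZ -gamma_prime_comm bop_mulE.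
  have /adjointP -> := sE; rewrite -bop_mulE mulrA EE' mul0r bop_zeroE rdot0r//.
have o2 : rdot (E x) (E' x) = 0.
  by have /adjointP -> := sE; rewrite -bop_mulE EE' bop_zeroE rdot0r.
have n2 : rnorm (Z (E' x)) ^+ 2 = kappa ^+ 2 * rnorm (E' x) ^+ 2.
  rewrite -!rdotxx (skewadj_rdot _ _ sZ).
  have -> : Z (Z (E' x)) = (Z * Z * E') x by [].
  rewrite gamma_gen_sqr.
  by rewrite bop_oppE bop_scaleE rdotNr rdotZr opprK.
have n1 : rnorm ((Z * E) (E x)) ^+ 2 <= kappa ^+ 2 * rnorm (E x) ^+ 2.
  rewrite -exprMn ler_pXn2r ?nnegrE ?mulr_ge0 ?rnorm_ge0 ?pi_ge0//.
  by rewrite (le_trans (bop_normP _ _))// ler_wpM2r ?rnorm_ge0.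
have p1 : rdot x (E x) = rnorm (E x) ^+ 2.
  by rewrite -rdotxx; have /adjointP -> := sE; rewrite -bop_mulE EE.
have p2 : rdot x (E' x) = rnorm (E' x) ^+ 2.
  by rewrite -rdotxx; have /adjointP -> := sE'; rewrite -bop_mulE E'E'.
(* Bessel's inequality: |E x|^2 + |E' x|^2 <= |x|^2. *)
have := sqr_ge0 (rnorm (x - (E x + E' x))).
rewrite rnorm_sqrB rnorm_sqrD rdotDr p1 p2 o2 => px.
rewrite rnorm_sqrD o1 exprMn.
have := sqr_ge0 kappa; move: n1; rewrite n2; nra.
Qed.

Lemma gamma_rot_prime : refl Q * refl P * E' = - E'.
Proof.
have SE' : (P + Q - 1) * E' = 0 by exact: prime_proj_ker.
have rP : refl P * E' = - (refl Q * E').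
  apply/eqP; rewrite -addr_eq0 -mulrDl; apply/eqP.
  have -> : refl P + refl Q = (P + Q - 1) + (P + Q - 1) by rewrite /refl; ncring.
  by rewrite mulrDl SE' addr0.
by rewrite -mulrA rP mulrN mulrA refl_sqr// mul1r.
Qed.

Lemma gamma_rot_fix x : (refl Q * refl P) x = - x -> P x + Q x = x.
Proof.
move=> h; have h1 : refl P x = - refl Q x.
  have : refl Q ((refl Q * refl P) x) = refl Q (- x) by rewrite h.
  by rewrite raddfN => <-; rewrite -[refl P x]bop_oneE -(refl_sqr QQ).
have : (refl P + refl Q) x = 0 by rewrite bop_addE h1 addNr.
have -> : refl P + refl Q = 2 *: (P + Q - 1) by rewrite scaler_nat mulr2n /refl; ncring.
rewrite bop_scaleE => /eqP; rewrite scaler_eq0 => /orP[|].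
  by move=> /eqP/complexI/eqP; rewrite pnatr_eq0.
by rewrite bop_subE bop_addE bop_oneE subr_eq0 => /eqP.
Qed.

End Gamma.

(** * Jacobi fields *)

Section Necessity.
Context {R : realType} {H : hilbertType R}.
Implicit Types (x y w : H).
Variables (P Q E X : bop H) (g : R -> bop H).
Local Notation kappa := (pi / 2 : R).
Local Notation Z := (X * P - P * X).
Hypotheses (PP : P * P = P) (sP : adjoint P P) (QQ : Q * Q = Q) (sQ : adjoint Q Q).
Hypotheses (tX : tangent P X) (gX : forall t, g t = geod P X t) (g1 : g 1 = Q).
Hypotheses (Zpi : `|Z| <= kappa) (EE : E * E = E) (sE : adjoint E E).
Hypotheses (EZ : E * Z = Z * E) (PE : P * E = E * P).
Hypotheses (ZZE : Z * Z * E = - (kappa ^+ 2 *: E)).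
Hypotheses (WE : refl Q * refl P * E = - E).
Hypotheses (Efix : forall x, (refl Q * refl P) x = - x -> E x = x).
Hypotheses (projE : forall x, P (E x) + Q (E x) = E x).

(** The initial velocity of G s is the partial derivative of G in t at t = 0, so the velocity of Xs
    is a mixed second derivative of G. *)
Lemma derive_tangent_field (G : R -> R -> bop H) (e : R) : 0 < e ->
  smooth_on [set p : R * R | `|p.1| < e] (fun p => G p.1 p.2) ->
  (forall s, `|s| < e -> geodesic P (G s) /\ G s 0 = P) ->
  exists Xs X1, is_derive (0 : R) 1 Xs X1 /\
    forall s, `|s| < e -> tangent P (Xs s) /\ forall t, G s t = geod P (Xs s) t.
Proof.
move=> e0 smG hG; pose F (p : R * R) := G p.1 p.2.
pose Xs (s : R) := 'D_(0 : R, 1 : R) F (s, 0).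
(* Class C^2 is enough: first the direction of t, then that of s. *)
have [_ /(_ (0, 1)) [_ [_ /(_ (1, 0)) [/(_ (0, 0)) dX _]]]] := smG 2.
have {}dX : derivable ('D_(0 : R, 1 : R) F) (0 : R, 0 : R) (1, 0).
  by apply: dX; rewrite /= normr0.
exists Xs, ('D_(1 : R, 0 : R) ('D_(0 : R, 1 : R) F) (0, 0)); split.
  have pE (h : R) : h *: ((1 : R), (0 : R)) + (0, 0) = (h, 0) :> R * R.
    by apply: injective_projections; rewrite /= addr0 ?scaler0 // /GRing.scale /= mulr1.
  have /is_derive_line := DeriveDef dX erefl.
  by rewrite (_ : (fun h => _) = Xs)//; apply/funext => h; rewrite pE.
move=> s se; have [gs s0] := hG s se.
have [X' tX' hX'] := geodesic_tangent s0 gs.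
have -> : Xs s = X'; last by split.
have d1 : is_derive (s, 0 : R) (0 : R, 1 : R) F X'.
  apply/is_derive_line.
  rewrite (_ : (fun h => _) = geod P X'); first exact: is_derive_geod0.
  apply/funext => h; rewrite -hX' /F /= /GRing.scale /= mulr0 mulr1 add0r addr0.
  by [].
by case: d1 => _ h; exact: h.
Qed.

Lemma jacobi_field_bracket (J : `[0%R, 1%R]%classic -> bop H) : g 0 = P ->
  jacobi_field P g J -> exists B : bop H,
    [/\ skewadj B, P * B = 0, Q * B = B & forall t, J t = B * g (val t) - g (val t) * B].
Proof.
move=> g0 [e [G [e0 [smG hG G0 hJ]]]].
have [s se|Xs [X1 [dX hX]]] := derive_tangent_field e0 smG.
  by have [gs -> _] := hG s se; rewrite g0.
have Xs0 : Xs 0 = X.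
  have [|tX0 h] := hX 0; first by rewrite normr0.
  have d1 : is_derive (0 : R) 1 (G 0) (Xs 0) by rewrite (funext h); exact: is_derive_geod0.
  have d2 : is_derive (0 : R) 1 (G 0) X.
    by rewrite (funext G0) (funext gX); exact: is_derive_geod0.
  exact: is_derive_uniq d1 d2.
pose Zs s := Xs s * P - P * Xs s; pose V := X1 * P - P * X1.
have Zs0 : Zs 0 = Z by rewrite /Zs Xs0.
have dZ : is_derive (0 : R) 1 Zs V.
  exact: is_deriveB (bop_is_deriveMr P dX) (bop_is_deriveMl P dX).
have ne : \forall s \near (0 : R), `|s| < e.
  exact: nbhs0_lt.
have sZs : \forall s \near (0 : R), skewadj (Zs s).
  by apply: filterS ne => s /hX[tXs _]; exact: tangent_skewadj.
have WZs : \forall s \near (0 : R), opexp (2 *: Zs s) = refl Q * refl P.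
  apply: filterS ne => s se; have [tXs hs] := hX s se.
  have := geod_refl PP tXs 1; rewrite -hs scale1r => <-.
  by have [_ _ ->] := hG s se; rewrite g1.
have WZ : refl Q * refl P = opexp (2 *: Z).
  by have := nbhs_singleton WZs; rewrite Zs0.
have sV : skewadj V by exact: is_derive_skewadj dZ sZs.
have VW : V * (refl Q * refl P) = refl Q * refl P * V.
  apply: (is_derive_commute dZ); apply: filterS WZs => s <-.
  by rewrite comm_opexp// -bop_scaleAl -bop_scaleAr.
have eV : refl P * V = - (V * refl P).
  have d1 := bop_is_deriveMl (refl P) dZ.
  have d2 := is_deriveN (bop_is_deriveMr (refl P) dZ).
  apply: is_derive_uniq d1 _; apply: near_eq_is_derive _ d2.
  by apply: filterS ne => s /hX[tXs _]; rewrite tangent_gen_refl.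
have sZ : skewadj Z by exact: tangent_skewadj.
have eZ := tangent_gen_refl tX.
have eE : refl P * E = E * refl P by rewrite mulrBl mulrBr mulrDl mulrDr PE mulr1 mul1r.
pose B0 := halfturn_gen kappa Z E V.
have eB0 : refl P * B0 = B0 * refl P by exact: halfturn_gen_comm.
have PB0 : P * B0 = B0 * P by exact: refl_comm.
have k0 : 0 < kappa by rewrite divr_gt0 ?pi_gt0.
have sB0 : skewadj B0 by exact: (halfturn_gen_skewadj _ sZ sE WE Efix sV VW).
have EB0 : E * B0 = B0 by exact: (halfturn_gen_suppl _ EE sE EZ WE Efix sV VW).
have ZB0 : Z * B0 = - (B0 * Z) by exact: (halfturn_gen_anti sE EZ ZZE WE Efix sV VW).
(* This is B0 - eps B0 = 2 (1 - P) B0. It is killed by P and has its range in that of [E], hence in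
   H01. *)
pose B := B0 - P * B0 + (B0 - P * B0).
have PB : P * B = 0 by rewrite mulrDr !mulrBr mulrA PP subrr addr0.
have EB : E * B = B by rewrite mulrDr !mulrBr mulrA -PE -mulrA EB0.
exists B; split => //.
- have h : adjoint (B0 - P * B0) (- (B0 - P * B0)).
    rewrite opprD opprK; apply: adjointD => //; rewrite -[X in adjoint _ X]opprK.
    by apply: adjointN; have := adjointM sP sB0; rewrite mulNr PB0.
  by rewrite /skewadj opprD; exact: adjointD.
- apply: bop_ext => x; have := projE (B x).
  have -> : E (B x) = B x by rewrite -bop_mulE EB.
  by rewrite -bop_mulE PB bop_zeroE add0r.
move=> t; rewrite hJ derive1E.
have d1 : is_derive (0 : R) 1 (fun s => G s (val t)) (B0 * g (val t) - g (val t) * B0).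
  have := is_derive_geodesic_variation k0 sZ Zpi EE sE EZ ZZE WE Efix WZ dZ Zs0 sZs WZs PB0 (val t).
  rewrite -geodE -gX; apply: near_eq_is_derive.
  by apply: filterS ne => s /hX[_ ->].
have [_ ->] := d1.
(* The correction eps B0 leaves the field unchanged: both factors anticommute with Z and commute
   with P, so the product commutes with gamma. *)
have C : (refl P * B0) * g (val t) = g (val t) * (refl P * B0).
  set C := refl P * B0.
  have CZ : C * Z = Z * C.
    have BZ : B0 * Z = - (Z * B0) by rewrite ZB0 opprK.
    rewrite /C -(mulrA _ B0) BZ mulrN (mulrA _ Z) eZ mulNr opprK -(mulrA Z) //.
  have CP : C * P = P * C.
    by rewrite /C -mulrA -PB0 !mulrA; congr (_ * _); rewrite /refl; ncring.
  have Ce (a : R) : C * opexp (a *: Z) = opexp (a *: Z) * C.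
    by rewrite comm_opexp// -bop_scaleAl -bop_scaleAr CZ.
  clearbody C; rewrite gX geodE -(scaleNr (val t)).
  by rewrite !mulrA Ce -(mulrA _ C P) CP mulrA -(mulrA _ C) Ce !mulrA.
have -> : B = B0 - refl P * B0 by rewrite /B /refl; ncring.
by rewrite mulrBl mulrBr C; ncring.
Qed.

End Necessity.

(** * Smoothness of rotated geodesics *)

Section Smooth.
Context {R : realType} {H : hilbertType R}.
Implicit Types (A B M Z : bop H) (F : R * R -> bop H).

Lemma Ck_on_sub (U V : normedModType R) (D D' : set U) k (F : U -> V) :
  D `<=` D' -> Ck_on D' k F -> Ck_on D k F.
Proof.
move=> DD; elim: k F => [|k IH] F [cF hF]; (split; first by move=> p /DD; exact: cF) => //.
move=> v; have [dF kF] := hF v; split; first by move=> p /DD; exact: dF.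
exact: IH.
Qed.

Lemma Ck_on_add F G k : Ck_on setT k F -> Ck_on setT k G ->
  Ck_on setT k (fun p => F p + G p).
Proof.
elim: k F G => [|k IH] F G [cF hF] [cG hG].
  by split=> // p _; apply: continuousD; [exact: cF|exact: cG].
split=> [p _|v]; first by apply: continuousD; [exact: cF|exact: cG].
have [dF kF] := hF v; have [dG kG] := hG v.
split=> [p _|]; first by apply: derivableD; [exact: dF|exact: dG].
have -> : 'D_v (fun p => F p + G p) = fun p => 'D_v F p + 'D_v G p.
  by apply/funext => p; rewrite -deriveD//; [exact: dF|exact: dG].
exact: IH.
Qed.

Lemma Ck_on_comp (L : bop H -> bop H) :
  (forall f A, is_derive (0 : R) 1 f A -> is_derive (0 : R) 1 (L \o f) (L A)) ->
  (forall A, {for A, continuous L}) ->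
  forall k F, Ck_on setT k F -> Ck_on setT k (L \o F).
Proof.
move=> dL cL; elim=> [|k IH] F [cF hF].
  by split=> // p _; apply: continuous_comp; [exact: cF|exact: cL].
split=> [p _|v]; first by apply: continuous_comp; [exact: cF|exact: cL].
have [dF kF] := hF v.
have dLF p : is_derive p v (L \o F) (L ('D_v F p)).
  apply/is_derive_line; apply: (dL (fun h => F (h *: v + p))).
  exact: (proj1 (is_derive_line F p v _) (DeriveDef (dF p I) erefl)).
split=> [p _|]; first by have [] := dLF p.
have -> : 'D_v (L \o F) = L \o 'D_v F by apply/funext => p; have [_ ->] := dLF p.
exact: IH.
Qed.

Lemma continuous_bopMl B A : {for A, continuous (fun M => B * M)}.
Proof.
rewrite /prop_for /continuous_at; apply: (@bop_cvgM _ _ _ (nbhs A) _ (fun=> B) id).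
  exact: cvg_cst.
exact: cvg_id.
Qed.

Lemma continuous_bopMr B A : {for A, continuous (fun M => M * B)}.
Proof.
rewrite /prop_for /continuous_at; apply: (@bop_cvgM _ _ _ (nbhs A) _ id (fun=> B)).
  exact: cvg_id.
exact: cvg_cst.
Qed.

Lemma Ck_on_mull B k F : Ck_on setT k F -> Ck_on setT k (fun p => B * F p).
Proof.
move=> h; apply: (@Ck_on_comp (fun M => B * M)) h => [f A|A].
  exact: bop_is_deriveMl.
exact: continuous_bopMl.
Qed.

Lemma Ck_on_mulr B k F : Ck_on setT k F -> Ck_on setT k (fun p => F p * B).
Proof.
move=> h; apply: (@Ck_on_comp (fun M => M * B)) h => [f A|A].
  exact: bop_is_deriveMr.
exact: continuous_bopMr.
Qed.

Lemma Ck_on_scale (a : R) k F : Ck_on setT k F -> Ck_on setT k (fun p => a *: F p).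
Proof.
move=> h; have := @Ck_on_mull (a *: (1 : bop H)) _ _ h.
by under eq_fun do rewrite -bop_scaleAl mul1r.
Qed.

Lemma is_derive_opexp_affine A (a c : R) :
  is_derive (0 : R) 1 (fun h => opexp ((h * a + c) *: A)) (a *: A * opexp (c *: A)).
Proof.
have := bop_is_deriveMr (opexp (c *: A)) (is_derive_opexp0 (a *: A)).
rewrite (_ : (fun h => _) = (fun h => opexp ((h * a + c) *: A)))//.
apply/funext => h; rewrite scalerDl opexpD ?scalerA//.
by rewrite -!bop_scaleAl -!bop_scaleAr !scalerA mulrC.
Qed.

(** The middle operator M is kept general because differentiating in the second variable replaces M
    by Z M - M Z. Derivatives are then combinations of such maps, and induction on the order of
    smoothness goes through. *)
Definition conj_flow B Z M (p : R * R) :=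
  opexp (p.1 *: B) * (opexp (p.2 *: Z) * M * opexp (p.2 *: - Z)) * opexp (p.1 *: - B).

Lemma opexp_scale_comm A (c : R) : A * opexp (c *: A) = opexp (c *: A) * A.
Proof. by symmetry; apply: comm_opexp; rewrite -bop_scaleAl -bop_scaleAr. Qed.

Lemma is_derive_conj_flow B Z M p v : is_derive p v (conj_flow B Z M)
  (v.1 *: (B * conj_flow B Z M p - conj_flow B Z M p * B) +
   v.2 *: conj_flow B Z (Z * M - M * Z) p).
Proof.
apply/is_derive_line; case: p => p1 p2; case: v => v1 v2 /=.
have d := bop_is_deriveM (bop_is_deriveM (is_derive_opexp_affine B v1 p1)
  (bop_is_deriveM (bop_is_deriveMr M (is_derive_opexp_affine Z v2 p2))
    (is_derive_opexp_affine (- Z) v2 p2))) (is_derive_opexp_affine (- B) v1 p1).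
apply: (is_derive_eq d); rewrite !mul0r !add0r /conj_flow /=.
have cB := opexp_scale_comm (- B) p1; have cZ := opexp_scale_comm Z p2.
set a := opexp (p1 *: B); set a' := opexp (p1 *: - B) in cB *.
set b := opexp (p2 *: Z) in cZ *; set b' := opexp (p2 *: - Z).
have E1 : v1 *: B * a = v1 *: (B * a) by rewrite bop_scaleAl.
have E2 : v1 *: - B * a' = - (v1 *: (a' * B)).
  by rewrite -bop_scaleAl cB mulrN scalerN.
have E3 : v2 *: Z * b = v2 *: (b * Z) by rewrite -bop_scaleAl cZ.
have E4 : v2 *: - Z * b' = - (v2 *: (Z * b')) by rewrite -bop_scaleAl mulNr scalerN.
rewrite E1 E2 E3 E4.
have -> : v2 *: (b * Z) * M * b' + b * M * - (v2 *: (Z * b')) =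
    v2 *: (b * (Z * M - M * Z) * b').
  rewrite mulrN -!bop_scaleAl -bop_scaleAr -scalerBr; congr (_ *: _).
  by ncring.
rewrite mulrDl mulrN -!bop_scaleAr -!bop_scaleAl addrAC -scalerBr.
by congr (_ *: _ + _); ncring.
Qed.

Lemma continuous_conj_flow B Z M p : {for p, continuous (conj_flow B Z M)}.
Proof.
have ce A : continuous (fun t : R => opexp (t *: A)).
  by move=> t; apply: is_derive1_continuous (is_derive_opexp A t).
have c1 A : (fun q : R * R => opexp (q.1 *: A)) @ p --> opexp (p.1 *: A).
  by apply: (continuous_comp (@cvg_fst _ _ _ _ _) (ce A p.1)).
have c2 A : (fun q : R * R => opexp (q.2 *: A)) @ p --> opexp (p.2 *: A).
  by apply: (continuous_comp (@cvg_snd _ _ _ _ _) (ce A p.2)).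
by apply: bop_cvgM => //; apply: bop_cvgM => //; apply: bop_cvgM => //;
  apply: bop_cvgM => //; exact: cvg_cst.
Qed.

Lemma Ck_on_conj_flow B Z k M : Ck_on setT k (conj_flow B Z M).
Proof.
elim: k M => [|k IH] M; first by split=> // p _; exact: continuous_conj_flow.
split=> [p _|v]; first exact: continuous_conj_flow.
split=> [p _|]; first by have [] := is_derive_conj_flow B Z M p v.
have -> : 'D_v (conj_flow B Z M) = fun p =>
    v.1 *: (B * conj_flow B Z M p + - 1 *: (conj_flow B Z M p * B)) +
    v.2 *: conj_flow B Z (Z * M - M * Z) p.
  by apply/funext => p; have [_ ->] := is_derive_conj_flow B Z M p v; rewrite scaleN1r.
apply: Ck_on_add; apply: Ck_on_scale; last exact: IH.
apply: Ck_on_add; first exact: Ck_on_mull.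
by apply: Ck_on_scale; exact: Ck_on_mulr.
Qed.

End Smooth.

(** * Rotations fixing P and Q produce Jacobi fields *)

Section Sufficiency.
Context {R : realType} {H : hilbertType R}.

Lemma skewadj_ker_ran (P Q B : bop H) : adjoint P P -> adjoint Q Q -> skewadj B ->
  P * B = 0 -> Q * B = B -> B * P = 0 /\ B * Q = B.
Proof.
move=> sP sQ sB PB QB; split.
  have h := adjointM sP sB; rewrite PB in h.
  by have := adjoint_uniq h (@adjoint0 _ _) => /eqP; rewrite mulNr oppr_eq0 => /eqP.
have h := adjointM sQ sB; rewrite QB in h.
by have /eqP := adjoint_uniq h sB; rewrite mulNr eqr_opp => /eqP.
Qed.

Variables (P Q X : bop H) (g : R -> bop H).
Local Notation Z := (X * P - P * X).
Hypotheses (PP : P * P = P) (sP : adjoint P P) (sQ : adjoint Q Q).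
Hypotheses (tX : tangent P X) (gX : forall t, g t = geod P X t) (g1 : g 1 = Q).

(** B commutes with P and Q, so e^{sB} gamma e^{-sB} keeps both end points; it is the geodesic from
    P with initial velocity e^{sB} X e^{-sB}. *)
Lemma bracket_jacobi_field (B : bop H) : skewadj B -> P * B = 0 -> Q * B = B ->
  jacobi_field P g (fun t => B * g (val t) - g (val t) * B).
Proof.
move=> sB PB QB.
have [BP BQ] := skewadj_ker_ran sP sQ sB PB QB.
pose U s := opexp (s *: B); pose V s := opexp (- (s *: B)).
have UV s : U s * V s = 1 by exact: opexpNr.
have VU s : V s * U s = 1 by exact: opexpNl.
have sU s : adjoint (U s) (V s) by apply: adjoint_opexp_skewadj; exact: skewadjZ.
have UP s : U s * P = P * U s by apply: comm_opexp; rewrite -bop_scaleAl -bop_scaleAr PB BP.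
have UQ s : U s * Q = Q * U s by apply: comm_opexp; rewrite -bop_scaleAl -bop_scaleAr QB BQ.
pose G s t := U s * g t * V s.
have VP s : V s * P = P * V s.
  by apply: comm_opexp; rewrite mulNr mulrN -bop_scaleAl -bop_scaleAr PB BP.
have e1 s : U s * X * V s * P = U s * (X * P) * V s.
  by rewrite -(mulrA _ (V s)) VP; ncring.
have e2 s : P * (U s * X * V s) = U s * (P * X) * V s.
  have -> : P * (U s * X * V s) = P * U s * X * V s by ncring.
  by rewrite -UP; ncring.
exists 1, G; split=> //; split.
- move=> k; apply: (@Ck_on_sub _ _ _ _ setT) => //.
  rewrite (_ : (fun p => _) = conj_flow B Z P); first exact: Ck_on_conj_flow.
  by apply/funext => p; rewrite /G /conj_flow gX geodE !scalerN.
- move=> s _; split.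
  + exists P, (U s * X * V s); split.
    * by exists 1, 1; split; rewrite ?mulr1 ?mul1r.
    * have [sX hX] := tX; split.
        have := adjointM (adjointM (sU s) sX) (adjointC (sU s)).
        by rewrite mulrA.
      by rewrite e1 e2 -mulrDl -mulrDr hX.
    * move=> t; rewrite /G gX geodE /geod.
      have -> : U s * X * V s * P - P * (U s * X * V s) = U s * Z * V s.
        by rewrite e1 e2 -mulrBl -mulrBr.
      have e a : opexp (a *: (U s * Z * V s)) = U s * opexp (a *: Z) * V s.
        by rewrite -opexp_conj// -bop_scaleAr -bop_scaleAl.
      rewrite -!(scaleNr t) !e; set f := opexp (t *: Z); set f' := opexp (- t *: Z).
      have -> : U s * f * V s * P * (U s * f' * V s) = U s * f * (V s * P) * U s * f' * V s.
        by ncring.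
      rewrite VP; have -> : U s * f * (P * V s) * U s * f' * V s =
        U s * f * P * (V s * U s) * f' * V s by ncring.
      by rewrite VU; ncring.
  + by rewrite /G gX geod0 UP -mulrA UV mulr1.
  + by rewrite /G g1 UQ -mulrA UV mulr1.
- by move=> t; rewrite /G /U /V scale0r oppr0 opexp0 mulr1 mul1r.
- move=> t; rewrite derive1E.
  have d := bop_is_deriveM (bop_is_deriveMr (g (val t)) (is_derive_opexp B 0)) (is_derive_opexpN B 0).
  have [_ ->] := d.
  by rewrite scale0r oppr0 opexp0 !mulr1 mul1r mulrN.
Qed.

End Sufficiency.

(** * Skew-adjoint operators on a finite-dimensional space *)

Section RankOne.
Context {R : realType} {H : hilbertType R}.
Implicit Types (a b x y : H).

Lemma hdotZl (c : R[i]) x y : hdot (c *: x) y = c * hdot x y.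
Proof. by rewrite linearZl. Qed.
Lemma hdotZr (c : R[i]) x y : hdot x (c *: y) = Num.conj c * hdot x y.
Proof. by rewrite linearZr. Qed.
Lemma hdotC x y : hdot x y = Num.conj (hdot y x).
Proof. by rewrite hermC /= expr0 mul1r. Qed.
Lemma hdot_suml n (F : 'I_n -> H) y : hdot (\sum_i F i) y = \sum_i hdot (F i) y.
Proof.
by apply: (big_morph (fun x => hdot x y)) => [u v|]; [rewrite linearDl|rewrite linear0l].
Qed.

(** The factor 2 comes from bounding real and imaginary parts separately; it is harmless, since only
    boundedness of [rank_one] is at stake. *)
Lemma norm_hdot_le x y : `|hdot x y| <= (2 * (rnorm x * rnorm y))%:C.
Proof.
have nC (r : R) : `|r%:C| = `|r|%:C by rewrite normc_def /= expr0n addr0 sqrtr_sqr.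
have ni : `|('i)%C : R[i]| = 1.
  by rewrite normc_def /= expr0n expr1n add0r sqrtr1.
rewrite hdot_rdot [_ +i* _]complexE /= (le_trans (ler_normD _ _))// normrM !nC ni mul1r.
rewrite -rmorphD lecR mulrDl mul1r lerD ?rdot_abs//.
rewrite (le_trans (rdot_abs _ _))// ler_wpM2r ?rnorm_ge0//.
by rewrite -lecR !rnormE normrZ normrN ni mul1r.
Qed.
Lemma hdot_sumr n (F : 'I_n -> H) y : hdot y (\sum_i F i) = \sum_i hdot y (F i).
Proof. by rewrite hdotC hdot_suml rmorph_sum; apply: eq_bigr => i _; rewrite [RHS]hdotC. Qed.

Fact rank_one_linear a b : linear (fun x => hdot x b *: a).
Proof. by move=> c x y; rewrite linearDl /= hdotZl scalerDl scalerA. Qed.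

Fact rank_one_bounded a b : exists M : R, forall x, `|hdot x b *: a| <= M%:C * `|x|.
Proof.
apply: (@bop_bound_of _ _ _ (2 * (rnorm b * rnorm a))) => x.
rewrite -lecR !rnormE normrZ (le_trans (ler_wpM2r (normr_ge0 _) (norm_hdot_le _ _)))//.
by rewrite -!rnormE -rmorphM lecR le_eqVlt; apply/orP; left; apply/eqP; ring.
Qed.

Definition rank_one a b : bop H := Bop (rank_one_linear a b) (rank_one_bounded a b).

Lemma rank_oneE a b x : rank_one a b x = hdot x b *: a. Proof. by []. Qed.

Lemma rank_one_adj a b : adjoint (rank_one a b) (rank_one b a).
Proof. by move=> x y; rewrite !rank_oneE hdotZl hdotZr mulrC -hdotC. Qed.

End RankOne.

Section SkewDim.
Context {R : realType} {H : hilbertType R}.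
Variables (n : nat) (S : set H) (e : 'I_n -> H).
Hypothesis (efree : forall c : 'I_n -> R[i], \sum_i c i *: e i = 0 -> forall i, c i = 0).
Hypothesis (espan : forall v, S v <-> exists c : 'I_n -> R[i], v = \sum_i c i *: e i).

(** A basis given by [has_dim] need not be orthonormal. Its Gram matrix is invertible: a null vector
    yields a combination of the e_j orthogonal to each of them, hence to itself. *)
Lemma dual_basis : exists f : 'I_n -> H, forall i j, hdot (e i) (f j) = (i == j)%:R.
Proof.
pose G := \matrix_(i, j) hdot (e i) (e j).
have Gu : G \in unitmx.
  rewrite -row_free_unit -kermx_eq0; apply/eqP/row_matrixP => k; rewrite row0.
  set v := row k _; have vG : v *m G = 0 by rewrite /v -row_mul mulmx_ker row0.
  clearbody v.
  pose w := \sum_i v 0 i *: e i.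
  have we j : hdot w (e j) = 0.
    have := congr1 (fun A : 'rV_n => A 0 j) vG; rewrite !mxE => <-.
    by rewrite /w hdot_suml; apply: eq_bigr => i _; rewrite hdotZl mxE.
  have w0 : w = 0.
    apply: rdotxx_eq0; rewrite /rdot {2}/w hdot_sumr big1// => i _.
    by rewrite hdotZr we mulr0.
  by apply/rowP => i; rewrite (efree w0) mxE.
exists (fun j => \sum_l Num.conj (invmx G l j) *: e l) => i j.
have := congr1 (fun A : 'M[R[i]]_n => A i j) (mulmxV Gu); rewrite !mxE => <-.
by rewrite hdot_sumr; apply: eq_bigr => l _; rewrite hdotZr conjCK mxE mulrC.
Qed.

Local Notation w := (1 + 'i%C : R[i]).

(* The coefficient 1 + i lets one real n x n matrix a encode the anti-Hermitian matrix with
   entries (a_ij - a_ji) + i (a_ij + a_ji), see skew_coefE; no case split on i, j is needed. *)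
Definition skew_unit i j : bop H :=
  rank_one (w *: e i) (e j) - rank_one (e j) (w *: e i).

Lemma skew_unit_skewadj i j : skewadj (skew_unit i j).
Proof. by rewrite /skewadj opprB; apply: adjointB; exact: rank_one_adj. Qed.

Lemma span_sum (c : 'I_n -> R[i]) : S (\sum_i c i *: e i).
Proof. by apply/espan; exists c. Qed.

Definition skew_coef (a : 'I_n -> 'I_n -> R) i j : R[i] := (a i j)%:C * w - (a j i)%:C * Num.conj w.

Lemma skew_comb_apply (a : 'I_n -> 'I_n -> R) x :
  (\sum_i \sum_j a i j *: skew_unit i j) x =
  \sum_i \sum_j (skew_coef a i j * hdot x (e j)) *: e i.
Proof.
rewrite bop_sumE; under eq_bigr do rewrite bop_sumE.
transitivity (\sum_i \sum_j ((a i j)%:C * w * hdot x (e j)) *: e i -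
  \sum_i \sum_j ((a i j)%:C * Num.conj w * hdot x (e i)) *: e j).
  rewrite -sumrB; apply: eq_bigr => i _; rewrite -sumrB; apply: eq_bigr => j _.
  rewrite bop_scaleE bop_subE !rank_oneE hdotZr scalerBr !scalerA.
  by congr (_ *: _ - _ *: _); [rewrite mulrAC|rewrite mulrA].
rewrite [X in _ - X]exchange_big -sumrB; apply: eq_bigr => i _ /=.
rewrite -sumrB; apply: eq_bigr => j _.
by rewrite -scalerBl -mulrBl.
Qed.

Lemma skew_coefE (a : 'I_n -> 'I_n -> R) i j :
  skew_coef a i j = (a i j - a j i) +i* (a i j + a j i).
Proof.
rewrite /skew_coef; apply/eqP; rewrite eq_complex /=.
by apply/andP; split; apply/eqP; simpc => /=; ring.
Qed.

Variable f : 'I_n -> H.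
Hypothesis ef : forall i j, hdot (e i) (f j) = (i == j)%:R.

Lemma dual_coord v : S v -> v = \sum_i hdot v (f i) *: e i.
Proof.
move=> /espan[c vc]; rewrite {1}vc; apply: eq_bigr => i _; congr (_ *: _).
rewrite vc hdot_suml (bigD1 i)//= hdotZl ef eqxx mulr1 big1 ?addr0// => k ki.
by rewrite hdotZl ef (negbTE ki) mulr0.
Qed.

Lemma skew_comb_inj (a : 'I_n -> 'I_n -> R) :
  \sum_i \sum_j a i j *: skew_unit i j = 0 -> forall i j, a i j = 0.
Proof.
move=> h; have c0 i j : skew_coef a i j = 0.
  have := skew_comb_apply a (f j); rewrite h bop_zeroE.
  have -> : \sum_i \sum_j0 (skew_coef a i j0 * hdot (f j) (e j0)) *: e i =
      \sum_i skew_coef a i j *: e i.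
    apply: eq_bigr => k _; rewrite -scaler_suml; congr (_ *: _).
    rewrite (bigD1 j)//= hdotC ef eqxx rmorph1 mulr1 big1 ?addr0// => l lj.
    by rewrite hdotC ef (negbTE lj) rmorph0 mulr0.
  by move/esym/efree => ->.
move=> i j; have := c0 i j; rewrite skew_coefE => /eqP.
by rewrite eq_complex /= => /andP[/eqP h1 /eqP h2]; lra.
Qed.

(** The coefficients invert [skew_coefE]: if m is the anti-Hermitian matrix of B, then Re m_ij =
    a_ij - a_ji and Im m_ij = a_ij + a_ji. *)
Lemma skew_comb_span (B : bop H) : skewadj B -> (forall x, S (B x)) ->
  B = \sum_i \sum_j (((complex.Re (hdot (B (f j)) (f i)) +
                       complex.Im (hdot (B (f j)) (f i))) / 2) *: skew_unit i j).
Proof.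
move=> sB SB; apply: bop_ext => x; set a := fun i j => (complex.Re (hdot (B (f j)) (f i)) +
                       complex.Im (hdot (B (f j)) (f i))) / 2.
rewrite -/(a _ _) (skew_comb_apply a).
have cE i j : skew_coef a i j = hdot (B (f j)) (f i).
  rewrite skew_coefE /a; have -> : hdot (B (f i)) (f j) = - Num.conj (hdot (B (f j)) (f i)).
    by rewrite sB bop_oppE linearNr /= hdotC.
  by case: (hdot (B (f j)) (f i)) => p q /=; congr (_ +i* _); field.
(* B x is expanded in the basis; skew-adjointness moves B onto f i, and B (f i) is expanded in
   turn. *)
rewrite {1}(dual_coord (SB x)); apply: eq_bigr => i _.
rewrite -scaler_suml; congr (_ *: _).
rewrite sB bop_oppE linearNr /= {1}(dual_coord (SB (f i))) hdot_sumr -sumrN.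
apply: eq_bigr => j _; rewrite cE hdotZr -mulNr; congr (_ * _).
by rewrite [RHS]sB bop_oppE linearNr /= [in RHS]hdotC.
Qed.

End SkewDim.

Lemma skewadj_has_dim (R : realType) (H : hilbertType R) (S : set H) n :
  has_dim S n ->
  has_dim (F := R) [set B : bop H | skewadj B /\ forall x, S (B x)] (n * n).
Proof.
move=> [e [efree espan]]; have [f ef] := dual_basis efree.
(* Matrix vectorization enumerates the pairs (i, j) by ['I_(n * n)]. *)
have [pr prK Kpr] := @curry_mxvec_bij n n.
pose E k := let p := pr k in skew_unit e p.1 p.2.
have sumE (c : 'I_(n * n) -> R) : \sum_k c k *: E k =
    \sum_i \sum_j c (mxvec_index i j) *: skew_unit e i j.
  rewrite pair_bigA /= (reindex (uncurry (@mxvec_index n n))) /=; last first.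
    by exists pr => [p _|k _]; [rewrite prK|rewrite Kpr].
  apply: eq_bigr => -[i j] _ /=; rewrite /E.
  by have := prK (i, j); rewrite /= => ->.
exists E; split.
  move=> c; rewrite sumE => h k; case/mxvec_indexP: k => i j.
  exact: (skew_comb_inj efree ef h).
move=> B; split=> [[sB SB]|[c ->]].
  rewrite (skew_comb_span espan ef sB SB).
  pose a i j := (complex.Re (hdot (B (f j)) (f i)) + complex.Im (hdot (B (f j)) (f i))) / 2.
  exists (fun k => a (pr k).1 (pr k).2); rewrite sumE.
  apply: eq_bigr => i _; apply: eq_bigr => j _; congr (_ *: _).
  by have := prK (i, j); rewrite /= => ->.
rewrite sumE; split; last first.
  move=> x; rewrite skew_comb_apply; under eq_bigr do rewrite -scaler_suml.
  exact: span_sum.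
rewrite /skewadj -sumrN; elim/big_ind2 : _ => //; first exact: adjoint0.
  by move=> ? ? ? ?; exact: adjointD.
move=> i _; rewrite -sumrN; elim/big_ind2 : _ => //; first exact: adjoint0.
  by move=> ? ? ? ?; exact: adjointD.
by move=> j _; apply: skewadjZ; exact: skew_unit_skewadj.
Qed.

Lemma has_dim_image (F : fieldType) (U V : lmodType F) (S : set U) (T : set V)
    (L : U -> V) d : linear L -> (forall x, S x -> L x = 0 -> x = 0) ->
  T = L @` S -> has_dim S d -> has_dim T d.
Proof.
move=> Llin Linj -> [e [efree espan]].
pose L' : {linear U -> V} := HB.pack L (GRing.isLinear.Build F U V *:%R L Llin).
have LE (c : 'I_d -> F) : \sum_i c i *: L (e i) = L (\sum_i c i *: e i).
  by rewrite -[L]/(L' : U -> V) linear_sum; apply: eq_bigr => i _; rewrite linearZ.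
exists (fun i => L (e i)); split.
  move=> c; rewrite LE => h; apply: efree; apply: Linj h.
  by apply/espan; exists c.
move=> v; split=> [[x /espan[c ->] <-]|[c ->]]; first by exists c; rewrite LE.
by rewrite LE; exists (\sum_i c i *: e i) => //; apply/espan; exists c.
Qed.

(** * The space of Jacobi fields as an image of skew-adjoint operators *)

Section JacobiSpace.
Context {R : realType} {H : hilbertType R}.
Implicit Types (x y : H).
Local Notation I01 := (`[0%R, 1%R]%classic : set R).

Definition bracket_field (g : R -> bop H) (B : bop H) : I01 -> bop H :=
  fun t => B * g (val t) - g (val t) * B.

Lemma bracket_field_linear (g : R -> bop H) : linear (bracket_field g).
Proof.
move=> a A B; apply/funext => t; rewrite /bracket_field.
rewrite mulrDl mulrDr -bop_scaleAl -bop_scaleAr.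
rewrite [RHS]/GRing.add /= /GRing.scale /= scalerBr.
by ncring.
Qed.

Lemma jacobi_vanishing_bracket (P Q : bop H) u g :
  P * P = P -> adjoint P P -> Q * Q = Q -> adjoint Q Q ->
  isometric_iso (H01 P Q) (H10 P Q) u -> is_gamma P Q u g ->
  jacobi_vanishing P g 1 =
    bracket_field g @` [set B : bop H | skewadj B /\ forall x, H01 P Q (B x)] /\
  forall B : bop H, skewadj B /\ (forall x, H01 P Q (B x)) ->
    bracket_field g B = 0 -> B = 0.
Proof.
move=> PP sP QQ sQ uiso [geo g0 g1 [v uv blocks] [E [projE Eg _ _ len]]].
have [X tX gX] := geodesic_tangent g0 geo.
have EP : E * P = P * E by have := Eg 0; rewrite g0.
have EQ : E * Q = Q * E by have := Eg 1; rewrite g1.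
have H01P (B : bop H) : (forall x, H01 P Q (B x)) <-> P * B = 0 /\ Q * B = B.
  split=> [h|[h1 h2] x].
    split; apply: bop_ext => x; rewrite bop_mulE; have [h1 h2] := h x.
      exact: h1.
    exact: ran_id.
  split; first by rewrite /ker /= -bop_mulE h1.
  by exists (B x) => //; rewrite -bop_mulE h2.
split.
  apply/seteqP; split=> [J [jJ _]|J [B [sB SB] <-]].
    have fixE x : (refl Q * refl P) x = - x -> prime_proj P Q E x = x.
      by move=> /(gamma_rot_fix QQ); exact: prime_proj_fix.
    have [B [sB PB QB JB]] := jacobi_field_bracket PP sP tX gX g1
      (gamma_norm PP sP QQ sQ tX gX g1 uiso uv blocks projE Eg len)
      (prime_proj_idem PP sP QQ sQ projE EP EQ) (prime_proj_adj sP sQ projE EP EQ)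
      (gamma_prime_comm PP QQ tX gX g1 Eg) (prime_proj_commP PP QQ EP)
      (gamma_gen_sqr PP sP QQ sQ tX gX g1 uiso uv blocks projE Eg)
      (gamma_rot_prime PP sP QQ sQ gX g1 projE Eg) fixE
      (prime_projE PP sP QQ sQ projE EP EQ) g0 jJ.
    exists B; first by split => //; exact/H01P.
    by apply/funext => t; rewrite JB.
  have [PB QB] := (H01P B).1 SB; have [BP BQ] := skewadj_ker_ran sP sQ sB PB QB.
  split; first exact: (bracket_jacobi_field sP sQ tX gX g1).
  (* The field vanishes at both ends because B commutes with P and Q. *)
  by move=> t [tE|tE]; rewrite /bracket_field tE ?g0 ?g1 ?PB ?BP ?QB ?BQ subrr.
move=> B [sB SB] B0.
have [PB QB] := (H01P B).1 SB; have [BP BQ] := skewadj_ker_ran sP sQ sB PB QB.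
have dg : is_derive (0 : R) 1 g X by rewrite (funext gX); exact: is_derive_geod0.
(* The derivative at 0 of a bracket that vanishes on [0, 1]. *)
have BX : B * X - X * B = 0.
  have dB : is_derive (0 : R) 1 (fun t => B * g t - g t * B) (B * X - X * B).
    exact: is_deriveB (bop_is_deriveMl B dg) (bop_is_deriveMr B dg).
  apply: bop_eq_rdot => x y; rewrite bop_zeroE rdot0l.
  apply: (is_derive_right (is_derive_rdot x y dB) (is_derive_cst 0 (0 : R) 1)) => t t01.
  have tI : I01 t by rewrite /= in_itv.
  have h : B * g t - g t * B = 0 := congr1 (fun J => J (exist _ t (mem_set tI))) B0.
  by rewrite h bop_zeroE rdot0l.
(* For y = B x in H01, X y lies in the range of P, which B kills. Hence X (B y) = B (X y) = 0, and
   X^2 = kappa^2 on H01 gives B y = 0. *)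
have BB : B * B = 0.
  apply: bop_ext => x; rewrite bop_mulE; set y := B x.
  have hy : P y = 0 by rewrite /y -bop_mulE PB.
  have hQ : Q y = y by rewrite /y -bop_mulE QB.
  have XXy := gamma_tangent_sqr PP QQ tX gX uiso uv blocks (x := y).
  rewrite hy hQ add0r in XXy; have {}XXy := XXy erefl.
  have PXy : P (X y) = X y.
    have [_ tXe] := tX; have := congr1 (fun A : bop H => A y) tXe.
    by rewrite bop_addE !bop_mulE hy raddf0 add0r.
  have BXy : B (X y) = 0 by rewrite -PXy -bop_mulE BP.
  have XBy : X (B y) = 0.
    have := congr1 (fun A : bop H => A y) BX.
    by rewrite bop_subE !bop_mulE BXy sub0r bop_zeroE => /eqP; rewrite oppr_eq0 => /eqP.
  have XXBy := gamma_tangent_sqr PP QQ tX gX uiso uv blocks (x := B y).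
  rewrite -(bop_mulE P) -(bop_mulE Q) PB QB bop_zeroE add0r XBy raddf0 in XXBy.
  have {}XXBy := XXBy erefl.
  apply/eqP; have /eqP := XXBy; rewrite eq_sym scaler_eq0 => /orP[|//].
  by move/eqP/complexI/eqP; rewrite sqrf_eq0 mulf_eq0 invr_eq0 (gt_eqF (pi_gt0 R)) pnatr_eq0.
(* By skew-adjointness |B x|^2 = - <x, B (B x)>. *)
apply: bop_ext => x; apply: rdotxx_eq0.
by rewrite (skewadj_rdot _ _ sB) -bop_mulE BB rdot0r oppr0.
Qed.

End JacobiSpace.

(** * Graphs, and the dimension of H01 *)

Section Graphs.
Context {R : realType} {H : hilbertType R}.
Implicit Types (T : bop H) (P Q : bop (hprod H H)).

Lemma graphB T x y : graph T x -> graph T y -> graph T (x - y).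
Proof. by move=> [a ->] [b ->]; exists (a - b); rewrite raddfB. Qed.

Lemma invgraphB T x y : invgraph T x -> invgraph T y -> invgraph T (x - y).
Proof. by move=> [a ->] [b ->]; exists (a - b); rewrite raddfB. Qed.

(** A vector (T x, x) of the inverse graph is killed by P exactly when it is orthogonal to all (y,
    0), that is, when T x = 0. *)
Lemma H01_graph T P Q : orthoprojection (graph (0 : bop H)) P ->
  orthoprojection (invgraph T) Q ->
  H01 P Q = (fun x : H => (0, x) : hprod H H) @` ker T.
Proof.
move=> pP pQ; apply/seteqP; split=> [z [Pz Qz]|_ [x Tx <-]].
  have QQ := orthoprojection_idem (@invgraphB T) pQ.
  have [[x zx] _] := pQ z; rewrite (ran_id QQ Qz) in zx.
  have [_ oz] := pP z; rewrite [P z]Pz subr0 in oz.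
  have Tx : T x = 0.
    apply: rdotxx_eq0; have : hdot z ((T x, 0) : hprod H H) = 0.
      by apply: oz; exists (T x).
    by rewrite zx /= /hprod_dot /= linear0r addr0 /rdot => ->.
  by exists x => //; rewrite zx Tx.
split.
  apply: (orthoprojection_orth (@graphB 0) pP) => _ [y ->].
  by rewrite /= /hprod_dot /= linear0l linear0r addr0.
exists ((0, x) : hprod H H) => //.
apply: (orthoprojection_id (@invgraphB T) pQ).
by exists x; rewrite Tx.
Qed.

End Graphs.

Theorem theorem5p18 (R : realType) (H : hilbertType R) (T : bop H) (n : nat)
    (P Q : bop (hprod H H)) (u : hprod H H -> hprod H H)
    (gamma : R -> bop (hprod H H)) :
  fredholm T -> fredholm_index T 0 ->
  has_dim (ker T) n -> has_dim (orth (ran T)) n -> (0 < n)%N ->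
  orthoprojection (graph (0 : bop H)) P ->
  orthoprojection (invgraph T) Q ->
  isometric_iso (H01 P Q) (H10 P Q) u ->
  is_gamma P Q u gamma ->
  conjugate_parameter P gamma 1 /\ conjugate_index P gamma 1 (n ^ 2).
Proof.
move=> _ _ kerT _ n0 pP pQ uiso hg.
have PP := orthoprojection_idem (@graphB _ _ 0) pP.
have sP := orthoprojection_adj pP.
have QQ := orthoprojection_idem (@invgraphB _ _ T) pQ.
have sQ := orthoprojection_adj pQ.
have [JE Jinj] := jacobi_vanishing_bracket PP sP QQ sQ uiso hg.
have dH01 : has_dim (H01 P Q) n.
  apply: (has_dim_image _ _ (H01_graph pP pQ) kerT).
    by move=> a x y; congr pair; rewrite /= scaler0 addr0.
  by move=> x _ [].
have dJ : conjugate_index P gamma 1 (n ^ 2).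
  apply: (has_dim_image (bracket_field_linear gamma) Jinj JE).
  exact: skewadj_has_dim.
split=> //; split; first by rewrite /= in_itv /= ler01 lexx.
have [e [efree espan]] := dJ.
have k0 : (0 < n ^ 2)%N by rewrite expn_gt0 n0.
(* Since n > 0 the basis of the space of fields is nonempty, and its first vector is a non-trivial
   Jacobi field. *)
exists (e (Ordinal k0)); split.
  apply/espan; exists (fun i => (i == Ordinal k0)%:R).
  rewrite (bigD1 (Ordinal k0)) // eqxx scale1r big1 /= ?addr0 // => i /negbTE ->.
  by rewrite scale0r.
move=> e0; have := efree (fun i => (i == Ordinal k0)%:R) _ (Ordinal k0).
rewrite eqxx => /(_ _)/eqP; rewrite oner_eq0 => h; apply: notF; apply: h.
rewrite (bigD1 (Ordinal k0)) // eqxx scale1r e0 /= add0r big1 // => i /negbTE ->.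
by rewrite scale0r.
Qed.
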